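(* Let $\mathcal{H}_1,\mathcal{H}_2$ be separable complex Hilbert spaces. For $j=1,2$ let $T_j$ be a sectorial operator in $\mathcal{H}_j$ with $T_j^{-1}\in\mathcal{B}(\mathcal{H}_j)$. Let $S$ be a closed operator mapping $\operatorname{dom}(S)\subseteq\mathcal{H}_1$ into $\mathcal{H}_2$ with $\operatorname{dom}(S)\supseteq\operatorname{dom}(T_1)$ and $\operatorname{dom}(S^* )\supseteq\operatorname{dom}(T_2^* )$. Let $p\in[1,\infty)$ and assume $$ST_1^{-1}\in\mathcal{B}_p(\mathcal{H}_1,\mathcal{H}_2),\qquad S^*(T_2^* )^{-1}\in\mathcal{B}_p(\mathcal{H}_2,\mathcal{H}_1).$$ Assume that $T_j\in\mathrm{BIP}(N_j,\theta_j)$ for some $N_j\ge1$, $\theta_j\ge0$, $j=1,2$. Let $\overline{\Sigma}=\{z\in\mathbb{C}\mid\operatorname{Re}(z)\in[0,1]\}$. Then for every $z\in\overline{\Sigma}$ the operator $T_2^{-z}ST_1^{-1+z}$, defined on $\operatorname{dom}(T_1)$, is closable, and $$\overline{T_2^{-z}ST_1^{-1+z}}\in\mathcal{B}_p(\mathcal{H}_1,\mathcal{H}_2).$$ In addition, for every $k\in(0,\infty)$ and every $z\in\overline{\Sigma}$, $$\big\|\overline{T_2^{-z}ST_1^{-1+z}}\big\|_{\mathcal{B}_p(\mathcal{H}_1,\mathcal{H}_2)}\le N_1N_2\,e^{k(\operatorname{Im}(z))^2+k\operatorname{Re}(z)[1-\operatorname{Re}(z)]+(4k)^{-1}(\theta_1+\theta_2)^2}\,\big\|ST_1^{-1}\big\|_{\mathcal{B}_p(\mathcal{H}_1,\mathcal{H}_2)}^{1-\operatorname{Re}(z)}\,\big\|S^*(T_2^*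 )^{-1}\big\|_{\mathcal{B}_p(\mathcal{H}_2,\mathcal{H}_1)}^{\operatorname{Re}(z)},$$ and for every $x\in[0,1]$, $$\big\|\overline{T_2^{-x}ST_1^{-1+x}}\big\|_{\mathcal{B}_p(\mathcal{H}_1,\mathcal{H}_2)}\le N_1N_2\,e^{(\theta_1+\theta_2)[x(1-x)]^{1/2}}\,\big\|ST_1^{-1}\big\|_{\mathcal{B}_p(\mathcal{H}_1,\mathcal{H}_2)}^{1-x}\,\big\|S^*(T_2^* )^{-1}\big\|_{\mathcal{B}_p(\mathcal{H}_2,\mathcal{H}_1)}^{x}.$$
   Context: $\mathcal{B}(\mathcal{H})$ denotes the bounded everywhere-defined linear operators on $\mathcal{H}$; $\mathcal{B}_p(\mathcal{H}_1,\mathcal{H}_2)$, $p\in[1,\infty)$, denotes the $\ell^p$-based Schatten–von Neumann class of operators from $\mathcal{H}_1$ to $\mathcal{H}_2$ with its usual norm. An overline on an operator denotes its closure. Operator products are maximally defined, $\operatorname{dom}(AB)=\{f\in\operatorname{dom}(B)\mid Bf\in\operatorname{dom}(A)\}$, unless a domain is specified explicitly. Sectorial operators: for $\omega\in(0,\pi)$ let $S_\omega=\{z\in\mathbb{C}\setminus\{0\}\mid|\arg z|<\omega\}$ and $S_0=(0,\infty)$. A densely defined closed linear operator $T$ in $\mathcal{H}$ is sectorial if for some $\omega\in[0,\pi)$ one has $\sigma(T)\subseteq\overline{S_\omega}$ and $\sup_{z\in\mathbb{C}\setminus\overline{S_{\omega'}}}\|z(T-zI)^{-1}\|<\infty$ for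 all $\omega'\in(\omega,\pi)$. Powers: for $T$ sectorial with $T^{-1}\in\mathcal{B}(\mathcal{H})$ and $\operatorname{Re}(z)>0$, $T^{-z}=(2\pi i)^{-1}\int_\Gamma\zeta^{-z}(T-\zeta I)^{-1}d\zeta\in\mathcal{B}(\mathcal{H})$, with the principal branch of $\zeta^{-z}$ on $\mathbb{C}\setminus(-\infty,0]$ and $\Gamma\subset(\mathbb{C}\setminus(-\infty,0])\cap\rho(T)$ a contour surrounding $\sigma(T)$ clockwise. For $s\in\mathbb{R}$, $T^{is}f$ is the norm limit of $T^{-z}f$ as $z\to-is$ with $\operatorname{Re}(z)>0$, on the domain of all $f\in\mathcal{H}$ for which the limit exists. $T\in\mathrm{BIP}(N,\theta)$ (with $N\ge1$, $\theta\ge0$) means that $T$ is sectorial, $T^{-1}\in\mathcal{B}(\mathcal{H})$, $T^{is}\in\mathcal{B}(\mathcal{H})$ and $\|T^{is}\|_{\mathcal{B}(\mathcal{H})}\le Ne^{\theta|s|}$ for all $s\in\mathbb{R}$. *)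

(* Defs.v *)
From HB Require Import structures.
From mathcomp Require Import all_boot all_order all_algebra.
From mathcomp Require Import sesquilinear complex.
From mathcomp Require Import all_classical all_reals all_analysis.

Set Implicit Arguments.
Unset Strict Implicit.
Unset Printing Implicit Defensive.

Import Order.TTheory GRing.Theory Num.Theory.
Import numFieldNormedType.Exports.

Local Open Scope classical_set_scope.
Local Open Scope ring_scope.
Local Open Scope complex_scope.

(* The inner product is linear in its first argument. *)
Record hilbertType (R : realType) := HilbertType {
  hsort :> completeNormedModType R[i];
  hdot : {dot hsort for (@Num.conj R[i])};
  hdot_norm : forall x : hsort, `|x| ^+ 2 = hdot x x
}.

Arguments hdot {R h}.

Definition separable_space (X : topologicalType) : Prop :=
  exists2 D : set X, countable D & dense D.

(* The norm of R[i]-normed modules takes its values in R[i]. *)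
Definition hnorm (R : realType) (H : hilbertType R) (x : H) : R :=
  complex.Re `|x|.

Section Operators.
Variable R : realType.
Implicit Types H : hilbertType R.

(* A (possibly unbounded, partially defined) operator is represented by its
   graph. Composition and inversion are those of relation_scope: [B \; A] is
   the product "B after A" with its maximal domain, and [A^-1] the inverse. *)
Definition oper H1 H2 := set (H1 * H2).

Definition dom H1 H2 (A : oper H1 H2) : set H1 := fst @` A.

Definition linear_oper H1 H2 (A : oper H1 H2) : Prop :=
  [/\ A (0, 0),
      forall (a : R[i]) u v, A u -> A v -> A (a *: u + v) &
      forall f g h, A (f, g) -> A (f, h) -> g = h].

Definition closed_oper H1 H2 (A : oper H1 H2) : Prop :=
  linear_oper A /\ closed A.

(* [closure A] is then the graph of the closure of the operator. *)
Definition closable H1 H2 (A : oper H1 H2) : Prop :=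
  linear_oper A /\ linear_oper (closure A).

Definition restrict_dom H1 H2 (A : oper H1 H2) (D : set H1) : oper H1 H2 :=
  [set u | A u /\ D u.1].

Definition adjoint H1 H2 (A : oper H1 H2) : oper H2 H1 :=
  [set u | forall f g, A (f, g) -> hdot g u.1 = hdot f u.2].

Definition scale_oper H1 H2 (c : R[i]) (A : oper H1 H2) : oper H1 H2 :=
  [set u | exists2 g, A (u.1, g) & u.2 = c *: g].

Definition graph H1 H2 (B : H1 -> H2) : oper H1 H2 := [set u | u.2 = B u.1].

Definition opnorm H1 H2 (A : oper H1 H2) : \bar R :=
  ereal_sup [set (hnorm u.2)%:E | u in [set u | A u /\ hnorm u.1 <= 1]].

Definition bounded_oper H1 H2 (A : oper H1 H2) : Prop :=
  [/\ linear_oper A, dom A = setT & (opnorm A < +oo)%E].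

Definition compact_oper H1 H2 (A : oper H1 H2) : Prop :=
  bounded_oper A /\
  compact (closure (snd @` [set u | A u /\ hnorm u.1 <= 1])).

(* Singular values: the square roots of the nonzero eigenvalues of A^* A,
   counted with multiplicity in nonincreasing order, then extended by 0.
   Counting with multiplicity means that they are listed along an orthonormal
   family of eigenvectors whose orthogonal complement is the kernel of A. *)
Definition is_singular_values H1 H2 (A : oper H1 H2) (s : nat -> R) : Prop :=
  [/\ nonincreasing_seq s, forall n, 0 <= s n &
   exists e : nat -> H1,
   [/\ forall m n, 0 < s m -> 0 < s n -> hdot (e m) (e n) = (m == n)%:R,
       forall n, 0 < s n ->
         (adjoint A \; A)%relation (e n, (s n ^+ 2)%:C *: e n) &
       forall f, (forall n, 0 < s n -> hdot f (e n) = 0) -> A (f, 0)]].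

Definition singular_values H1 H2 (A : oper H1 H2) : nat -> R :=
  xget (fun=> 0) [set s | is_singular_values A s].

Definition schatten_norm H1 H2 (p : R) (A : oper H1 H2) : \bar R :=
  ('N[counting]_(p%:E) [EFin \o singular_values A])%E.

Definition schatten H1 H2 (p : R) (A : oper H1 H2) : Prop :=
  compact_oper A /\ (schatten_norm p A < +oo)%E.

End Operators.

Section ComplexFunctions.
Variable R : realType.
Implicit Types (z w : R[i]) (phi eps t r : R).

Definition cis t : R[i] := cos t +i* sin t.

Definition cexp z : R[i] := (expR (complex.Re z))%:C * cis (complex.Im z).

(* The principal argument, with values in ]-pi, pi] (for z <> 0). *)
Definition carg z : R :=
  let a := acos (complex.Re z / complex.Re `|z|) in
  if 0 <= complex.Im z then a else - a.

Definition clog z : R[i] := ln (complex.Re `|z|) +i* carg z.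

Definition cpow z w : R[i] := cexp (w * clog z).

Definition sector phi : set R[i]^o :=
  if phi == 0 then [set z : R[i] | 0 < z]
  else [set z : R[i] | z != 0 /\ `|carg z| < phi].

Definition cintegrable (D : set R) (F : R -> R[i]) : Prop :=
  lebesgue_measure.-integrable D (fun t => (complex.Re (F t))%:E) /\
  lebesgue_measure.-integrable D (fun t => (complex.Im (F t))%:E).

Definition cintegral (D : set R) (F : R -> R[i]) : R[i] :=
  (\int[lebesgue_measure]_(t in D) complex.Re (F t))%R +i*
  (\int[lebesgue_measure]_(t in D) complex.Im (F t))%R.

(* The keyhole contour comes in from infinity along the ray arg = -phi, follows
   the arc of radius eps from the angle -phi through 0 to phi, and leaves to
   infinity along the ray arg = phi: it runs clockwise around the part of the
   sector |arg| < phi outside of the disc of radius eps. *)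
Definition ray_integrand phi (G : R[i] -> R[i]) r : R[i] :=
  G (r%:C * cis phi) * cis phi.

Definition arc_integrand eps (G : R[i] -> R[i]) t : R[i] :=
  G (eps%:C * cis t) * ('i%C * (eps%:C * cis t)).

Definition keyhole_integrable phi eps (G : R[i] -> R[i]) : Prop :=
  [/\ cintegrable `[eps, +oo[ (ray_integrand (- phi) G),
      cintegrable `[- phi, phi] (arc_integrand eps G) &
      cintegrable `[eps, +oo[ (ray_integrand phi G)].

Definition keyhole_integral phi eps (G : R[i] -> R[i]) : R[i] :=
  - cintegral `[eps, +oo[ (ray_integrand (- phi) G)
  + cintegral `[- phi, phi] (arc_integrand eps G)
  + cintegral `[eps, +oo[ (ray_integrand phi G).

End ComplexFunctions.

Section Sectorial.
Variables (R : realType) (H : hilbertType R).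
Implicit Types (T : oper H H) (z : R[i]).

(* (T - zI)^{-1} *)
Definition resolvent T z : oper H H :=
  [set u | T (u.2, u.1 + z *: u.2)].

Definition resolvent_set T : set R[i]^o :=
  [set z : R[i] | bounded_oper (resolvent T z)].

Definition spectrum T : set R[i]^o := ~` resolvent_set T.

Definition sectorial_of_angle T (w : R) : Prop :=
  [/\ 0 <= w < pi,
      spectrum T `<=` closure (sector w) &
      forall w', w < w' < pi ->
        (ereal_sup [set opnorm (scale_oper z (resolvent T z))
                   | z in ~` closure (sector w')] < +oo)%E].

Definition sectorial T : Prop :=
  [/\ closed_oper T, dense (dom T) & exists w, sectorial_of_angle T w].

(* The keyhole contour lies in the resolvent set, off ]-oo, 0], and surrounds
   the spectrum of T. *)
Definition admissible_keyhole T (phi eps : R) : Prop :=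
  [/\ exists2 w, sectorial_of_angle T w & w < phi < pi,
      0 < eps &
      forall z : R[i], `|z| <= eps%:C -> resolvent_set T z].

Definition resolvent_fun T z (f : H) : H :=
  xget 0 [set g | resolvent T z (f, g)].

(* A = (2 pi i)^{-1} \int_Gamma zeta^{-z} (T - zeta I)^{-1} d zeta, the integral
   being taken in the weak sense. The integrand is norm continuous and
   absolutely integrable, so that this is also the value of the norm convergent
   integral in B(H). *)
Definition is_neg_power T z (A : H -> H) : Prop :=
  exists phi eps : R, admissible_keyhole T phi eps /\
    forall f g : H,
      let G zeta := cpow zeta (- z) * hdot (resolvent_fun T zeta f) g in
      keyhole_integrable phi eps G /\
      hdot (A f) g = (2 * pi%:C * 'i%C)^-1 * keyhole_integral phi eps G.

(* By Cauchy's theorem the integral does not depend on the contour. *)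
Definition neg_power_fun T z : H -> H :=
  xget (fun=> 0) [set A | is_neg_power T z A].

(* T^{is}, with its maximal domain *)
Definition imag_power T (s : R) : oper H H :=
  [set u | (fun z : R[i]^o => neg_power_fun T z u.1) @
           within [set z : R[i] | 0 < complex.Re z]
             (nbhs (- (s%:C * 'i%C) : R[i]^o)) --> u.2].

(* T^{-z} for Re z >= 0 *)
Definition neg_power T z : oper H H :=
  if 0 < complex.Re z then graph (neg_power_fun T z)
  else imag_power T (- complex.Im z).

Definition BIP T (N theta : R) : Prop :=
  [/\ sectorial T,
      bounded_oper (T^-1)%relation &
      forall s : R, bounded_oper (imag_power T s) /\
        (opnorm (imag_power T s) <= (N * expR (theta * `|s|))%:E)%E].

End Sectorial.

(* Main.v *)
Require Import Defs.
From HB Require Import structures.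
From mathcomp Require Import all_boot all_order all_algebra.
From mathcomp Require Import sesquilinear complex.
From mathcomp Require Import all_classical all_reals all_analysis.
From mathcomp Require Import ring lra.

Set Implicit Arguments.
Unset Strict Implicit.
Unset Printing Implicit Defensive.

Import Order.TTheory GRing.Theory Num.Theory.
Import numFieldNormedType.Exports.

Local Open Scope classical_set_scope.
Local Open Scope ring_scope.
Local Open Scope complex_scope.

(** Stein interpolation. The operators T2^{-z} S T1^{-1+z} depend analytically
    on z in the strip 0 < Re z < 1, and on its boundary they are products of
    imaginary powers, bounded by hypothesis, with S T1^{-1} (for Re z = 0) or
    with the adjoint of S^* (T2^* )^{-1} (for Re z = 1). The Schatten norm of an
    operator is the supremum of finite sums of its matrix coefficients along
    orthonormal families, weighted by y_i^(p-1) with the sum of the y_i^p at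
    most 1. Such a sum, with phases, is a scalar analytic function to which the
    three lines theorem applies; the factor exp (k (z^2 - z)) compensates the
    growth exp ((theta1 + theta2) |Im z|) of the boundary values and produces
    the exponential in the bound. The last estimate optimizes over k.

    Four points carry the argument.

    Schatten classes. [singular_values_pairing] bounds the weighted sums for
    Bessel families rather than orthonormal ones: a bounded operator applied to
    a family, such as an imaginary power, only multiplies its Bessel constant,
    and so does replacing an orthonormal family by nearby vectors of a dense
    domain. Conversely [dual_bound_schatten] recovers compactness and the norm
    from orthonormal families; it rests on [singular_values_exist].

    Powers. [polar_cauchy] leads to the independence of the contour integrals
    from the contour ([KI_contour]), so that a single contour represents all the
    powers ([neg_power_spec]). The resolvent identity and the vanishing of the
    integral of zeta^(-z-1) give T^{-z} T^{-1} = T^{-z-1} ([neg_power_shift]),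
    and expanding the integrand gives the expansion of T^{-z} in z
    ([neg_power_taylor]). [bip_power_family] adds the imaginary powers.

    Three lines. Instead of holomorphy only second-order expansions at every
    point are used: the average of |F|^2 over the points z + r i^j is then at
    least |F(z)|^2 up to O(r^3) ([taylor2_submean]), which suffices for the
    maximum principle and for [three_lines].

    Unbounded operators. On the test vectors r1 (r1 u), in the domain of T1^2,
    and in the range of the adjoint of T2^{-1} the coefficients of
    T2^{-z} S T1^{-1+z} equal those of T2^{-1-z} (S T1^{-1}) T1^{-2+z}, a product
    of bounded operators that is analytic on a neighbourhood of the closed
    strip. The bounds found there extend by density to the domain of T1
    ([strip_bound]) and then to the closure
    ([closure_of_bounded_on_range]). *)

(** * The modulus of complex numbers as a real number *)

Section ComplexModulus.
Variable R : realType.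
Implicit Types (z w : R[i]) (r : R).

(** The modulus of R[i] takes its values in R[i]; estimates are carried out in
    the ordered field R. *)
Definition cabs z : R := complex.Re `|z|.

Lemma cabsE z : `|z| = (cabs z)%:C.
Proof. by []. Qed.

Lemma cabs_ge0 z : 0 <= cabs z.
Proof. by have := normr_ge0 z; rewrite lecE => /andP[]. Qed.

Lemma cabs0 : cabs 0 = 0.
Proof. by rewrite /cabs normr0. Qed.

Lemma cabs1 : cabs 1 = 1.
Proof. by rewrite /cabs normr1. Qed.

Lemma cabs_eq0 z : cabs z = 0 -> z = 0.
Proof. exact: Normc.eq0_normc. Qed.

Lemma cabsM z w : cabs (z * w) = cabs z * cabs w.
Proof. exact: Normc.normcM. Qed.

Lemma cabsD z w : cabs (z + w) <= cabs z + cabs w.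
Proof. exact: le_normcD. Qed.

Lemma cabsN z : cabs (- z) = cabs z.
Proof. by rewrite /cabs normrN. Qed.

Lemma cabsB z w : cabs (z - w) <= cabs z + cabs w.
Proof. by rewrite -(cabsN w) cabsD. Qed.

Lemma cabs_subC z w : cabs (z - w) = cabs (w - z).
Proof. by rewrite -cabsN opprB. Qed.

Lemma cabsR r : cabs r%:C = `|r|.
Proof. by rewrite /cabs normc_def /= expr0n addr0 sqrtr_sqr. Qed.

(** Conjugation with its carrier fixed to the complex numbers over R. *)
Definition cj z : R[i] := conjc z.

Lemma cabsJ z : cabs (cj z) = cabs z.
Proof. by rewrite /cabs normcJ. Qed.

Lemma cabsX z n : cabs (z ^+ n) = cabs z ^+ n.
Proof. by elim: n => [|n ih]; rewrite ?expr0 ?cabs1 // !exprS cabsM ih. Qed.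

Lemma cabsV z : cabs z^-1 = (cabs z)^-1.
Proof. exact: Normc.normcV. Qed.

Lemma cabs_sqr z : cabs z ^+ 2 = complex.Re z ^+ 2 + complex.Im z ^+ 2.
Proof.
by rewrite /cabs normc_def /= sqr_sqrtr // addr_ge0 // sqr_ge0.
Qed.

Lemma cabs_nat n : cabs n%:R = n%:R.
Proof.
have -> : n%:R = (n%:R : R)%:C by rewrite rmorph_nat.
by rewrite cabsR ger0_norm ?ler0n.
Qed.

Lemma cabs_mulJ z : z * cj z = (cabs z ^+ 2)%:C.
Proof. by rewrite cabs_sqr add_Re2_Im2 sqr_normc. Qed.

Lemma Re_le_cabs z : `|complex.Re z| <= cabs z.
Proof. by have := normc_ge_Re z; rewrite lecE => /andP[]. Qed.

Lemma Im_le_cabs z : `|complex.Im z| <= cabs z.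
Proof.
rewrite -(ler_pXn2r (ltn0Sn 1)) ?nnegrE ?cabs_ge0 // cabs_sqr real_normK ?num_real //.
by rewrite lerDr sqr_ge0.
Qed.

Lemma cabs_le_ReIm z : cabs z <= `|complex.Re z| + `|complex.Im z|.
Proof.
rewrite -(ler_pXn2r (ltn0Sn 1)) ?nnegrE ?cabs_ge0 ?addr_ge0 // cabs_sqr sqrrD.
rewrite !real_normK ?num_real // -addrA lerD2l lerDr.
by rewrite mulrn_wge0 // mulr_ge0.
Qed.

Lemma cabs_sum n (F : 'I_n -> R[i]) : cabs (\sum_i F i) <= \sum_i cabs (F i).
Proof.
elim/big_ind2: _ => [|a x b y ha hb|//]; first by rewrite cabs0.
by apply: le_trans (cabsD _ _) _; exact: lerD.
Qed.

Lemma cabs_gt0 z : z != 0 -> 0 < cabs z.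
Proof.
move=> z0; rewrite lt_def cabs_ge0 andbT; apply: contra z0 => /eqP h.
by apply/eqP/cabs_eq0.
Qed.

Lemma cabs_dist z w : `|cabs z - cabs w| <= cabs (z - w).
Proof.
rewrite ler_norml; apply/andP; split.
  by have := cabsD z (w - z); rewrite addrC subrK cabs_subC; lra.
by have := cabsD (z - w) w; rewrite subrK; lra.
Qed.

Lemma ReD z w : complex.Re (z + w) = complex.Re z + complex.Re w.
Proof. by rewrite raddfD. Qed.
Lemma ImD z w : complex.Im (z + w) = complex.Im z + complex.Im w.
Proof. by rewrite raddfD. Qed.
Lemma ReN z : complex.Re (- z) = - complex.Re z.
Proof. by rewrite raddfN. Qed.
Lemma ImN z : complex.Im (- z) = - complex.Im z.
Proof. by rewrite raddfN. Qed.
Lemma ReM z w :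
  complex.Re (z * w) = complex.Re z * complex.Re w - complex.Im z * complex.Im w.
Proof. by case: z w => a b [c d]. Qed.
Lemma ImM z w :
  complex.Im (z * w) = complex.Re z * complex.Im w + complex.Im z * complex.Re w.
Proof. by case: z w => a b [c d]. Qed.

Lemma Re_realM r z : complex.Re (r%:C * z) = r * complex.Re z.
Proof. by rewrite ReM /= mul0r subr0. Qed.
Lemma Im_realM r z : complex.Im (r%:C * z) = r * complex.Im z.
Proof. by rewrite ImM /= mul0r addr0. Qed.

Lemma cjM z w : cj (z * w) = cj z * cj w.
Proof. exact: (rmorphM conjc). Qed.
Lemma cjD z w : cj (z + w) = cj z + cj w.
Proof. exact: (raddfD conjc). Qed.
Lemma cjV z : cj z^-1 = (cj z)^-1.
Proof. exact: conjc_inv. Qed.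
Lemma cjR r : cj r%:C = r%:C.
Proof. exact: conjc_real. Qed.
Lemma cjK z : cj (cj z) = z.
Proof. exact: conjcK. Qed.
Lemma cj0 : cj 0 = 0.
Proof. exact: conjc0. Qed.

Lemma complex_ext z w :
  complex.Re z = complex.Re w -> complex.Im z = complex.Im w -> z = w.
Proof. by case: z w => a b [c d] /= -> ->. Qed.

End ComplexModulus.

(** * Inner product and norm of a Hilbert space *)

Section HilbertBasics.
Variables (R : realType) (H : hilbertType R).
Implicit Types (x y z : H) (c : R[i]).

Lemma hnormE x : `|x| = (hnorm x)%:C.
Proof.
have := normr_ge0 x; rewrite lecE /= => /andP[/eqP h _].
by apply: complex_ext => //=.
Qed.

Lemma hnorm_ge0 x : 0 <= hnorm x.
Proof. by have := normr_ge0 x; rewrite lecE => /andP[]. Qed.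

Lemma hnorm0 : hnorm (0 : H) = 0.
Proof. by rewrite /hnorm normr0. Qed.

Lemma hnorm_eq0 x : hnorm x = 0 -> x = 0.
Proof. by move=> h; apply/eqP; rewrite -normr_eq0 hnormE h. Qed.

Lemma hnormD x y : hnorm (x + y) <= hnorm x + hnorm y.
Proof. by have := ler_normD x y; rewrite lecE ReD => /andP[]. Qed.

Lemma hnormN x : hnorm (- x) = hnorm x.
Proof. by rewrite /hnorm normrN. Qed.

Lemma hnorm_subC x y : hnorm (x - y) = hnorm (y - x).
Proof. by rewrite -hnormN opprB. Qed.

Lemma hnormZ c x : hnorm (c *: x) = cabs c * hnorm x.
Proof. by rewrite /hnorm normrZ hnormE cabsE ReM /= mulr0 subr0. Qed.

Lemma hnorm_dist3 y x z : hnorm (x - z) <= hnorm (x - y) + hnorm (y - z).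
Proof. by have := hnormD (x - y) (y - z); rewrite addrA subrK. Qed.

Lemma hnorm_gt0 x : x != 0 -> 0 < hnorm x.
Proof.
move=> x0; rewrite lt_def hnorm_ge0 andbT; apply: contra x0 => /eqP h.
by apply/eqP/hnorm_eq0.
Qed.

Lemma hnorm_le_eps x : (forall e, 0 < e -> hnorm x <= e) -> x = 0.
Proof.
move=> h; apply: hnorm_eq0; apply/eqP; rewrite eq_le hnorm_ge0 andbT.
by apply/ler_addgt0Pl => e e0; rewrite addr0 h.
Qed.

Lemma hdotDl x y z : hdot (x + y) z = hdot x z + hdot y z.
Proof. exact: linearDl. Qed.
Lemma hdotDr x y z : hdot z (x + y) = hdot z x + hdot z y.
Proof. exact: linearDr. Qed.
Lemma hdotBl x y z : hdot (x - y) z = hdot x z - hdot y z.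
Proof. exact: linearBl. Qed.
Lemma hdotBr x y z : hdot z (x - y) = hdot z x - hdot z y.
Proof. exact: linearBr. Qed.
Lemma hdotNr x z : hdot z (- x) = - hdot z x.
Proof. exact: linearNr. Qed.
Lemma hdotZl c x z : hdot (c *: x) z = c * hdot x z.
Proof. exact: linearZl_LR. Qed.
Lemma hdotZr c x z : hdot z (c *: x) = cj c * hdot z x.
Proof. exact: linearZr_LR. Qed.
Lemma hdot0l z : hdot 0 z = 0.
Proof. exact: linear0l. Qed.
Lemma hdot0r z : hdot z 0 = 0.
Proof. exact: linear0r. Qed.
Lemma hdotC x y : hdot x y = cj (hdot y x).
Proof. by rewrite hermC /= expr0 mul1r. Qed.

Lemma hdot_suml n (F : 'I_n -> H) z : hdot (\sum_i F i) z = \sum_i hdot (F i) z.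
Proof.
by elim/big_ind2: _ => [|a x b y <- <-|//]; rewrite ?hdot0l ?hdotDl.
Qed.
Lemma hdot_sumr n (F : 'I_n -> H) z : hdot z (\sum_i F i) = \sum_i hdot z (F i).
Proof.
by elim/big_ind2: _ => [|a x b y <- <-|//]; rewrite ?hdot0r ?hdotDr.
Qed.

Lemma hdotxx x : hdot x x = (hnorm x ^+ 2)%:C.
Proof. by rewrite -hdot_norm hnormE rmorphXn. Qed.

Lemma cabs_hdotC x y : cabs (hdot x y) = cabs (hdot y x).
Proof. by rewrite hdotC cabsJ. Qed.

Lemma hnorm_sqrD x y :
  hnorm (x + y) ^+ 2 = hnorm x ^+ 2 + hnorm y ^+ 2 + 2 * complex.Re (hdot x y).
Proof.
have -> (u : H) : hnorm u ^+ 2 = complex.Re (hdot u u) by rewrite hdotxx.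
rewrite !(hdotDl, hdotDr) (hdotC y x) !ReD.
by case: (hdot x y) => a b /=; rewrite !hdotxx /=; ring.
Qed.

Lemma parallelogram x y :
  hnorm (x + y) ^+ 2 + hnorm (x - y) ^+ 2 = 2 * (hnorm x ^+ 2 + hnorm y ^+ 2).
Proof. by rewrite !hnorm_sqrD hdotNr ReN hnormN; ring. Qed.

Lemma hdot_CS x y : cabs (hdot x y) <= hnorm x * hnorm y.
Proof.
have [->|y0] := eqVneq y 0; first by rewrite hdot0r cabs0 hnorm0 mulr0.
have yp := hnorm_gt0 y0.
(* The discriminant of the square of the norm of x minus its projection on y. *)
pose c : R[i] := hdot x y / (hnorm y ^+ 2)%:C.
have yn0 : (hnorm y ^+ 2)%:C != 0 :> R[i].
  by rewrite -(rmorph0 (real_complex R)) (inj_eq (@complexI R)) expf_neq0 ?gt_eqF.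
have : 0 <= hnorm (x - c *: y) ^+ 2 by exact: sqr_ge0.
rewrite hnorm_sqrD hnormN hdotNr hdotZr hnormZ exprMn.
have -> : cj c * hdot x y = (cabs (hdot x y) ^+ 2 / hnorm y ^+ 2)%:C.
  rewrite /c cjM cjV cjR mulrAC [cj _ * _]mulrC.
  by rewrite cabs_mulJ fmorph_div.
have -> : cabs c = cabs (hdot x y) / hnorm y ^+ 2.
  by rewrite cabsM cabsV cabsR ger0_norm ?sqr_ge0.
move=> h; rewrite -(ler_pXn2r (ltn0Sn 1)) ?nnegrE ?cabs_ge0 ?mulr_ge0 ?hnorm_ge0 //.
rewrite exprMn -subr_ge0.
set a := cabs _ in h *; set b := hnorm y in h yp yn0 *; set d := hnorm x in h *.
move: h; rewrite ReN /=.
have -> : d ^+ 2 + (a / b ^+ 2) ^+ 2 * b ^+ 2 + 2 * - (a ^+ 2 / b ^+ 2)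
          = (d ^+ 2 * b ^+ 2 - a ^+ 2) / b ^+ 2 by field; rewrite gt_eqF.
by rewrite pmulr_lge0 // invr_gt0 exprn_gt0.
Qed.

Lemma hdot_eq0_all x : (forall y, hdot x y = 0) -> x = 0.
Proof.
by move=> /(_ x); rewrite hdotxx => -[] /eqP; rewrite sqrf_eq0 => /eqP/hnorm_eq0.
Qed.

Lemma hdot_inj x y : (forall z, hdot x z = hdot y z) -> x = y.
Proof.
move=> h; apply/eqP; rewrite -subr_eq0; apply/eqP; apply: hdot_eq0_all => z.
by rewrite hdotBl h subrr.
Qed.

Lemma hnorm_sup x (M : R) : 0 <= M ->
  (forall y, cabs (hdot x y) <= M * hnorm y) -> hnorm x <= M.
Proof.
move=> M0 /(_ x); rewrite hdotxx cabsR ger0_norm ?sqr_ge0 //.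
have [->|x0] := eqVneq (hnorm x) 0; first by [].
by rewrite expr2 ler_pM2r // lt_def x0 hnorm_ge0.
Qed.

(** Limits of sequences are handled with real tolerances, because the metric
    of a normed module over the complex numbers is complex-valued. *)
Definition hlim (u : nat -> H) (l : H) : Prop :=
  forall e : R, 0 < e -> exists N, forall n, (N <= n)%N -> hnorm (u n - l) < e.

Definition hcauchy (u : nat -> H) : Prop :=
  forall e : R, 0 < e ->
    exists N, forall m n, (N <= m)%N -> (N <= n)%N -> hnorm (u m - u n) < e.

Lemma ball_hnorm x (e : R) y : 0 < e -> ball x e%:C y <-> hnorm (x - y) < e.
Proof. by move=> e0; rewrite -ball_normE /= hnormE ltcR. Qed.

Lemma complex_gt0 (e : R[i]) : 0 < e -> e = (complex.Re e)%:C /\ 0 < complex.Re e.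
Proof.
rewrite ltcE /= => /andP[/eqP h h']; split => //.
by apply: complex_ext => //=.
Qed.

Lemma nbhs_hnorm x (P : set H) :
  nbhs x P <-> exists2 e : R, 0 < e & forall y, hnorm (x - y) < e -> P y.
Proof.
split.
  move/nbhs_ballP => [e /= /complex_gt0[-> e0] h]; exists (complex.Re e) => // y yx.
  by apply: h; apply/ball_hnorm.
move=> [e e0 h]; apply/nbhs_ballP; exists e%:C => /=; first by rewrite ltcR.
by move=> y /ball_hnorm -/(_ e0); exact: h.
Qed.

Lemma hcauchy_cvg u : hcauchy u -> exists l, hlim u l.
Proof.
move=> uC.
have : cvgn u.
  apply/cauchy_cvgP/cauchy_ballP => e /complex_gt0[-> e0].
  have [N hN] := uC _ e0.
  exists ([set u n | n in [set n | (N <= n)%N]],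
          [set u n | n in [set n | (N <= n)%N]]) => /=.
    by split; exists N => // n /= Nn; exists n.
  move=> [a b] /= [[m Nm <-] [n Nn <-]].
  by apply/ball_hnorm => //; exact: hN.
move=> /cvg_ex[/= l ul]; exists l => e e0.
have /ul [N _ hN] : nbhs l [set y | hnorm (y - l) < e].
  by apply/nbhs_hnorm; exists e => // y; rewrite /= hnorm_subC.
by exists N => n Nn; exact: hN.
Qed.

Lemma hlim_unique u l l' : hlim u l -> hlim u l' -> l = l'.
Proof.
move=> h h'; apply/eqP; rewrite -subr_eq0; apply/eqP; apply: hnorm_le_eps => e e0.
have e2 : 0 < e / 2 by rewrite divr_gt0.
have [N hN] := h _ e2; have [N' hN'] := h' _ e2.
apply: le_trans (hnorm_dist3 (u (maxn N N')) _ _) _.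
have := hN _ (leq_maxl N N'); have := hN' _ (leq_maxr N N').
by rewrite (hnorm_subC l); lra.
Qed.

Lemma closure_hnorm (A : set H) x :
  closure A x <-> forall e : R, 0 < e -> exists2 a, A a & hnorm (x - a) < e.
Proof.
split=> [cA e e0|h B /nbhs_hnorm[e e0 hB]].
  have [|a [Aa ha]] := cA [set y | hnorm (x - y) < e]; last by exists a.
  by apply/nbhs_hnorm; exists e.
by have [a Aa xa] := h _ e0; exists a; split => //; exact: hB.
Qed.

End HilbertBasics.

Lemma invS_small (R : realType) (e : R) : 0 < e ->
  exists N, forall n, (N <= n)%N -> n.+1%:R^-1 < e.
Proof.
move=> e0; exists (Num.truncn e^-1) => n Nn.
rewrite invf_plt ?posrE ?ltr0n //.
apply: lt_le_trans (truncnS_gt e^-1) _.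
by rewrite ler_nat ltnS.
Qed.

(** * Orthogonal projection and the Riesz representation theorem *)

Section Projection.
Variables (R : realType) (H : hilbertType R).
Implicit Types (x y w : H) (D : set H).

(** First-order optimality: a distance that no multiple of y can decrease is
    orthogonal to y. *)
Lemma hdot_eq0_of_min w y :
  (forall c, hnorm w <= hnorm (w - c *: y)) -> hdot w y = 0.
Proof.
move=> h; apply: cabs_eq0; set al := hdot w y.
pose t := (hnorm y ^+ 2 + 1)^-1.
have den0 : 0 < hnorm y ^+ 2 + 1 by rewrite ltr_wpDl // sqr_ge0.
have t0 : 0 < t by rewrite invr_gt0.
(* A small step along y in the direction of the inner product. *)
have := h (t%:C * al).
rewrite -(ler_pXn2r (ltn0Sn 1)) ?nnegrE ?hnorm_ge0 // hnorm_sqrD hnormN hnormZ.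
rewrite hdotNr hdotZr ReN cjM cjR -/al -(mulrA t%:C) [cj al * _]mulrC cabs_mulJ.
rewrite ReM /= mul0r subr0 cabsM cabsR gtr0_norm // => h1.
have h2 : 2 * t * cabs al ^+ 2 <= t * (t * hnorm y ^+ 2) * cabs al ^+ 2.
  by move: h1; rewrite -/al; set a := cabs al; set b := hnorm y; nra.
have h3 : t * hnorm y ^+ 2 <= 1.
  by rewrite /t mulrC ler_pdivrMr // mul1r lerDl.
have h4 : 0 <= t * cabs al ^+ 2 * (1 - t * hnorm y ^+ 2).
  by rewrite mulr_ge0 ?subr_ge0 // mulr_ge0 ?sqr_ge0 // ltW.
apply/eqP; rewrite -sqrf_eq0 eq_le sqr_ge0 andbT -(pmulr_rle0 _ t0).
by move: h2 h4; set a := cabs al ^+ 2; nra.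
Qed.

Definition subspace D := D 0 /\ forall c u v, D u -> D v -> D (c *: u + v).

(** Minimizing sequences are Cauchy by the parallelogram law. The subspace is
    not assumed closed, so the projection l is only a limit of its points. *)
Lemma orthogonal_projection D x : subspace D -> exists l,
  (forall e, 0 < e -> exists2 y, D y & hnorm (l - y) < e) /\
  forall y, D y -> hdot (x - l) y = 0.
Proof.
move=> [D0 Dlin].
pose E : set R := [set hnorm (x - y) | y in D].
have hE : has_inf E.
  split; first by exists (hnorm (x - 0)), 0.
  by exists 0 => _ [y _ <-]; exact: hnorm_ge0.
pose m := inf E.
have m_le y : D y -> m <= hnorm (x - y).
  by move=> Dy; apply: ge_inf; [exact: hE.2|exists y].
have m0 : 0 <= m.
  by apply: lb_le_inf; [exact: hE.1|move=> _ [y _ <-]; exact: hnorm_ge0].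
have /choice [u hu] : forall n, exists y, D y /\ hnorm (x - y) < m + n.+1%:R^-1.
  move=> n; have /(inf_adherent)/(_ hE)[_ [y Dy <-] hy] : (0 : R) < n.+1%:R^-1.
    by rewrite invr_gt0 ltr0n.
  by exists y.
have uD n : D (u n) by case: (hu n).
have uC : hcauchy u.
  move=> e e0.
  have : 0 < e ^+ 2 / (8 * m + 4) by rewrite divr_gt0 ?exprn_gt0 //; lra.
  move=> /invS_small[N hN]; exists N => i j Ni Nj.
  rewrite -(ltr_pXn2r (ltn0Sn 1)) ?nnegrE ?hnorm_ge0 ?ltW //.
  (* The midpoint of two almost closest points cannot be closer than m. *)
  have mid : 2 * m <= hnorm ((x - u i) + (x - u j)).
    have -> : (x - u i) + (x - u j) = 2 *: (x - 2^-1 *: (u i + u j)).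
      rewrite scalerBr scalerA divff ?pnatr_eq0 // scale1r scaler_nat mulr2n.
      by rewrite opprD addrACA.
    rewrite hnormZ cabs_nat.
    rewrite ler_pM2l //; apply: m_le; rewrite scalerDr; apply: (Dlin) => //.
    by rewrite -[_ *: _]addr0; exact: Dlin.
  have := parallelogram (x - u i) (x - u j).
  have -> : (x - u i) - (x - u j) = u j - u i.
    by rewrite opprB addrC addrA subrK.
  rewrite hnorm_subC.
  have [_ hi] := hu i; have [_ hj] := hu j.
  have a1 : i.+1%:R^-1 < e ^+ 2 / (8 * m + 4) :> R by exact: hN.
  have b1 : j.+1%:R^-1 < e ^+ 2 / (8 * m + 4) :> R by exact: hN.
  have a2 : i.+1%:R^-1 <= 1 :> R by rewrite invf_le1 ?ltr0n // ler1n.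
  have b2 : j.+1%:R^-1 <= 1 :> R by rewrite invf_le1 ?ltr0n // ler1n.
  have a0 : 0 < i.+1%:R^-1 :> R by rewrite invr_gt0 ltr0n.
  have b0 : 0 < j.+1%:R^-1 :> R by rewrite invr_gt0 ltr0n.
  have den : 0 < 8 * m + 4 by lra.
  move: a1 b1; rewrite !ltr_pdivlMr //.
  move: hi hj a0 b0 a2 b2 mid.
  have := hnorm_ge0 (x - u i); have := hnorm_ge0 (x - u j).
  set p := hnorm (x - u i); set q := hnorm (x - u j).
  set a := i.+1%:R^-1; set b := j.+1%:R^-1.
  set s := hnorm (_ + _); set d := hnorm (_ - _).
  move=> q0 p0 hp hq a0 b0 a1 b1 hs ha hb par.
  have h1 : p ^+ 2 <= (m + a) ^+ 2 by rewrite ler_pXn2r ?nnegrE //; lra.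
  have h2 : q ^+ 2 <= (m + b) ^+ 2 by rewrite ler_pXn2r ?nnegrE //; lra.
  have h3 : (2 * m) ^+ 2 <= s ^+ 2.
    by rewrite ler_pXn2r ?nnegrE ?mulr_ge0 //; exact: hnorm_ge0.
  have h4 : a ^+ 2 <= a by rewrite expr2; nra.
  have h5 : b ^+ 2 <= b by rewrite expr2; nra.
  nra.
have [l ul] := hcauchy_cvg uC.
exists l; split.
  by move=> e /ul[N hN]; exists (u N) => //; rewrite hnorm_subC; exact: hN.
have ge_m c y : D y -> m <= hnorm (x - l - c *: y).
  move=> Dy; apply/ler_addgt0Pl => e /ul[N hN].
  apply: (le_trans (m_le (c *: y + u N) _)); first exact: Dlin.
  have -> : x - (c *: y + u N) = (l - u N) + (x - l - c *: y).
    by rewrite [RHS]addrC (addrAC x) addrA subrK opprD addrA.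
  apply: le_trans (hnormD _ _) _; rewrite lerD2r hnorm_subC ltW //; exact: hN.
have le_m : hnorm (x - l) <= m.
  apply/ler_addgt0Pl => e e0; have e2 : 0 < e / 2 by rewrite divr_gt0.
  have [N hN] := ul _ e2; have [N' hN'] := invS_small e2.
  have [_ h1] := hu (maxn N N').
  have h2 := hN' _ (leq_maxr N N'); have h3 := hN _ (leq_maxl N N').
  have := hnorm_dist3 (u (maxn N N')) x l; move: h1 h2 h3.
  by set a := _^-1; set b := hnorm _; set c := hnorm _; set d := hnorm _; lra.
by move=> y Dy; apply: hdot_eq0_of_min => c; apply: le_trans le_m _; exact: ge_m.
Qed.

(** Used for ranges, whose orthogonal complement is the kernel of the adjoint. *)
Lemma dense_of_orthogonal D : subspace D ->
  (forall x, (forall y, D y -> hdot x y = 0) -> x = 0) ->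
  forall x e, 0 < e -> exists2 y, D y & hnorm (x - y) < e.
Proof.
move=> sD h x e e0; have [l [l1 l2]] := orthogonal_projection x sD.
have /eqP := h _ l2; rewrite subr_eq0 => /eqP ->; exact: l1.
Qed.

(** The representing vector is a multiple of the residual of the projection of
    a vector outside of the kernel on the kernel. *)
Lemma riesz (L : H -> R[i]) (M : R) :
  (forall c u v, L (c *: u + v) = c * L u + L v) ->
  (forall u, cabs (L u) <= M * hnorm u) ->
  exists q, forall u, L u = hdot u q.
Proof.
move=> Llin LM.
have L0 : L 0 = 0.
  by have := LM 0; rewrite hnorm0 mulr0 => h; apply: cabs_eq0; apply/eqP;
    rewrite eq_le h cabs_ge0.
have [[x Lx]|h] := pselect (exists x, L x <> 0); last first.
  exists 0 => u; rewrite hdot0r; apply/eqP/negPn/negP => /eqP hu.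
  by apply: h; exists u.
have [|l [l1 l2]] := @orthogonal_projection [set u | L u = 0] x.
  by split => //= c u v hu hv; rewrite Llin hu hv mulr0 addr0.
have LB u v : L (u - v) = L u - L v.
  by rewrite addrC -scaleN1r Llin mulN1r addrC.
have Ll : L l = 0.
  apply: cabs_eq0; apply/eqP; rewrite eq_le cabs_ge0 andbT.
  apply/ler_addgt0Pl => e e0; rewrite addr0.
  have : 0 < e / (`|M| + 1) by rewrite divr_gt0 // ltr_wpDl.
  move=> /l1[y /= Ly]; rewrite ltr_pdivlMr ?ltr_wpDl // => hy.
  have := LM (l - y); rewrite LB Ly subr0 => /le_trans; apply.
  have := hnorm_ge0 (l - y); have := ler_norm M; move: hy; nra.
set w := x - l in l2 *.
have Lw : L w <> 0 by rewrite LB Ll subr0.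
have w0 : w != 0 by apply/eqP => h; apply: Lw; rewrite h.
have nw : (hnorm w ^+ 2)%:C != 0 :> R[i].
  by rewrite -hdotxx; apply/eqP => h; move/eqP: w0; apply; apply: hnorm_eq0;
    move: h; rewrite hdotxx => -[] /eqP; rewrite sqrf_eq0 => /eqP.
exists (cj (L w / (hnorm w ^+ 2)%:C) *: w) => u.
have : hdot w (u - (L u / L w) *: w) = 0.
  by apply: l2; rewrite /= addrC -scaleNr Llin mulNr divfK ?addNr //; exact/eqP.
rewrite hdotZr cjK hdotC hdotBl hdotZl hdotxx => /(congr1 (@cj R)).
rewrite cjK cj0 => /eqP; rewrite subr_eq0 => /eqP ->.
move: nw; generalize ((hnorm w ^+ 2)%:C) => N nw; field.
by apply/andP; split; first [exact: nw | exact/eqP].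
Qed.

End Projection.

(** * Bounded linear maps and closures of their graphs *)

Section BoundedMaps.
Variables (R : realType) (H1 H2 : hilbertType R).
Implicit Types (a : H1 -> H2) (M : R) (A : oper H1 H2).

(** A bounded linear map comes with an explicit bound M: the proof is about
    constants, and the operator norm is only an extended real. *)
Definition blin a M : Prop :=
  [/\ 0 <= M, forall c u v, a (c *: u + v) = c *: a u + a v &
      forall u, hnorm (a u) <= M * hnorm u].

Section Linear.
Variables (a : H1 -> H2) (M : R).
Hypothesis aM : blin a M.

Lemma blin_ge0 : 0 <= M. Proof. by case: aM. Qed.
Lemma blin_lin c u v : a (c *: u + v) = c *: a u + a v. Proof. by case: aM. Qed.
Lemma blin_le u : hnorm (a u) <= M * hnorm u. Proof. by case: aM. Qed.

Lemma blin0 : a 0 = 0.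
Proof.
apply: hnorm_eq0; apply/eqP; rewrite eq_le hnorm_ge0 andbT.
by have := blin_le 0; rewrite hnorm0 mulr0.
Qed.
Lemma blinD u v : a (u + v) = a u + a v.
Proof. by have := blin_lin 1 u v; rewrite !scale1r. Qed.
Lemma blinZ c u : a (c *: u) = c *: a u.
Proof. by have := blin_lin c u 0; rewrite !addr0 blin0 addr0. Qed.
Lemma blinN u : a (- u) = - a u.
Proof. by rewrite -scaleN1r blinZ scaleN1r. Qed.
Lemma blinB u v : a (u - v) = a u - a v.
Proof. by rewrite blinD blinN. Qed.
Lemma blin_sum n (F : 'I_n -> H1) : a (\sum_i F i) = \sum_i a (F i).
Proof. by elim/big_ind2: _ => [|x b y c <- <-|//]; rewrite ?blin0 ?blinD. Qed.

Lemma blin_weaken N : M <= N -> blin a N.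
Proof.
move=> MN; split; [exact: le_trans blin_ge0 MN|exact: blin_lin|move=> u].
by apply: le_trans (blin_le u) _; rewrite ler_wpM2r // hnorm_ge0.
Qed.

Lemma blin_hlim u l : hlim u l -> hlim (a \o u) (a l).
Proof.
move=> ul e e0; have : 0 < e / (M + 1).
  by rewrite divr_gt0 // ltr_wpDl // blin_ge0.
move=> /ul[N hN]; exists N => n /hN; rewrite ltr_pdivlMr ?ltr_wpDl ?blin_ge0 //.
rewrite /= -blinB => h; apply: le_lt_trans (blin_le _) _.
by have := hnorm_ge0 (u n - l); move: h; nra.
Qed.

(** Riesz representation of f |-> <a f, v> for each v. *)
Lemma blin_adjoint : exists b : H2 -> H1,
  [/\ 0 <= M, forall c u v, b (c *: u + v) = c *: b u + b v,
      forall u, hnorm (b u) <= M * hnorm u &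
      forall u v, hdot (a u) v = hdot u (b v)].
Proof.
have /choice[b hb] : forall v, exists q, forall u, hdot (a u) v = hdot u q.
  move=> v; apply: (@riesz _ _ _ (M * hnorm v)) => [c u u'|u].
    by rewrite blin_lin hdotDl hdotZl.
  apply: le_trans (hdot_CS _ _) _; rewrite mulrAC ler_wpM2r ?hnorm_ge0 //.
  exact: blin_le.
exists b; split => // [|c u v|u]; first exact: blin_ge0.
  apply: hdot_inj => z; rewrite hdotDl hdotZl ![hdot (b _) z]hdotC -!hb.
  by rewrite hdotDr hdotZr cjD cjM cjK.
apply: hnorm_sup => [|y]; first by rewrite mulr_ge0 ?hnorm_ge0 ?blin_ge0.
rewrite cabs_hdotC -hb; apply: le_trans (hdot_CS _ _) _.
rewrite mulrAC ler_wpM2r ?hnorm_ge0 //; exact: blin_le.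
Qed.

End Linear.

(** Only the vectors of norm at most one enter the operator norm; scaling
    reaches the others. *)
Lemma opnorm_le A u M : linear_oper A -> A u -> (opnorm A <= M%:E)%E -> 0 <= M ->
  hnorm u.2 <= M * hnorm u.1.
Proof.
move=> [A0 Alin Afun] Au hM M0.
have [u0|u0] := eqVneq u.1 0.
  by rewrite (_ : u.2 = 0) ?u0 ?hnorm0 ?mulr0 //; apply: (Afun 0) => //;
    rewrite -u0 -surjective_pairing.
have nu := hnorm_gt0 u0.
pose c : R[i] := ((hnorm u.1)^-1)%:C.
have Acu : A (c *: u) by rewrite -[_ *: _]addr0; exact: Alin.
have cc : cabs c = (hnorm u.1)^-1 by rewrite cabsR gtr0_norm // invr_gt0.
have /ereal_sup_ubound/le_trans/(_ hM) :
    [set (hnorm u.2)%:E | u in [set u | A u /\ hnorm u.1 <= 1]]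
      (hnorm (c *: u.2))%:E.
  by exists (c *: u) => //; split => //=; rewrite hnormZ cc mulVf ?gt_eqF.
by rewrite lee_fin hnormZ cc mulrC ler_pdivrMr.
Qed.

Lemma bounded_operP A : bounded_oper A ->
  exists a M, blin a M /\ (forall f g, A (f, g) <-> g = a f).
Proof.
move=> [Alin Adom Aoo].
have /choice[a ha] : forall f, exists g, A (f, g).
  move=> f; have : dom A f by rewrite Adom.
  by case=> -[f' g] /= Afg <-; exists g.
have [M M0 hM] : exists2 M, 0 <= M & (opnorm A <= M%:E)%E.
  move: Aoo; case E: (opnorm A) => [r| |] // _; last by exists 0 => //; rewrite leNye.
  by exists (Num.max r 0); rewrite ?le_max ?lexx ?orbT // lee_fin le_max lexx.
exists a, M; have [A0 Al Afun] := Alin; split.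
  split => // [c u v|u]; last exact: (@opnorm_le A (u, a u)).
  by apply: (Afun (c *: u + v)) => //; exact: (Al c (u, a u) (v, a v)).
by move=> f g; split=> [h|->//]; exact: Afun h (ha f).
Qed.

Lemma linear_oper_graph a M : blin a M -> linear_oper (graph a).
Proof.
move=> aM; split => [|c [u1 u2] [v1 v2]|f g h] /=.
- by rewrite /graph /= (blin0 aM).
- by rewrite /graph /= => -> ->; rewrite (blin_lin aM).
- by rewrite /graph /= => -> ->.
Qed.

Lemma bounded_oper_graph a M : blin a M -> bounded_oper (graph a).
Proof.
move=> aM; split; first exact: linear_oper_graph aM.
  by apply/seteqP; split=> // f _; exists (f, a f).
apply: le_lt_trans (ltry M); apply: ge_ereal_sup => _ [[u1 u2] /= [gu u1le] <-].
rewrite lee_fin (_ : u2 = a u1) //; apply: le_trans (blin_le aM _) _.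
by rewrite -[leRHS]mulr1 ler_wpM2l // (blin_ge0 aM).
Qed.

Lemma closure_pair A x y :
  closure A (x, y) <-> forall e : R, 0 < e ->
    exists f g, [/\ A (f, g), hnorm (x - f) < e & hnorm (y - g) < e].
Proof.
split=> [cA e e0|h B].
  have [|[a b] [Aab [/= xa yb]]] :=
    cA ([set f | hnorm (x - f) < e] `*` [set g | hnorm (y - g) < e]).
    by exists ([set f | hnorm (x - f) < e], [set g | hnorm (y - g) < e]) => //;
      split; apply/nbhs_hnorm; exists e.
  by exists a, b.
move=> [[P Q] /= [/nbhs_hnorm[e e0 hP] /nbhs_hnorm[e' e'0 hQ]] PQ].
have m0 : 0 < Num.min e e' by rewrite lt_min e0 e'0.
have [a [b [Aab xa yb]]] := h _ m0.
exists (a, b); split => //; apply: PQ; split => /=.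
  by apply: hP; apply: lt_le_trans xa _; rewrite ge_min lexx.
by apply: hQ; apply: lt_le_trans yb _; rewrite ge_min lexx orbT.
Qed.

(** The closure of a densely defined bounded operator is everywhere defined:
    images of approximating sequences are Cauchy. *)
Lemma closure_bounded A M : 0 <= M -> linear_oper A ->
  (forall x e, 0 < e -> exists2 y, dom A y & hnorm (x - y) < e) ->
  (forall f g, A (f, g) -> hnorm g <= M * hnorm f) ->
  exists a, blin a M /\ closure A = graph a.
Proof.
move=> M0 [A0 Al Afun] Ad AM.
have AB f g f' g' : A (f, g) -> A (f', g') -> A (f - f', g - g').
  move=> h h'; rewrite addrC -scaleN1r [g - _]addrC -[- g']scaleN1r.
  exact: (Al (-1) (f', g') (f, g)).
have Aclose f g f' g' (e : R) : A (f, g) -> A (f', g') ->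
    hnorm (f - f') < e / (M + 1) -> hnorm (g - g') < e.
  move=> h h'; rewrite ltr_pdivlMr ?ltr_wpDl // => hf.
  have := AM _ _ (AB _ _ _ _ h h'); have := hnorm_ge0 (f - f'); move: hf; nra.
have ex x : exists y, forall e, 0 < e ->
    exists f g, [/\ A (f, g), hnorm (x - f) < e & hnorm (y - g) < e].
  have /choice[s hs] : forall n, exists u, A u /\ hnorm (x - u.1) < n.+1%:R^-1.
    move=> n; have : (0 : R) < n.+1%:R^-1 by rewrite invr_gt0 ltr0n.
    by move=> /(Ad x)[y [[y' g] /= h <-] hy]; exists (y', g).
  have sC : hcauchy (fun n => (s n).2).
    move=> e e0; have : 0 < e / (M + 1) / 2 by rewrite !divr_gt0 // ltr_wpDl.
    move=> /invS_small[N hN]; exists N => m n Nm Nn.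
    have [h1 h2] := hs m; have [h3 h4] := hs n.
    apply: (Aclose (s m).1 _ (s n).1) => //; rewrite -?surjective_pairing //.
    have := hnorm_dist3 x (s m).1 (s n).1; rewrite (hnorm_subC (s m).1 x).
    have := hN _ Nm; have := hN _ Nn; move: h2 h4.
    set a := m.+1%:R^-1; set b := n.+1%:R^-1; set c := e / _.
    by set p := hnorm _; set q := hnorm _; set r := hnorm _; lra.
  have [y hy] := hcauchy_cvg sC; exists y => e e0.
  have [N hN] := invS_small e0; have [N' hN'] := hy _ e0.
  have [h1 h2] := hs (maxn N N').
  exists (s (maxn N N')).1, (s (maxn N N')).2; split.
  - by rewrite -surjective_pairing.
  - by apply: lt_trans h2 _; apply: hN; exact: leq_maxl.
  - by rewrite hnorm_subC; apply: hN'; exact: leq_maxr.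
have [a ha] := choice ex.
have uniq x y : closure A (x, y) -> y = a x.
  move/closure_pair => h; apply/eqP; rewrite -subr_eq0; apply/eqP.
  apply: hnorm_le_eps => e e0.
  have e3 : 0 < e / 3 by rewrite divr_gt0.
  have d0 : 0 < Num.min (e / 3) (e / 3 / (M + 1) / 2).
    by rewrite lt_min e3 !divr_gt0 // ltr_wpDl.
  have [f [g [Afg fx gy]]] := h _ d0.
  have [f' [g' [Afg' fx' gy']]] := ha x _ d0.
  move: fx gy fx' gy'; rewrite !lt_min => /andP[_ fx] /andP[gy _] /andP[_ fx'] /andP[gy' _].
  have : hnorm (g - g') < e / 3.
    apply: (Aclose f _ f') => //.
    by have := hnorm_dist3 x f f'; rewrite (hnorm_subC f x); lra.
  have := hnorm_dist3 g y (a x); have := hnorm_dist3 g' g (a x).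
  by rewrite (hnorm_subC g' (a x)); lra.
have cla : closure A = graph a.
  apply/seteqP; split=> -[x y]; first exact: uniq.
  by rewrite /graph /= => ->; apply/closure_pair; exact: ha.
exists a; split => //; split => // [c u v|u].
  apply/esym/uniq/closure_pair => e e0.
  have : 0 < e / (cabs c + 1) by rewrite divr_gt0 // ltr_wpDl // cabs_ge0.
  set d := e / _ => d0.
  have [f [g [Afg fu gu]]] := ha u _ d0; have [f' [g' [Afg' fv gv]]] := ha v _ d0.
  exists (c *: f + f'), (c *: g + g').
  have key (K : hilbertType R) (p q p' q' : K) : hnorm (p - q) < d ->
      hnorm (p' - q') < d -> hnorm (c *: p + p' - (c *: q + q')) < e.
    move=> h h'; rewrite opprD addrACA -scalerBr.
    apply: le_lt_trans (hnormD _ _) _; rewrite hnormZ.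
    have -> : e = cabs c * d + d by rewrite /d; field; have := cabs_ge0 c; lra.
    by rewrite ler_ltD // ler_wpM2l ?cabs_ge0 ?ltW.
  by split; [exact: (Al c (f, g) (f', g'))|exact: key|exact: key].
apply/ler_addgt0Pl => e e0.
have : 0 < e / (M + 1) by rewrite divr_gt0 // ltr_wpDl.
move=> d0.
have [f [g [/AM Afg fu gu]]] := ha u _ d0.
have h1 : hnorm (a u) <= hnorm (a u - g) + hnorm g.
  by have := hnormD (a u - g) g; rewrite subrK.
have h2 : hnorm f <= hnorm (u - f) + hnorm u.
  by have := hnormD (f - u) u; rewrite subrK hnorm_subC.
have h3 : e = e / (M + 1) * (M + 1) by field; lra.
rewrite [X in _ <= X + _]h3; move: h1 h2 fu gu Afg d0.
set d := e / _; have := hnorm_ge0 (u - f); nra.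
Qed.

End BoundedMaps.

(** * Bessel families *)

Section Families.
Variables (R : realType) (H : hilbertType R).
Implicit Types (u : nat -> H) (k : nat) (c : R).

(** The Bessel bound of a finite family: the quantitative substitute for
    orthonormality that survives applying a bounded operator and small
    perturbations. *)
Definition bessel k c u : Prop :=
  forall h, \sum_(i < k) cabs (hdot (u i) h) ^+ 2 <= c ^+ 2 * hnorm h ^+ 2.

Definition orthog k u : Prop :=
  forall i j, (i < k)%N -> (j < k)%N -> i <> j -> hdot (u i) (u j) = 0.

Lemma pythagoras k u (c : nat -> R[i]) : orthog k u ->
  hnorm (\sum_(i < k) c i *: u i) ^+ 2 =
  \sum_(i < k) cabs (c i) ^+ 2 * hnorm (u i) ^+ 2.
Proof.
elim: k => [|k ih] ou; first by rewrite !big_ord0 hnorm0 expr0n.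
rewrite !big_ord_recr /= hnorm_sqrD ih; last first.
  by move=> i j ik jk; apply: ou; exact: leqW.
have h0 : \sum_(i < k) hdot (c i *: u i) (u k) = 0.
  rewrite big1 // => i _; rewrite hdotZl ou ?mulr0 //; first exact: (leqW (ltn_ord i)).
  by move=> ik; have := ltn_ord i; rewrite ik ltnn.
by rewrite hdotZr hdot_suml h0 mulr0 /= mulr0 addr0 hnormZ exprMn.
Qed.

Lemma bessel_orthog k u : orthog k u ->
  (forall i, (i < k)%N -> hnorm (u i) <= 1) -> bessel k 1 u.
Proof.
move=> ou u1 h; rewrite expr1n mul1r.
pose s := \sum_(i < k) hdot h (u i) *: u i.
have : 0 <= hnorm (h - s) ^+ 2 by exact: sqr_ge0.
rewrite hnorm_sqrD hnormN hdotNr ReN.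
have -> : complex.Re (hdot h s) = \sum_(i < k) cabs (hdot (u i) h) ^+ 2.
  rewrite /s hdot_sumr raddf_sum; apply: eq_bigr => i _.
  by rewrite /= hdotZr mulrC cabs_mulJ cabs_hdotC.
have : hnorm s ^+ 2 <= \sum_(i < k) cabs (hdot (u i) h) ^+ 2.
  rewrite /s (@pythagoras k u (fun i => hdot h (u i))) //; apply: ler_sum => i _.
  by rewrite cabs_hdotC ler_piMr ?sqr_ge0 // exprn_ile1 ?hnorm_ge0 // u1.
set S := \sum_(i < k) _; lra.
Qed.

(** The inequality is tested at the vector itself. *)
Lemma bessel_norm k c u i : 0 <= c -> bessel k c u -> (i < k)%N ->
  hnorm (u i) <= c.
Proof.
move=> c0 bu ik; have [->//|n0] := eqVneq (hnorm (u i)) 0.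
have n1 : 0 < hnorm (u i) by rewrite lt_def n0 hnorm_ge0.
have := bu (u i); rewrite (bigD1 (Ordinal ik)) //= hdotxx cabsR.
set S := \sum_(_ < _ | _) _ => h.
have S0 : 0 <= S by apply: sumr_ge0 => j _; exact: sqr_ge0.
have : (hnorm (u i) ^+ 2) * hnorm (u i) ^+ 2 <= c ^+ 2 * hnorm (u i) ^+ 2.
  by move: h; rewrite ger0_norm ?sqr_ge0 //; lra.
by rewrite ler_pM2r ?exprn_gt0 // ler_pXn2r ?nnegrE // hnorm_ge0.
Qed.

(** The cross terms are absorbed by (x + y)^2 <= (1 + d) x^2 + (1 + 1/d) y^2;
    the bound tends to c with d, for a fixed length k. *)
Lemma bessel_perturb k c u u' (d : R) : 0 <= c -> 0 < d -> bessel k c u ->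
  (forall i, (i < k)%N -> hnorm (u' i - u i) <= d) ->
  bessel k (Num.sqrt ((1 + d) * c ^+ 2 + k%:R * (d ^+ 2 + d))) u'.
Proof.
move=> c0 d0 bu uu' h.
have d1 : 0 < d^-1 by rewrite invr_gt0.
rewrite sqr_sqrtr; last first.
  by rewrite addr_ge0 // mulr_ge0 ?sqr_ge0 ?ler0n // addr_ge0 ?sqr_ge0 // ltW.
apply: (@le_trans _ _ (\sum_(i < k) ((1 + d) * cabs (hdot (u i) h) ^+ 2
                                    + (d ^+ 2 + d) * hnorm h ^+ 2))).
  apply: ler_sum => i _.
  have := hdot_CS (u' i - u i) h; have := uu' i (ltn_ord i).
  have : cabs (hdot (u' i) h) <= cabs (hdot (u i) h) + cabs (hdot (u' i - u i) h).
    by apply: le_trans (cabsD _ _); rewrite -hdotDl addrC subrK.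
  have := cabs_ge0 (hdot (u' i) h); have := cabs_ge0 (hdot (u i) h).
  have := hnorm_ge0 h; have := hnorm_ge0 (u' i - u i).
  set x := cabs (hdot (u' i) h); set y := cabs (hdot (u i) h).
  set z := cabs _; set n := hnorm h; set m := hnorm _.
  move=> m0 n0 y0 x0 hx mz hz.
  have hx' : x <= y + d * n by nra.
  apply: (@le_trans _ _ ((y + d * n) ^+ 2)).
    by rewrite ler_pXn2r ?nnegrE // addr_ge0 // mulr_ge0 // ltW.
  rewrite -subr_ge0 (_ : _ - _ = d * (y - n) ^+ 2); last by ring.
  by rewrite mulr_ge0 ?sqr_ge0 // ltW.
rewrite big_split /= -mulr_sumr sumr_const card_ord -[X in _ + X]mulr_natl.
rewrite [leRHS]mulrDl -!mulrA; apply: lerD => //.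
apply: ler_wpM2l; first by rewrite addr_ge0 // ltW.
by rewrite mulrA; exact: bu.
Qed.

End Families.

(** The adjoint moves the map from the family to the test vector. *)
Lemma bessel_map (R : realType) (H1 H2 : hilbertType R) (a : H1 -> H2)
  (M c : R) k (u : nat -> H1) :
  blin a M -> bessel k c u -> bessel k (M * c) (a \o u).
Proof.
move=> aM bu h; have [b [M0 _ bM ab]] := blin_adjoint aM.
under eq_bigr do rewrite ab.
apply: le_trans (bu _) _.
have -> : (M * c) ^+ 2 * hnorm h ^+ 2 = c ^+ 2 * (M * hnorm h) ^+ 2 by ring.
rewrite ler_wpM2l ?sqr_ge0 // ler_pXn2r ?nnegrE ?hnorm_ge0 //.
by rewrite mulr_ge0 ?hnorm_ge0.
Qed.

(** * Schmidt expansion and Schatten estimates *)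

Section SingularSystem.
Variables (R : realType) (H1 H2 : hilbertType R).
Variables (A : oper H1 H2) (a : H1 -> H2) (M : R).
Hypothesis aM : blin a M.
Hypothesis aA : forall f g, A (f, g) <-> g = a f.

Variables (s : nat -> R) (e0 : nat -> H1).
Hypothesis e_on : forall m n, 0 < s m -> 0 < s n ->
  hdot (e0 m) (e0 n) = (m == n)%:R.
Hypothesis e_eig : forall n, 0 < s n ->
  (adjoint A \; A)%relation (e0 n, (s n ^+ 2)%:C *: e0 n).
Hypothesis e_ker : forall f, (forall n, 0 < s n -> hdot f (e0 n) = 0) ->
  A (f, 0).

Let e n : H1 := if 0 < s n then e0 n else 0.
Let g n : H2 := ((s n)^-1)%:C *: a (e n).

Let eE n f : hdot (a f) (a (e n)) = (s n ^+ 2)%:C * hdot f (e n).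
Proof.
rewrite /e; case: ifPn => [sn|_]; last by rewrite (blin0 aM) !hdot0r mulr0.
have [h /= /aA -> hh] := e_eig sn.
by rewrite (hh f (a f)) ?aA // hdotZr cjR.
Qed.

Let e_og k : orthog k e.
Proof.
move=> i j _ _ ij; rewrite /e; case: ifPn => [si|_]; last by rewrite hdot0l.
case: ifPn => [sj|_]; last by rewrite hdot0r.
by rewrite e_on //; case: eqP.
Qed.

Let e_norm n : 0 < s n -> hnorm (e n) = 1.
Proof.
move=> sn; have := hdotxx (e n); rewrite {1 2}/e sn e_on // eqxx => -[] /esym/eqP.
by rewrite sqrf_eq1 => /orP[/eqP//|/eqP h]; have := hnorm_ge0 (e n); lra.
Qed.

Let e_le1 n : hnorm (e n) <= 1.
Proof.
have [sn|] := boolP (0 < s n); first by rewrite e_norm.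
by rewrite /e => /negbTE ->; rewrite hnorm0.
Qed.

Let g_og k : orthog k g.
Proof.
move=> i j ik jk ij; rewrite /g hdotZl hdotZr eE (e_og ik jk ij).
by rewrite !mulr0.
Qed.

Let g_le1 n : hnorm (g n) <= 1.
Proof.
rewrite /g hnormZ cabsR; have [sn|] := boolP (0 < s n); last first.
  by rewrite /e => /negbTE ->; rewrite (blin0 aM) hnorm0 mulr0.
have : hnorm (a (e n)) ^+ 2 = s n ^+ 2.
  have := eE n (e n); rewrite !hdotxx e_norm // expr1n mulr1 => -[] //.
move=> /eqP; rewrite eqrXn2 ?hnorm_ge0 ?(ltW sn) // => /eqP ->.
by rewrite ger0_norm ?invr_ge0 ?(ltW sn) // mulVf // gt_eqF.
Qed.

Let ag n : a (e n) = (s n)%:C *: g n.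
Proof.
rewrite /g scalerA; have [sn|] := boolP (0 < s n); last first.
  by rewrite /e => /negbTE ->; rewrite (blin0 aM) scaler0.
by rewrite -rmorphM mulfV ?gt_eqF // scale1r.
Qed.

Let expansion f :
  hlim (fun N => \sum_(n < N) ((s n)%:C * hdot f (e n)) *: g n) (a f).
Proof.
pose x N := \sum_(n < N) hdot f (e n) *: e n.
pose q N := \sum_(n < N) cabs (hdot (e n) f) ^+ 2.
have xC : hcauchy x.
  have q_le N : q N <= hnorm f ^+ 2.
    have := bessel_orthog (@e_og N) (fun i _ => e_le1 i) f.
    by rewrite expr1n mul1r.
  have q_nd m n : (m <= n)%N -> q m <= q n.
    move=> /subnK <-; elim: (n - m)%N => [|j ih]; first by rewrite add0n.
    by apply: le_trans ih _; rewrite addSn /q big_ord_recr /= lerDl sqr_ge0.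
  have xq m n : (m <= n)%N -> hnorm (x n - x m) ^+ 2 <= q n - q m.
    elim: n => [|n ih]; first by rewrite leqn0 => /eqP ->; rewrite !subrr hnorm0 expr0n.
    rewrite leq_eqVlt => /predU1P[->|]; first by rewrite !subrr hnorm0 expr0n.
    rewrite ltnS => mn; rewrite /x /q !big_ord_recr /= -/(x n) -/(q n).
    have h0 K : (K <= n)%N -> hdot (x K) (e n) = 0.
      move=> Kn; rewrite hdot_suml big1 // => i _.
      have iN := leq_trans (ltn_ord i) Kn.
      rewrite hdotZl (@e_og n.+1) ?mulr0 //; first exact: leqW.
      by move=> h; rewrite h ltnn in iN.
    rewrite addrAC hnorm_sqrD hdotZr hdotBl !h0 //.
    rewrite subrr mulr0 /= mulr0 addr0 hnormZ exprMn [_ + _ - q m]addrAC.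
    apply: lerD; first exact: ih.
    by rewrite cabs_hdotC ler_piMr ?sqr_ge0 // exprn_ile1 ?hnorm_ge0.
  have qb : has_sup [set q n | n in setT].
    split; first by exists (q 0%N), 0%N.
    by exists (hnorm f ^+ 2) => _ [n _ <-].
  move=> eps eps0; have : 0 < eps ^+ 2 by rewrite exprn_gt0.
  move=> /(sup_adherent)/(_ qb)[_ [N _ <-] hN].
  have q_sup n : q n <= sup [set q n | n in setT].
    by apply: ub_le_sup; [exact: qb.2|exists n].
  exists N.
  suff key m n : (N <= m)%N -> (m <= n)%N -> hnorm (x n - x m) < eps.
    move=> m n Nm Nn; have [mn|/ltnW nm] := leqP m n; last exact: key.
    by rewrite hnorm_subC; exact: key.
  move=> Nm mn; rewrite -(ltr_pXn2r (ltn0Sn 1)) ?nnegrE ?hnorm_ge0 ?ltW //.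
  apply: le_lt_trans (xq _ _ mn) _.
  by have := q_sup n; have := q_nd _ _ Nm; move: hN; set S := sup _; lra.
have [l xl] := hcauchy_cvg xC.
have fl : a f = a l.
  apply/eqP; rewrite -subr_eq0 -(blinB aM); apply/eqP/esym/aA/e_ker => n sn.
  have en : e n = e0 n by rewrite /e sn.
  rewrite -en; apply: cabs_eq0; apply/eqP; rewrite eq_le cabs_ge0 andbT.
  apply/ler_addgt0Pl => d d0; rewrite addr0; have [N hN] := xl _ d0.
  pose K := maxn N n.+1.
  have -> : hdot (f - l) (e n) = hdot (x K - l) (e n).
    rewrite !hdotBl; congr (_ - _).
    have nK : (n < K)%N by rewrite leq_max leqnn orbT.
    rewrite hdot_suml (bigD1 (Ordinal nK)) //= hdotZl hdotxx e_norm //.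
    rewrite expr1n mulr1 big1 ?addr0 // => i iK.
    rewrite hdotZl (@e_og K) ?mulr0 // => h.
    by move/eqP: iK; apply; apply: val_inj.
  apply: le_trans (hdot_CS _ _) _; rewrite e_norm // mulr1 ltW //.
  by apply: hN; rewrite leq_max leqnn.
rewrite fl; have := blin_hlim aM xl.
congr hlim; apply/funext => N /=; rewrite /x (blin_sum aM).
by apply: eq_bigr => n _; rewrite (blinZ aM) ag scalerA mulrC.
Qed.

Lemma schmidt_expansion_of_family : exists (e : nat -> H1) (g : nat -> H2),
  [/\ forall k, orthog k e, forall n, hnorm (e n) <= 1,
      forall k, orthog k g, forall n, hnorm (g n) <= 1 &
      forall f, hlim (fun N => \sum_(n < N) ((s n)%:C * hdot f (e n)) *: g n) (a f)].
Proof. by exists e, g; split. Qed.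

End SingularSystem.

(** The kernel condition makes the eigenvectors complete as far as the operator
    is concerned, hence its Schmidt expansion converges. *)
Lemma schmidt_expansion (R : realType) (H1 H2 : hilbertType R)
  (A : oper H1 H2) (a : H1 -> H2) (M : R) (s : nat -> R) :
  blin a M -> (forall f g, A (f, g) <-> g = a f) -> is_singular_values A s ->
  exists (e : nat -> H1) (g : nat -> H2),
  [/\ forall k, orthog k e, forall n, hnorm (e n) <= 1,
      forall k, orthog k g, forall n, hnorm (g n) <= 1 &
      forall f, hlim (fun N => \sum_(n < N) ((s n)%:C * hdot f (e n)) *: g n) (a f)].
Proof.
move=> aM aA [_ _ [e [e_on e_eig e_ker]]].
exact (schmidt_expansion_of_family aM aA e_on e_eig e_ker).
Qed.

(** Young's inequality for the exponents p / (p - 1) and p, written so that it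
    remains true at p = 1. *)
Lemma young_powR (R : realType) (p y s : R) : 1 <= p -> 0 <= y -> 0 <= s ->
  y `^ (p - 1) * s <= (1 - p^-1) * y `^ p + p^-1 * s `^ p.
Proof.
move=> p1 y0 s0; have [->|pn1] := eqVneq p 1.
  by rewrite subrr powRr0 invr1 subrr mul0r add0r !mul1r powRr1.
have p0 : 0 < p by exact: lt_le_trans ltr01 p1.
have pm1 : 0 < p - 1 by rewrite subr_gt0 lt_def pn1.
have q0 : 0 < p / (p - 1) by rewrite divr_gt0.
have := @conjugate_powR R (y `^ (p - 1)) s (p / (p - 1)) p (powR_ge0 _ _) s0 q0 p0.
have pn0 : p != 0 by rewrite gt_eqF.
have pm0 : p - 1 != 0 by rewrite gt_eqF.
rewrite -powRrM (_ : (p - 1) * (p / (p - 1)) = p); last by field.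
move=> /(_ _)/le_trans; apply.
  by field; rewrite pm0 pn0.
by rewrite (_ : 1 - p^-1 = (p / (p - 1))^-1) ?[_ / p]mulrC ?[y `^ p / _]mulrC //; field; rewrite pm0 pn0.
Qed.

(** The Gohberg-Krein estimate, in the dual form that is linear in the matrix
    entries: the products of the coefficients of the two families along the
    singular vectors are dominated by a doubly substochastic matrix, so that
    Young's inequality can be summed over both indices. *)
Lemma singular_values_pairing (R : realType) (H1 H2 : hilbertType R)
  (A : oper H1 H2) (a : H1 -> H2) (M : R) (s : nat -> R) (p K c d : R) k
  (u : nat -> H1) (v : nat -> H2) (y : nat -> R) :
  blin a M -> (forall f g, A (f, g) <-> g = a f) ->
  is_singular_values A s -> 1 <= p -> 0 <= K ->
  (forall N, \sum_(n < N) s n `^ p <= K `^ p) ->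
  0 < c -> 0 < d -> bessel k c u -> bessel k d v ->
  (forall i, 0 <= y i) -> \sum_(i < k) y i `^ p <= 1 ->
  \sum_(i < k) y i `^ (p - 1) * cabs (hdot (a (u i)) (v i)) <= c * d * K.
Proof.
move=> aM aA ssv p1 K0 sK c0 d0 bu bv y0 y1.
have s0 : forall n, 0 <= s n by case: ssv.
have p0 : 0 < p by exact: lt_le_trans ltr01 p1.
have pn0 : p != 0 by rewrite gt_eqF.
suff key K' : K < K' ->
    \sum_(i < k) y i `^ (p - 1) * cabs (hdot (a (u i)) (v i)) <= c * d * K'.
  apply/ler_addgt0Pl => eps eps0.
  have cd0 : 0 < c * d by rewrite mulr_gt0.
  have -> : eps + c * d * K = c * d * (K + eps / (c * d)).
    by field; rewrite !gt_eqF.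
  by apply: key; rewrite ltrDl divr_gt0.
move=> KK'; have K'0 : 0 < K' by exact: le_lt_trans KK'.
have sK' N : \sum_(n < N) (s n / K') `^ p <= 1.
  have iK : 0 <= K'^-1 by rewrite invr_ge0 ltW.
  rewrite (eq_bigr (fun n : 'I_N => s n `^ p * K'^-1 `^ p)); last by move=> n _; rewrite powRM.
  rewrite -mulr_suml.
  have -> : 1 = K' `^ p * K'^-1 `^ p by rewrite -powRM ?(ltW K'0) // mulfV ?gt_eqF // powR1.
  rewrite ler_wpM2r ?powR_ge0 //; apply: le_trans (sK N) _.
  by apply: ge0_ler_powR; rewrite ?nnegrE // ltW.
have [e' [g [e'_og e'_1 g_og g_1 FE]]] := schmidt_expansion aM aA ssv.
(* Partial sums of the Schmidt expansion of a. *)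
pose F f N := \sum_(n < N) ((s n)%:C * hdot f (e' n)) *: g n.
(* The substochastic matrix: by the arithmetic-geometric mean inequality it
   dominates the products of the coefficients, divided by c d. *)
pose D (i n : nat) : R := 2^-1 * (cabs (hdot (u i) (e' n)) ^+ 2 / c ^+ 2
                                + cabs (hdot (v i) (g n)) ^+ 2 / d ^+ 2).
have D0 i n : 0 <= D i n.
  by rewrite mulr_ge0 ?invr_ge0 // addr_ge0 // divr_ge0 ?sqr_ge0.
have c2 : 0 < c ^+ 2 by rewrite exprn_gt0.
have d2 : 0 < d ^+ 2 by rewrite exprn_gt0.
have sumD_n N i : (i < k)%N -> \sum_(n < N) D i n <= 1.
  move=> ik; rewrite -mulr_sumr big_split /= -!mulr_suml.
  rewrite ler_pdivrMl ?mulr1 // (_ : 2 = 1 + 1) //; apply: lerD.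
    rewrite ler_pdivrMr // mul1r.
    under eq_bigr do rewrite cabs_hdotC.
    apply: le_trans (bessel_orthog (e'_og N) (fun j _ => e'_1 j) _) _.
    rewrite expr1n mul1r ler_pXn2r ?nnegrE ?hnorm_ge0 ?(ltW c0) //.
    by apply: bessel_norm bu ik; exact: ltW.
  rewrite ler_pdivrMr // mul1r.
  under eq_bigr do rewrite cabs_hdotC.
  apply: le_trans (bessel_orthog (g_og N) (fun j _ => g_1 j) _) _.
  rewrite expr1n mul1r ler_pXn2r ?nnegrE ?hnorm_ge0 ?(ltW d0) //.
  by apply: bessel_norm bv ik; exact: ltW.
have sumD_i n : \sum_(i < k) D i n <= 1.
  rewrite -mulr_sumr big_split /= -!mulr_suml.
  rewrite ler_pdivrMl ?mulr1 // (_ : 2 = 1 + 1) //; apply: lerD.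
    rewrite ler_pdivrMr // mul1r; apply: le_trans (bu _) _.
    by rewrite ler_piMr ?sqr_ge0 // exprn_ile1 ?hnorm_ge0.
  rewrite ler_pdivrMr // mul1r; apply: le_trans (bv _) _.
  by rewrite ler_piMr ?sqr_ge0 // exprn_ile1 ?hnorm_ge0.
have cdK0 : 0 <= c * d * K' by rewrite !mulr_ge0 // ltW.
have FN N : \sum_(i < k) y i `^ (p - 1) * cabs (hdot (F (u i) N) (v i)) <= c * d * K'.
  have term i : cabs (hdot (F (u i) N) (v i)) <= \sum_(n < N) c * d * K' * ((s n / K') * D i n).
    rewrite hdot_suml; apply: le_trans (cabs_sum _) _; apply: ler_sum => n _.
    rewrite hdotZl !cabsM cabsR ger0_norm // (cabs_hdotC (g n)) /D.
    set x := cabs _; set z := cabs _.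
    have -> : c * d * K' * (s n / K' * (2^-1 * (x ^+ 2 / c ^+ 2 + z ^+ 2 / d ^+ 2)))
       = s n * x * z + s n * (c * d) / 2 * (x / c - z / d) ^+ 2.
      by field; rewrite !gt_eqF.
    by rewrite lerDl mulr_ge0 ?sqr_ge0 // divr_ge0 // !mulr_ge0 ?(ltW c0) ?(ltW d0).
  apply: (@le_trans _ _ (\sum_(i < k) \sum_(n < N) c * d * K' *
     (D i n * ((1 - p^-1) * y i `^ p + p^-1 * (s n / K') `^ p)))).
    apply: ler_sum => i _; apply: le_trans (ler_wpM2l (powR_ge0 _ _) (term i)) _.
    rewrite mulr_sumr; apply: ler_sum => n _.
    rewrite mulrCA ler_wpM2l //.
    rewrite mulrA [D i n * _]mulrC ler_wpM2r //; apply: young_powR => //.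
    by rewrite divr_ge0 // ltW.
  under eq_bigr do rewrite -mulr_sumr.
  rewrite -mulr_sumr ler_piMr //.
  have -> : \sum_(i < k) \sum_(n < N) D i n * ((1 - p^-1) * y i `^ p + p^-1 * (s n / K') `^ p)
    = (1 - p^-1) * (\sum_(i < k) y i `^ p * \sum_(n < N) D i n)
      + p^-1 * (\sum_(n < N) (s n / K') `^ p * \sum_(i < k) D i n).
    under [in RHS]eq_bigr do rewrite mulr_sumr.
    under [X in _ = _ + _ * X]eq_bigr do rewrite mulr_sumr.
    rewrite [X in _ = _ + _ * X]exchange_big /= !mulr_sumr -big_split /=.
    apply: eq_bigr => i _; rewrite !mulr_sumr -big_split /=.
    by apply: eq_bigr => n _; ring.
  have q0 : 0 <= p^-1 by rewrite invr_ge0 ltW.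
  have q1 : 0 <= 1 - p^-1 by rewrite subr_ge0 invf_le1.
  apply: (@le_trans _ _ ((1 - p^-1) * 1 + p^-1 * 1)); last by rewrite !mulr1 subrK.
  apply: lerD.
    rewrite ler_wpM2l //; apply: le_trans y1; apply: ler_sum => i _.
    by rewrite ler_piMr ?powR_ge0 // sumD_n.
  rewrite ler_wpM2l //; apply: le_trans (sK' N); apply: ler_sum => n _.
  by rewrite ler_piMr ?powR_ge0 // sumD_i.
apply/ler_addgt0Pl => eps eps0.
pose W := 1 + \sum_(i < k) y i `^ (p - 1) * hnorm (v i).
have W0 : 0 < W.
  by rewrite ltr_wpDr // sumr_ge0 // => i _; rewrite mulr_ge0 ?powR_ge0 ?hnorm_ge0.
have eW : 0 < eps / W by rewrite divr_gt0.
have [N hN] : exists N, forall i, (i < k)%N -> hnorm (F (u i) N - a (u i)) < eps / W.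
  have : exists N, forall n, (N <= n)%N -> forall i, (i < k)%N -> hnorm (F (u i) n - a (u i)) < eps / W.
    elim: (k) => [|m [N ih]]; first by exists 0%N.
    have [N' hN'] := FE (u m) _ eW; exists (maxn N N') => n.
    rewrite geq_max => /andP[Nn N'n] i; rewrite ltnS leq_eqVlt => /predU1P[->|im].
      exact: hN'.
    exact: ih.
  by move=> [N hN]; exists N; exact: hN.
apply: le_trans (_ : _ <= \sum_(i < k) (y i `^ (p - 1) * cabs (hdot (F (u i) N) (v i))
       + eps / W * (y i `^ (p - 1) * hnorm (v i)))) _.
  apply: ler_sum => i _; rewrite mulrCA -mulrDr ler_wpM2l ?powR_ge0 //.
  rewrite -lerBlDl; apply: le_trans (ler_norm _) _; apply: le_trans (cabs_dist _ _) _.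
  rewrite -hdotBl cabs_hdotC hdotC cabsJ; apply: le_trans (hdot_CS _ _) _.
  by rewrite ler_wpM2r ?hnorm_ge0 // hnorm_subC ltW // hN.
rewrite big_split /= addrC; apply: lerD; last exact: FN.
rewrite -mulr_sumr mulrAC ler_pdivrMr // ler_wpM2l ?(ltW eps0) //.
by rewrite /W ltW // ltrDr.
Qed.

(** * Orthonormal families *)

Section OrthonormalFamilies.
Variables (R : realType) (H : hilbertType R).
Implicit Types (u : nat -> H) (k : nat).

Definition orthonormal_family k u : Prop :=
  orthog k u /\ forall i, (i < k)%N -> hnorm (u i) = 1.

(** The residual is the part of f that the family does not see. *)
Lemma orthonormal_residual k u f : orthonormal_family k u ->
  let w := f - \sum_(i < k) hdot f (u i) *: u i in
  (forall i, (i < k)%N -> hdot w (u i) = 0) /\ hnorm w <= hnorm f.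
Proof.
move=> [ou u1] w.
have wu i : (i < k)%N -> hdot w (u i) = 0.
  move=> ik; rewrite hdotBl hdot_suml (bigD1 (Ordinal ik)) //= hdotZl hdotxx u1 //.
  rewrite expr1n mulr1 big1 ?addr0 ?subrr // => j ji.
  rewrite hdotZl ou ?mulr0 // => h; move/eqP: ji; apply; exact: val_inj.
split => //; pose s := \sum_(i < k) hdot f (u i) *: u i.
have : hnorm f ^+ 2 = hnorm w ^+ 2 + hnorm s ^+ 2.
  have {1}-> : f = w + s by rewrite subrK.
  rewrite hnorm_sqrD.
  rewrite (_ : hdot w s = 0) /= ?mulr0 ?addr0 //.
  by rewrite hdot_sumr big1 // => i _; rewrite hdotZr wu ?mulr0.
move=> h; rewrite -(ler_pXn2r (ltn0Sn 1)) ?nnegrE ?hnorm_ge0 // h.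
by rewrite lerDl sqr_ge0.
Qed.

Lemma orthonormal_extend k u f : orthonormal_family k u -> hnorm f = 1 ->
  (forall i, (i < k)%N -> hdot f (u i) = 0) ->
  orthonormal_family k.+1 (fun i => if (i < k)%N then u i else f).
Proof.
move=> [ou u1] f1 fu; split=> [i j|i]; last by case: ifP => // /u1.
rewrite !ltnS => ik jk ij; case: ifPn => [ik'|]; case: ifPn => // [jk'|].
- exact: ou.
- by move=> _; rewrite hdotC fu ?cj0.
- by move=> _; rewrite fu.
- rewrite -!leqNgt => kj ki; exfalso; apply: ij; apply/eqP.
  by rewrite eqn_leq (leq_trans ik kj) (leq_trans jk ki).
Qed.

Lemma orthonormal_bessel k u : orthonormal_family k u -> bessel k 1 u.
Proof. by move=> [ou u1]; apply: bessel_orthog => // i /u1 ->. Qed.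

End OrthonormalFamilies.

(** * Compactness by finite nets *)

Section Compactness.
Variables (R : realType) (H : hilbertType R).
Implicit Types (E : set H).

(** Compactness is stated with filters; sequences enter through the filter of
    tails. *)
Lemma compact_cluster_seq E (h : nat -> H) :
  compact (closure E) -> (forall n, E (h n)) ->
  exists l, forall e N, 0 < e -> exists2 n, (N <= n)%N & hnorm (h n - l) < e.
Proof.
move=> cE hE; have := cE (h @ \oo) _ _; case.
  by exists 0%N => // n _; apply: subset_closure; exact: hE.
move=> l [_ hl]; exists l => e N e0.
have [||_ [[n Nn <-] hn]] := hl (h @` [set n | (N <= n)%N]) [set y | hnorm (l - y) < e].
- by exists N => // n /= Nn; exists n.
- by apply/nbhs_hnorm; exists e.
- by exists n => //; rewrite hnorm_subC.
Qed.

(** Totally bounded sets in a complete space are relatively compact: an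
    ultrafilter contains one of the finitely many balls of each radius, so it
    is Cauchy. *)
Lemma compact_of_nets E :
  (forall e, 0 < e -> exists l : seq H,
     forall x, E x -> exists2 y, y \in l & hnorm (x - y) < e) ->
  compact (closure E).
Proof.
move=> nets; rewrite compact_ultra => F FU FE.
have FF : ProperFilter F by exact: ultra_proper.
have small e : 0 < e -> exists y, F [set x | hnorm (x - y) < e].
  move=> e0; have e2 : 0 < e / 2 by rewrite divr_gt0.
  have [l hl] := nets _ e2.
  have : F [set x | exists2 y, y \in l & hnorm (x - y) < e].
    apply: filterS FE => x /closure_hnorm/(_ _ e2)[a /hl[y yl ay] xa].
    by exists y => //; have := hnorm_dist3 a x y; lra.
  elim: (l) => [|b m ih].
    by move=> h; exfalso; apply: (@filter_not_empty _ F); apply: filterS h => x [].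
  move=> h; have [hb|hb] := in_ultra_setVsetC [set x | hnorm (x - b) < e] FU.
    by exists b.
  apply: ih; apply: filterS2 h hb => x [y]; rewrite in_cons => /predU1P[->//|ym] xy _.
  by exists y.
have : cvg F.
  apply/cauchy_cvgP/cauchy_ballP => e /complex_gt0[-> e0].
  have e2 : 0 < complex.Re e / 2 by rewrite divr_gt0.
  have [y hy] := small _ e2.
  exists ([set x | hnorm (x - y) < complex.Re e / 2],
          [set x | hnorm (x - y) < complex.Re e / 2]) => //=.
  move=> [a b] /= [ha hb]; apply/ball_hnorm => //.
  by have := hnorm_dist3 y a b; rewrite (hnorm_subC y b); lra.
move=> /cvg_ex[/= l Fl]; exists l; split => //.
apply: closed_closure => B /Fl FB; apply: (@filter_ex _ F).
exact: filterI FE FB.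
Qed.

(** A square grid of mesh d / 2. *)
Lemma complex_net (B d : R) : 0 < d -> exists L : seq R[i],
  forall c, cabs c <= B -> exists2 c', c' \in L & cabs (c - c') < d.
Proof.
move=> d0; have [B0|B0] := ltP B 0.
  by exists [::] => c /le_lt_trans/(_ B0); rewrite ltNge cabs_ge0.
pose t := d / 2; have t0 : 0 < t by rewrite divr_gt0.
pose n := (Num.truncn (2 * B / t)).+1.
pose G := [seq (j%:R * t - B : R) | j <- iota 0 n].
have GP (x : R) : `|x| <= B -> exists2 y, y \in G & `|x - y| < t.
  rewrite ler_norml => /andP[x1 x2].
  have q0 : 0 <= (x + B) / t by rewrite divr_ge0 ?(ltW t0) //; lra.
  pose j := Num.truncn ((x + B) / t).
  have /andP[j1 j2] := truncn_itv q0.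
  exists (j%:R * t - B).
    apply/mapP; exists j => //; rewrite mem_iota /= add0n ltnS.
    apply: le_truncn; rewrite ler_pM2r ?invr_gt0 //; lra.
  move: j1 j2; rewrite -/j ler_pdivlMr // ltr_pdivrMr // mulrSr mulrDl mul1r => j1 j2.
  by rewrite ltr_norml; lra.
exists [seq (p.1 +i* p.2) | p <- [seq (x, y) | x <- G, y <- G]] => c cB.
have [x xG hx] := GP _ (le_trans (Re_le_cabs c) cB).
have [y yG hy] := GP _ (le_trans (Im_le_cabs c) cB).
exists (x +i* y); first by apply/mapP; exists (x, y) => //; apply/allpairsP; exists (x, y).
apply: le_lt_trans (cabs_le_ReIm _) _; rewrite ReD ImD ReN ImN /=.
by have -> : d = t + t; [rewrite /t; lra|exact: ltrD].
Qed.

(** A bounded part of a finite-dimensional space has finite nets: induction on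
    the number of vectors, with a net for the last coefficient. *)
Lemma combination_net k (b : nat -> H) (B e : R) : 0 < e ->
  exists l : seq H, forall c : nat -> R[i], (forall i, (i < k)%N -> cabs (c i) <= B) ->
  exists2 y, y \in l & hnorm (\sum_(i < k) c i *: b i - y) < e.
Proof.
elim: k e => [|k ih] e e0.
  by exists [:: 0] => c _; exists 0; rewrite ?inE // big_ord0 subrr hnorm0.
have e2 : 0 < e / 2 by rewrite divr_gt0.
have [l hl] := ih _ e2.
have n1 : 0 < hnorm (b k) + 1 by rewrite ltr_wpDl // hnorm_ge0.
have [L hL] := @complex_net B (e / 2 / (hnorm (b k) + 1)) (divr_gt0 e2 n1).
exists [seq (p.1 + p.2 *: b k) | p <- [seq (x, y) | x <- l, y <- L]] => c cB.
have [y yl hy] := hl c (fun i ik => cB i (leqW ik)).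
have [c' c'L hc'] := hL _ (cB k (leqnn _)).
exists (y + c' *: b k); first by apply/mapP; exists (y, c') => //; apply/allpairsP; exists (y, c').
rewrite big_ord_recr /= opprD addrACA -scalerBl.
apply: le_lt_trans (hnormD _ _) _; rewrite hnormZ.
have : cabs (c k - c') * hnorm (b k) < e / 2.
  move: hc'; rewrite ltr_pdivlMr // mulrDr mulr1; have := cabs_ge0 (c k - c'); lra.
lra.
Qed.

End Compactness.

(** * Existence of singular values *)

Section SingularValuesExist.
Variables (R : realType) (H1 H2 : hilbertType R).
Variables (A : oper H1 H2) (a : H1 -> H2) (M : R).
Hypothesis aM : blin a M.
Hypothesis aA : forall f g, A (f, g) <-> g = a f.

(** At a point where the bound s of an operator on a subspace is attained, the
    nonnegative form s^2 <f, g> - <a f, a g> degenerates, hence vanishes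
    against every f. *)
Lemma maximizer_eigen (V : H1 -> Prop) e (s : R) :
  (forall c u v, V u -> V v -> V (c *: u + v)) -> V e -> hnorm e = 1 ->
  hnorm (a e) = s -> (forall f, V f -> hnorm (a f) <= s * hnorm f) ->
  forall f, V f -> hdot (a f) (a e) = (s ^+ 2)%:C * hdot f e.
Proof.
move=> Vlin Ve e1 ae sV f Vf.
have s0 : 0 <= s by rewrite -ae hnorm_ge0.
pose q (u : H1) := s ^+ 2 * hnorm u ^+ 2 - hnorm (a u) ^+ 2.
have q_ge0 u : V u -> 0 <= q u.
  move=> /sV h; rewrite subr_ge0 -exprMn ler_pXn2r ?nnegrE ?hnorm_ge0 //.
  by rewrite mulr_ge0 ?hnorm_ge0.
pose be := (s ^+ 2)%:C * hdot f e - hdot (a f) (a e).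
suff : be = 0 by move/eqP; rewrite subr_eq0 => /eqP <-.
have qf0 := q_ge0 _ Vf.
pose t := (q f + 1)^-1.
have t0 : 0 < t by rewrite invr_gt0 ltr_wpDl.
have hbe (ka : R[i]) : complex.Re (ka * be) =
    s ^+ 2 * complex.Re (ka * hdot f e) - complex.Re (ka * hdot (a f) (a e)).
  by rewrite /be mulrBr ReD ReN mulrCA Re_realM.
have := q_ge0 _ (Vlin (- (t%:C * cj be)) _ _ Vf Ve).
rewrite /q (blin_lin aM) !hnorm_sqrD !hnormZ e1 ae !hdotZl.
have -> : s ^+ 2 * ((cabs (- (t%:C * cj be)) * hnorm f) ^+ 2 + 1 ^+ 2 +
     2 * complex.Re (- (t%:C * cj be) * hdot f e)) -
    ((cabs (- (t%:C * cj be)) * hnorm (a f)) ^+ 2 + s ^+ 2 +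
     2 * complex.Re (- (t%:C * cj be) * hdot (a f) (a e)))
  = cabs (- (t%:C * cj be)) ^+ 2 * q f
    + 2 * complex.Re (- (t%:C * cj be) * be).
  by rewrite hbe /q; ring.
rewrite cabsN cabsM cabsR gtr0_norm // cabsJ mulNr -(mulrA t%:C) [cj be * _]mulrC.
rewrite cabs_mulJ ReN Re_realM /= => h.
have h3 : t * q f <= 1 by rewrite /t mulrC ler_pdivrMr // ?mul1r ?lerDl // ltr_wpDl.
apply: cabs_eq0; apply/eqP; rewrite -sqrf_eq0 eq_le sqr_ge0 andbT -(pmulr_rle0 _ t0).
have h4 : 0 <= t * cabs be ^+ 2 * (1 - t * q f).
  by rewrite mulr_ge0 ?subr_ge0 // mulr_ge0 ?sqr_ge0 // ltW.
by move: h h4; set x := cabs be; nra.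
Qed.

Hypothesis cptA : compact (closure (snd @` [set u | A u /\ hnorm u.1 <= 1])).

Let perp (l : seq H1) f := forall x, x \in l -> hdot f x = 0.

Let perp_lin l c u v : perp l u -> perp l v -> perp l (c *: u + v).
Proof. by move=> hu hv x xl; rewrite hdotDl hdotZl hu // hv // mulr0 addr0. Qed.

Let max_spec l e := [/\ perp l e, hnorm e <= 1,
  forall f, perp l f -> hnorm (a f) <= hnorm (a e) * hnorm f,
  0 < hnorm (a e) -> hnorm e = 1 & hnorm (a e) = 0 -> e = 0].

(** The supremum of the norm of the images of unit vectors is attained: if the
    images of a maximizing sequence converge, then so do the images of the
    midpoints, whose norms are therefore almost maximal, and the parallelogram
    law makes the sequence itself Cauchy. *)
Let max_ex l : exists e, max_spec l e.
Proof.
pose E := [set hnorm (a f) | f in [set f | perp l f /\ hnorm f <= 1]].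
have p0 : perp l 0 by move=> x _; rewrite hdot0l.
have hE : has_sup E.
  split; first by exists (hnorm (a 0)), 0 => //; split => //; rewrite hnorm0.
  exists M => _ [f [_ f1] <-]; apply: le_trans (blin_le aM f) _.
  by rewrite -[leRHS]mulr1 ler_wpM2l // (blin_ge0 aM).
pose m := sup E.
have m_ge f : perp l f -> hnorm (a f) <= m * hnorm f.
  move=> pf; have [->|f0] := eqVneq f 0.
    by rewrite (blin0 aM) !hnorm0 mulr0.
  have nf := hnorm_gt0 f0; rewrite -ler_pdivrMr //.
  have -> : hnorm (a f) / hnorm f = hnorm (a (((hnorm f)^-1)%:C *: f)).
    by rewrite (blinZ aM) hnormZ cabsR gtr0_norm ?invr_gt0 // mulrC.
  apply: ub_le_sup; first exact: hE.2.
  exists (((hnorm f)^-1)%:C *: f) => //; split.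
    by rewrite -[_ *: _]addr0; exact: perp_lin.
  by rewrite hnormZ cabsR gtr0_norm ?invr_gt0 // mulVf // gt_eqF.
have [m0|m0] := leP m 0.
  exists 0; split => //; rewrite ?hnorm0 ?(blin0 aM) ?hnorm0 ?ltxx //.
  move=> f /m_ge /le_trans; apply; by rewrite mul0r mulr_le0_ge0 ?hnorm_ge0.
have /choice[f fP] : forall n, exists f, [/\ perp l f, hnorm f <= 1 & m - n.+1%:R^-1 < hnorm (a f)].
  move=> n; have : (0 : R) < n.+1%:R^-1 by rewrite invr_gt0 ltr0n.
  by move=> /sup_adherent/(_ hE)[_ [f [pf f1] <-] hf]; exists f.
have [h hh] := @compact_cluster_seq _ _ _ (a \o f) cptA
  (fun n => let: And3 _ f1 _ := fP n in
    ex_intro2 _ _ (f n, a (f n)) (conj ((aA _ _).2 erefl) f1) erefl).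
have /choice[g gP] : forall n, exists g, [/\ perp l g, hnorm g <= 1,
    m - n.+1%:R^-1 < hnorm (a g) & hnorm (a g - h) < n.+1%:R^-1].
  move=> n; have : (0 : R) < n.+1%:R^-1 by rewrite invr_gt0 ltr0n.
  move=> /(hh _ n)[j nj hj]; have [q1 q2 q3] := fP j; exists (f j); split => //.
  apply: le_lt_trans q3; rewrite lerD2l lerN2.
  by rewrite lef_pV2 ?posrE ?ltr0n // ler_nat ltnS.
have gC : hcauchy g.
  move=> e e0; have : 0 < m * e ^+ 2 / 16 by rewrite !mulr_gt0 ?exprn_gt0.
  move=> /invS_small[N hN]; exists N => i j Ni Nj.
  have [pi i1 hi1 hi2] := gP i; have [pj j1 hj1 hj2] := gP j.
  have ei := hN _ Ni; have ej := hN _ Nj.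
  set d := m * e ^+ 2 / 16 in ei ej.
  have d0 : 0 < d by rewrite !mulr_gt0 ?exprn_gt0.
  have hs : hnorm (a (g i + g j)) <= m * hnorm (g i + g j).
    by apply: m_ge; rewrite -[g i]scale1r; exact: perp_lin.
  have hd : 2 * hnorm (a (g i)) <= hnorm (a (g i + g j)) + hnorm (a (g i) - a (g j)).
    have -> : 2 * hnorm (a (g i)) = hnorm (a (g i + g j) + (a (g i) - a (g j))).
      by rewrite (blinD aM) addrACA subrr addr0 -[in RHS]mulr2n -[in RHS]scaler_nat hnormZ cabs_nat.
    exact: hnormD.
  have ht := hnorm_dist3 h (a (g i)) (a (g j)).
  rewrite (hnorm_subC h) in ht.
  have par := parallelogram (g i) (g j).
  have i1' : hnorm (g i) ^+ 2 <= 1 by rewrite exprn_ile1 ?hnorm_ge0.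
  have j1' : hnorm (g j) ^+ 2 <= 1 by rewrite exprn_ile1 ?hnorm_ge0.
  have low : 2 * m - 4 * d < m * hnorm (g i + g j).
    move: hi1 hi2 hj1 hj2 ei ej hs hd ht.
    set x1 := i.+1%:R^-1; set x2 := j.+1%:R^-1.
    set x3 := hnorm (a (g i)); set x4 := hnorm (a (g j)).
    set x5 := hnorm (_ - h); set x6 := hnorm (_ - h); set x7 := hnorm (a (_ + _)).
    by set x8 := hnorm (_ - _); set x9 := m * _; lra.
  rewrite -(ltr_pXn2r (ltn0Sn 1)) ?nnegrE ?hnorm_ge0 ?ltW //.
  have s2 : hnorm (g i + g j) <= 2 by apply: le_trans (hnormD _ _) _; lra.
  have low2 : 2 - e ^+ 2 / 4 < hnorm (g i + g j).
    rewrite -(ltr_pM2l m0); apply: le_lt_trans low; rewrite /d; lra.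
  have := hnorm_ge0 (g i + g j).
  by move: par low2 s2; set x := hnorm (_ + _); set y := hnorm (_ - _) ^+ 2; nra.
have [e ge] := hcauchy_cvg gC.
have pe : perp l e.
  move=> x xl; apply: cabs_eq0; apply/eqP; rewrite eq_le cabs_ge0 andbT.
  apply/ler_addgt0Pl => d d0; rewrite addr0.
  have : 0 < d / (hnorm x + 1) by rewrite divr_gt0 // ltr_wpDl // hnorm_ge0.
  move=> /ge[N /(_ N (leqnn N))]; have [pN _ _ _] := gP N.
  rewrite ltr_pdivlMr ?ltr_wpDl ?hnorm_ge0 // => hN.
  have -> : hdot e x = hdot (e - g N) x by rewrite hdotBl pN // subr0.
  apply: le_trans (hdot_CS _ _) _; rewrite hnorm_subC.
  by move: hN; have := hnorm_ge0 (g N - e); have := hnorm_ge0 x; nra.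
have e1 : hnorm e <= 1.
  apply/ler_addgt0Pl => d /ge[N /(_ N (leqnn N))] hN.
  have [_ gN _ _] := gP N; have := hnormD (e - g N) (g N); rewrite subrK hnorm_subC.
  by lra.
have ae : m <= hnorm (a e).
  apply/ler_addgt0Pl => d d0; have d2 : 0 < d / 2 by rewrite divr_gt0.
  have [N hN] := invS_small d2; have [N' hN'] := blin_hlim aM ge d2.
  have := hN _ (leq_maxl N N'); have /= := hN' _ (leq_maxr N N').
  have [_ _ h1 _] := gP (maxn N N').
  have := hnormD (a (g (maxn N N')) - a e) (a e); rewrite subrK.
  move: h1; set x := _^-1; set y := hnorm (_ - _); set z := hnorm (a (g _)); lra.
have ae2 : hnorm (a e) = m.
  apply/eqP; rewrite eq_le ae andbT; apply: le_trans (m_ge _ pe) _.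
  by rewrite ler_piMr // ltW.
exists e; split => //; rewrite ae2 //.
  move=> _; apply/eqP; rewrite eq_le e1 /= -(ler_pM2l m0) mulr1 -{1}ae2.
  exact: m_ge.
by move=> mz; rewrite mz ltxx in m0.
Qed.

(** Singular vectors are chosen greedily, each one maximizing the norm of the
    image among the unit vectors orthogonal to the previous ones. Compactness
    forces the values to tend to zero, so nothing nonzero is left orthogonal
    to all of them. *)
Lemma singular_values_exist : exists s, is_singular_values A s.
Proof.
have /choice[pk pkP] := max_ex.
pose L n := iter n (fun l => rcons l (pk l)) [::].
pose e n := pk (L n).
have L1 m n : (m < n)%N -> e m \in L n.
  elim: n => // n ih; rewrite ltnS leq_eqVlt /L iterS mem_rcons in_cons => /predU1P[->|/ih].
    by rewrite eqxx.
  by rewrite /L => ->; rewrite orbT.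
have L2 n x : x \in L n -> exists2 m, (m < n)%N & x = e m.
  elim: n => // n ih; rewrite /L iterS mem_rcons in_cons => /predU1P[->|/ih[m mn ->]].
    by exists n.
  by exists m => //; exact: leqW.
pose s n := hnorm (a (e n)).
have s_ge0 n : 0 <= s n by exact: hnorm_ge0.
have perpE n f : (forall m, (m < n)%N -> hdot f (e m) = 0) <-> perp (L n) f.
  by split=> [h x /L2[m mn ->]|h m mn]; [exact: h|apply: h; exact: L1].
have e_perp m n : (m < n)%N -> hdot (e n) (e m) = 0.
  by move=> mn; have [/perpE h _ _ _ _] := pkP (L n); exact: h.
have s_le m n : (m <= n)%N -> s n <= s m.
  move=> mn; have [_ _ h _ _] := pkP (L m); have [_ e1 _ _ _] := pkP (L n).
  apply: le_trans (h (e n) _) _.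
    by apply/perpE => j jm; apply: e_perp; exact: leq_trans jm mn.
  by rewrite -[leRHS]mulr1; apply: ler_wpM2l => //; exact: hnorm_ge0.
have e1 n : 0 < s n -> hnorm (e n) = 1 by have [_ _ _ h _] := pkP (L n).
have on n : 0 < s n -> orthonormal_family n e.
  move=> sn; split=> [i j ik jk ij|i ik].
    have [ij'|] := ltnP i j; first by rewrite hdotC e_perp ?cj0.
    by rewrite leq_eqVlt => /predU1P[/esym//|]; exact: e_perp.
  by apply: e1; apply: lt_le_trans sn (s_le _ _ (ltnW ik)).
have eig n f : 0 < s n -> hdot (a f) (a (e n)) = (s n ^+ 2)%:C * hdot f (e n).
  elim/ltn_ind: n f => n ih f sn.
  have [pe _ mx _ _] := pkP (L n).
  have [/perpE wperp _] := orthonormal_residual f (on n sn).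
  have key := maximizer_eigen (@perp_lin (L n)) pe (e1 n sn) erefl mx.
  pose w := \sum_(i < n) hdot f (e i) *: e i.
  have fE : f = (f - w) + w by rewrite subrK.
  rewrite [in LHS]fE [in RHS]fE (blinD aM) [in LHS]hdotDl [in RHS]hdotDl mulrDr.
  congr (_ + _); first exact: key.
  rewrite /w (blin_sum aM) !hdot_suml mulr_sumr; apply: eq_bigr => i _.
  have si : 0 < s i by apply: lt_le_trans sn (s_le _ _ (ltnW (ltn_ord i))).
  rewrite (blinZ aM) !hdotZl [hdot (a _) _]hdotC [hdot (e i) _]hdotC.
  by rewrite ih // e_perp // !(mulr0, cj0).
exists s; split => //.
exists e; split.
- move=> m n sm sn; case: eqVneq => [<-|mn].
    by rewrite hdotxx e1 // expr1n.
  have [mn'|] := ltnP m n; first by rewrite hdotC e_perp ?cj0.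
  by rewrite leq_eqVlt => /predU1P[h|]; [rewrite h eqxx in mn|exact: e_perp].
- move=> n sn; exists (a (e n)); first exact/aA.
  by move=> f _ /aA ->; rewrite /= hdotZr cjR eig.
- move=> f fe; apply/aA/esym; apply: hnorm_le_eps => d d0.
  have fs n : hnorm (a f) <= s n * hnorm f.
    have [_ _ h _ _] := pkP (L n); apply: h; apply/perpE => m mn.
    have [sm|] := boolP (0 < s m); first exact: fe.
    rewrite lt_def s_ge0 andbT negbK => /eqP h0.
    by have [_ _ _ _ h1] := pkP (L m); rewrite /e h1 ?hdot0r.
  suff [n sn] : exists n, s n < d / (hnorm f + 1).
    apply: le_trans (fs n) _; move: sn.
    rewrite ltr_pdivlMr ?ltr_wpDl ?hnorm_ge0 //.
    by have := s_ge0 n; have := hnorm_ge0 f; nra.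
  (* Otherwise the images of the e n stay apart from each other. *)
  apply: contrapT => no; pose t := d / (hnorm f + 1).
  have t0 : 0 < t by rewrite divr_gt0 // ltr_wpDl // hnorm_ge0.
  have st n : t <= s n by rewrite leNgt; apply/negP => h; apply: no; exists n.
  have s_gt0 n : 0 < s n by exact: lt_le_trans t0 (st n).
  have [h hh] := @compact_cluster_seq _ _ _ (a \o e) cptA
    (fun n => let: And5 _ f1 _ _ _ := pkP (L n) in
      ex_intro2 _ _ (e n, a (e n)) (conj ((aA _ _).2 erefl) f1) erefl).
  have t2 : 0 < t / 2 by rewrite divr_gt0.
  have [m _ hm] := hh _ 0%N t2; have [n mn hn] := hh _ m.+1 t2.
  have : hnorm (a (e m) - a (e n)) < t.
    have := hnorm_dist3 h (a (e m)) (a (e n)); rewrite (hnorm_subC h).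
    by move: hm hn => /=; lra.
  apply/negP; rewrite -leNgt -(ler_pXn2r (ltn0Sn 1)) ?nnegrE ?hnorm_ge0 ?(ltW t0) //.
  rewrite hnorm_sqrD hnormN hdotNr eig // hdotC e_perp // cj0 mulr0 oppr0 /= mulr0 addr0.
  apply: (@le_trans _ _ (s m ^+ 2)); last by rewrite lerDl sqr_ge0.
  by rewrite ler_pXn2r ?nnegrE // ltW.
Qed.

End SingularValuesExist.

(** * The Schatten norm by duality *)

Section SchattenSums.
Variables (R : realType) (H1 H2 : hilbertType R).
Implicit Types (A : oper H1 H2) (a : H1 -> H2) (p K M : R) (s : nat -> R).

Lemma singular_values_spec A a M : blin a M ->
  (forall f g, A (f, g) <-> g = a f) -> compact_oper A ->
  is_singular_values A (singular_values A).
Proof.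
move=> aM aA [_ cA]; have [s hs] := singular_values_exist aM aA cA.
by apply: (@xgetPex _ _ [set s | is_singular_values A s]); exists s.
Qed.

Let partialE A p N : (\sum_(0 <= k < N) `|(EFin \o singular_values A) k| `^ p)%E
  = (\sum_(n < N) `|singular_values A n| `^ p)%:E.
Proof.
rewrite -sumEFin big_mkord; apply: eq_bigr => n _.
by [].
Qed.

Let sum_ge0 A p n : (0 <= `|(EFin \o singular_values A) n| `^ p)%E.
Proof. exact: poweR_ge0. Qed.

Lemma schatten_norm_sums A p : 1 <= p -> (schatten_norm p A < +oo)%E ->
  exists K, [/\ 0 <= K, schatten_norm p A = K%:E &
    forall N, \sum_(n < N) `|singular_values A n| `^ p <= K `^ p].
Proof.
move=> p1; have p0 : 0 < p by exact: lt_le_trans ltr01 p1.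
rewrite /schatten_norm Lnorm_counting //.
set S := (X in (X `^ _)%E) => Soo.
have S0 : (0 <= S)%E by apply: nneseries_ge0 => n _ _; exact: sum_ge0.
have SE : S = ((S `^ p^-1) `^ p)%E by rewrite -poweRrM mulVf ?gt_eqF // poweRe1.
have := poweR_ge0 S p^-1; move: Soo SE.
case: (S `^ p^-1)%E => [K| |] // _ SE K0; exists K; split => // N.
rewrite -lee_fin -partialE -poweR_EFin -SE.
exact: nneseries_lim_ge.
Qed.

Lemma schatten_norm_le A p K : 1 <= p -> 0 <= K ->
  (forall N, \sum_(n < N) `|singular_values A n| `^ p <= K `^ p) ->
  (schatten_norm p A <= K%:E)%E.
Proof.
move=> p1 K0 hK; have p0 : 0 < p by exact: lt_le_trans ltr01 p1.
rewrite /schatten_norm Lnorm_counting //.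
set S := (X in (X `^ _)%E).
have S0 : (0 <= S)%E by apply: nneseries_ge0 => n _ _; exact: sum_ge0.
have SK : (S <= (K `^ p)%:E)%E.
  apply: lime_le; first by apply: is_cvg_nneseries => n _ _; exact: sum_ge0.
  by near=> N; rewrite partialE lee_fin.
have -> : K%:E = ((K `^ p)%:E `^ p^-1)%E.
  by rewrite poweR_EFin -powRrM mulfV ?gt_eqF // powRr1.
apply: gt0_ler_poweR; rewrite ?invr_ge0 ?(ltW p0) //.
- by rewrite in_itv /= S0 leey.
- by rewrite in_itv /= lee_fin powR_ge0 leey.
Unshelve. all: by end_near.
Qed.

(** Duality with the l^q norm of the coefficients, in a form that makes sense
    for p = 1: the coefficients of the dual norm are written as y ^ (p - 1). *)
Definition dual_bound p K a : Prop :=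
  forall k (u : nat -> H1) (v : nat -> H2) (y : nat -> R),
    orthonormal_family k u -> orthonormal_family k v ->
    (forall i, 0 <= y i) -> \sum_(i < k) y i `^ p <= 1 ->
    \sum_(i < k) y i `^ (p - 1) * cabs (hdot (a (u i)) (v i)) <= K.

Lemma dual_bound_ge0 p K a : dual_bound p K a -> 0 <= K.
Proof.
move/(_ 0%N (fun=> 0) (fun=> 0) (fun=> 0)); rewrite !big_ord0; exact.
Qed.

(** The coefficients are taken to be the ones for which Hoelder's inequality
    is an equality. *)
Lemma dual_bound_sum p K a k (u : nat -> H1) (v : nat -> H2) :
  1 <= p -> dual_bound p K a ->
  orthonormal_family k u -> orthonormal_family k v ->
  \sum_(i < k) cabs (hdot (a (u i)) (v i)) `^ p <= K `^ p.
Proof.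
move=> p1 aK ou ov; have K0 := dual_bound_ge0 aK.
have p0 : 0 < p by exact: lt_le_trans ltr01 p1.
pose b i := cabs (hdot (a (u i)) (v i)).
pose X := \sum_(i < k) b i `^ p; rewrite -/X.
have X0 : 0 <= X by apply: sumr_ge0 => i _; exact: powR_ge0.
have [->|Xn0] := eqVneq X 0; first exact: powR_ge0.
have Xp : 0 < X by rewrite lt_def Xn0.
pose t := X `^ p^-1; have t0 : 0 < t by rewrite powR_gt0.
have tp : t `^ p = X by rewrite -powRrM mulVf ?gt_eqF // powRr1.
have it0 : 0 <= t^-1 by rewrite invr_ge0 ltW.
have ip : t^-1 `^ p = X^-1.
  rewrite -tp; apply: (@mulfI _ (t `^ p)); first by rewrite tp gt_eqF.
  by rewrite -powRM ?(ltW t0) // !mulfV ?gt_eqF ?powR1 // tp.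
have := aK k u v (fun i => b i / t) ou ov.
have -> : \sum_(i < k) (b i / t) `^ p = 1.
  rewrite (eq_bigr (fun i : 'I_k => b i `^ p * X^-1)); last first.
    by move=> i _; rewrite powRM ?cabs_ge0 // ip.
  by rewrite -mulr_suml mulfV.
move=> /(_ (fun i => divr_ge0 (cabs_ge0 _) (ltW t0)) (lexx _)).
have -> : \sum_(i < k) (b i / t) `^ (p - 1) * cabs (hdot (a (u i)) (v i)) = t.
  rewrite (eq_bigr (fun i : 'I_k => t * (b i `^ p * X^-1))); last first.
    move=> i _; rewrite -/(b i).
    have bt0 : 0 <= b i / t by rewrite divr_ge0 ?cabs_ge0 // ltW.
    have -> : b i `^ p * X^-1 = (b i / t) * (b i / t) `^ (p - 1).
      by rewrite mulr_powRB1 // powRM ?cabs_ge0 // ip.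
    by rewrite mulrA mulrCA mulfV ?gt_eqF // mulr1 mulrC.
  by rewrite -mulr_sumr -mulr_suml mulfV // mulr1.
move=> tK; rewrite -tp; apply: ge0_ler_powR; rewrite ?nnegrE //; exact: ltW.
Qed.

Variables (a : H1 -> H2) (M p K : R).
Hypothesis aM : blin a M.
Hypothesis p1 : 1 <= p.
Hypothesis aK : dual_bound p K a.

(** Greedily extending a pair of orthonormal families along which the operator
    is large must stop, and what remains is then small on the complements. *)
Lemma small_residual d : 0 < d -> exists k u v,
  [/\ orthonormal_family k u, orthonormal_family k v &
   forall f h, (forall i, (i < k)%N -> hdot f (u i) = 0) ->
     (forall i, (i < k)%N -> hdot h (v i) = 0) ->
     cabs (hdot (a f) h) <= d * hnorm f * hnorm h].
Proof.
move=> d0; apply: contrapT => no.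
have grow k : exists (u : nat -> H1) (v : nat -> H2),
  [/\ orthonormal_family k u, orthonormal_family k v &
      forall i, (i < k)%N -> d <= cabs (hdot (a (u i)) (v i))].
  elim: k => [|k [u [v [ou ov uv]]]].
    by exists (fun=> 0), (fun=> 0); split => //; split => // i j.
  have : exists f h, [/\ (forall i, (i < k)%N -> hdot f (u i) = 0),
     (forall i, (i < k)%N -> hdot h (v i) = 0) &
     d * hnorm f * hnorm h < cabs (hdot (a f) h)].
    apply: contrapT => no2; apply: no; exists k, u, v; split => // f h fu hv.
    by rewrite leNgt; apply/negP => fh; apply: no2; exists f, h.
  move=> [f [h [fu hv fh]]].
  have f0 : f != 0.
    by apply/eqP => f0; move: fh; rewrite f0 (blin0 aM) hdot0l cabs0 hnorm0 mulr0 mul0r ltxx.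
  have h0 : h != 0.
    by apply/eqP => h0; move: fh; rewrite h0 hdot0r cabs0 hnorm0 mulr0 ltxx.
  have nf := hnorm_gt0 f0; have nh := hnorm_gt0 h0.
  pose f' := ((hnorm f)^-1)%:C *: f; pose h' := ((hnorm h)^-1)%:C *: h.
  exists (fun i => if (i < k)%N then u i else f'), (fun i => if (i < k)%N then v i else h').
  split.
  - apply: orthonormal_extend => //.
      by rewrite hnormZ cabsR gtr0_norm ?invr_gt0 // mulVf // gt_eqF.
    by move=> i /fu; rewrite /f' hdotZl => ->; rewrite mulr0.
  - apply: orthonormal_extend => //.
      by rewrite hnormZ cabsR gtr0_norm ?invr_gt0 // mulVf // gt_eqF.
    by move=> i /hv; rewrite /h' hdotZl => ->; rewrite mulr0.
  - move=> i; rewrite ltnS; case: ifPn => [ik _|_ _]; first exact: uv.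
    rewrite /f' /h' (blinZ aM) hdotZl hdotZr cjR !cabsM !cabsR.
    rewrite !gtr0_norm ?invr_gt0 // mulrA -invfM mulrC ler_pdivlMr ?mulr_gt0 //.
    by rewrite mulrA ltW.
have dp : 0 < d `^ p by rewrite powR_gt0.
have p0 : 0 < p by exact: lt_le_trans ltr01 p1.
have q0 : 0 <= K `^ p / d `^ p by rewrite divr_ge0 ?powR_ge0.
(* More than (K / d)^p pairs with coefficients at least d would contradict the
   bound of the sum of their p-th powers. *)
pose n := (Num.truncn (K `^ p / d `^ p)).+1.
have [u [v [ou ov uv]]] := grow n.
have := dual_bound_sum p1 aK ou ov; apply/negP; rewrite -ltNge.
apply: (@lt_le_trans _ _ (\sum_(i < n) d `^ p)).
  rewrite sumr_const card_ord -mulr_natl -ltr_pdivrMr //; exact: truncnS_gt.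
apply: ler_sum => i _; apply: ge0_ler_powR; rewrite ?nnegrE ?cabs_ge0 ?(ltW d0) ?(ltW p0) //.
exact: uv.
Qed.

(** Off two finite families the operator is small, so it is a norm limit of
    operators of finite rank. *)
Lemma dual_bound_compact : compact_oper (graph a).
Proof.
split; first exact: bounded_oper_graph aM.
apply: compact_of_nets => e e0.
have e4 : 0 < e / 4 by rewrite divr_gt0.
have [k [u [v [ou ov res]]]] := small_residual e4.
have [l1 hl1] := @combination_net _ _ k (a \o u) 1 _ e4.
have [l2 hl2] := @combination_net _ _ k v M _ e4.
exists [seq q.1 + q.2 | q <- [seq (x, y) | x <- l1, y <- l2]] => _ [[f g] /= [gf f1] <-] /=.
have {gf g}-> : g = a f by [].
have [fu f2] := orthonormal_residual f ou.
set f' := f - _ in fu f2.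
have [gv g2] := orthonormal_residual (a f') ov.
set g' := a f' - _ in gv g2.
have [x xl hx] : exists2 x, x \in l1 & hnorm (\sum_(i < k) hdot f (u i) *: a (u i) - x) < e / 4.
  apply: (hl1 (fun i => hdot f (u i))) => i ik; apply: le_trans (hdot_CS _ _) _.
  by rewrite ou.2 // mulr1.
have [y yl hy] : exists2 y, y \in l2 & hnorm (\sum_(i < k) hdot (a f') (v i) *: v i - y) < e / 4.
  apply: (hl2 (fun i => hdot (a f') (v i))) => i ik; apply: le_trans (hdot_CS _ _) _.
  rewrite ov.2 // mulr1; apply: le_trans (blin_le aM _) _.
  by rewrite -[leRHS]mulr1 ler_wpM2l ?(blin_ge0 aM) // (le_trans f2).
exists (x + y); first by apply/mapP; exists (x, y) => //; apply/allpairsP; exists (x, y).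
have afE : a f' = \sum_(i < k) hdot (a f') (v i) *: v i + g'.
  by rewrite /g' addrC subrK.
have g'_le : hnorm g' <= e / 4.
  have [->|g0] := eqVneq g' 0; first by rewrite hnorm0 ltW.
  have := res f' g' fu gv.
  have -> : hdot (a f') g' = hdot g' g'.
    rewrite {1}afE hdotDl hdot_suml big1 ?add0r // => i _.
    by rewrite hdotZl [hdot (v i) _]hdotC gv // cj0 mulr0.
  rewrite hdotxx cabsR ger0_norm ?sqr_ge0 // expr2 ler_pM2r ?hnorm_gt0 //.
  move=> /le_trans; apply; rewrite ler_piMr ?(ltW e4) //; exact: le_trans f1.
have -> : a f - (x + y) = (\sum_(i < k) hdot f (u i) *: a (u i) - x)
     + ((\sum_(i < k) hdot (a f') (v i) *: v i - y) + g').
  have -> : a f = a f' + \sum_(i < k) hdot f (u i) *: a (u i).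
    rewrite /f' (blinB aM) (blin_sum aM).
    rewrite [X in _ - X + _](eq_bigr (fun i : 'I_k => hdot f (u i) *: a (u i))) ?subrK //.
    by move=> i _; rewrite (blinZ aM).
  by rewrite {1}afE [X in X - _]addrC opprD addrACA; congr (_ + _); rewrite addrAC.
apply: le_lt_trans (hnormD _ _) _.
have := hnormD (\sum_(i < k) hdot (a f') (v i) *: v i - y) g'.
move: hx hy g'_le; set r1 := hnorm _; set r2 := hnorm (_ - y); set r3 := hnorm g'.
set r4 := hnorm _; lra.
Qed.

(** The dual bound is tested along the right singular vectors e n and the left
    ones a (e n) / s n. *)
Lemma dual_bound_schatten :
  schatten p (graph a) /\ (schatten_norm p (graph a) <= K%:E)%E.
Proof.
have cpt := dual_bound_compact.
have aA f g : graph a (f, g) <-> g = a f by [].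
have [s_noninc s0 [e [e_on e_eig _]]] := singular_values_spec aM aA cpt.
set s := singular_values _ in s_noninc s0 e_on e_eig.
have p0 : 0 < p by exact: lt_le_trans ltr01 p1.
suff hK : (schatten_norm p (graph a) <= K%:E)%E.
  by split => //; split => //; apply: le_lt_trans hK (ltry _).
apply: schatten_norm_le => //; first exact: dual_bound_ge0 aK.
elim=> [|N ih]; first by rewrite big_ord0 powR_ge0.
have [sN|] := boolP (0 < s N); last first.
  rewrite lt_def s0 andbT negbK => /eqP sN.
  by rewrite big_ord_recr /= -/s sN normr0 powR0 ?gt_eqF // addr0.
have sn i : (i < N.+1)%N -> 0 < s i.
  by rewrite ltnS => iN; apply: lt_le_trans sN _; exact: s_noninc.
have eig i j : (i < N.+1)%N -> (j < N.+1)%N ->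
    hdot (a (e i)) (a (e j)) = (s j ^+ 2 * (i == j)%:R)%:C.
  move=> iN jN; have [h /aA -> hh] := e_eig _ (sn j jN).
  rewrite (hh (e i) (a (e i))) // hdotZr cjR e_on ?sn //.
  by case: (i == j); rewrite ?mulr1 ?mulr0.
pose g i := ((s i)^-1)%:C *: a (e i).
have oe : orthonormal_family N.+1 e.
  split=> [i j iN jN ij|i iN]; first by rewrite e_on ?sn //; case: eqP.
  have := hdotxx (e i); rewrite e_on ?sn // eqxx => -[] /esym/eqP.
  by rewrite sqrf_eq1 => /orP[/eqP//|/eqP h]; have := hnorm_ge0 (e i); lra.
have ae i : (i < N.+1)%N -> hnorm (a (e i)) = s i.
  move=> iN; have := eig i i iN iN; rewrite hdotxx eqxx mulr1 => -[] /eqP.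
  by rewrite eqrXn2 ?hnorm_ge0 // => /eqP.
have og : orthonormal_family N.+1 g.
  split=> [i j iN jN ij|i iN].
    rewrite /g hdotZl hdotZr eig //; case: eqP => // _.
    by rewrite mulr0 !mulr0.
  rewrite /g hnormZ ae // cabsR gtr0_norm ?invr_gt0 ?sn // mulVf // gt_eqF // sn //.
apply: le_trans (dual_bound_sum p1 aK oe og); apply: ler_sum => i _.
rewrite /g hdotZr cjR hdotxx cabsM !cabsR ae // -/s.
have := sn i (ltn_ord i); move: (s i) => x x0.
rewrite !ger0_norm ?sqr_ge0 ?invr_ge0 ?(ltW x0) // expr2 mulrA mulVf ?mul1r // gt_eqF //.
Qed.

End SchattenSums.

(** * Real derivatives *)

Section RealDerivatives.
Variable R : realType.
Implicit Types (f g : R -> R) (a b x : R).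

Lemma derive_eq f (df df' : R) x : is_derive x 1 f df -> df = df' -> is_derive x 1 f df'.
Proof. by move=> h <-. Qed.

Lemma derive_lin a x : is_derive x 1 (fun s : R => s * a) a.
Proof.
apply: (derive_eq (is_deriveM (is_derive_id x 1) (is_derive_cst a x 1))).
by rewrite /= scaler0 add0r /cst; exact: mulr1.
Qed.

Lemma derive_mul f g (df dg : R) x : is_derive x 1 f df -> is_derive x 1 g dg ->
  is_derive x 1 (fun s => f s * g s) (f x * dg + g x * df).
Proof. by move=> hf hg; exact: (derive_eq (is_deriveM hf hg)). Qed.

Lemma derive_sub f g (df dg : R) x : is_derive x 1 f df -> is_derive x 1 g dg ->
  is_derive x 1 (fun s => f s - g s) (df - dg).
Proof. by move=> hf hg; exact: (derive_eq (is_deriveB hf hg)). Qed.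

Lemma derive_const a x : is_derive x 1 (fun=> a) (0 : R).
Proof. exact: is_derive_cst. Qed.

Lemma derive_exp_lin a x : is_derive x 1 (fun s => expR (s * a)) (a * expR (x * a)).
Proof.
by apply: (derive_eq (is_derive1_comp (is_derive_expR _) (derive_lin a x))); exact: mulrC.
Qed.

Lemma derive_cos_lin a x : is_derive x 1 (fun s => cos (s * a)) (- (a * sin (x * a))).
Proof.
apply: (derive_eq (is_derive1_comp (is_derive_cos _) (derive_lin a x))).
by rewrite mulNr mulrC.
Qed.

Lemma derive_sin_lin a x : is_derive x 1 (fun s => sin (s * a)) (a * cos (x * a)).
Proof.
by apply: (derive_eq (is_derive1_comp (is_derive_sin _) (derive_lin a x))); exact: mulrC.
Qed.

(** The mean value theorem in the form that is iterated to estimate Taylor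
    remainders. *)
Lemma mean_value_bound f df (M : R) : f 0 = 0 ->
  (forall x, is_derive x 1 f (df x)) ->
  (forall x, 0 <= x <= 1 -> `|df x| <= M) -> forall s, 0 <= s <= 1 -> `|f s| <= M.
Proof.
move=> f0 fd dM s /andP[s0 s1].
have [c] := @MVT_segment R f df 0 s s0 (fun x _ => fd x) (derivable_within_continuous (fun x _ => @ex_derive _ _ _ _ _ _ _ (fd x))).
rewrite in_itv /= => /andP[c0 cs]; rewrite f0 !subr0 => ->.
rewrite normrM (ger0_norm s0); have := dM c; rewrite c0 (le_trans cs s1) => /(_ isT) h.
have := normr_ge0 (df c); nra.
Qed.

End RealDerivatives.

(** * The complex exponential *)

Section ComplexExponential.
Variable R : realType.
Implicit Types (z w l : R[i]) (r t : R).

Lemma Re_cexp z : complex.Re (cexp z) = expR (complex.Re z) * cos (complex.Im z).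
Proof. by rewrite /cexp Re_realM. Qed.

Lemma Im_cexp z : complex.Im (cexp z) = expR (complex.Re z) * sin (complex.Im z).
Proof. by rewrite /cexp Im_realM. Qed.

Lemma cexp0 : cexp (0 : R[i]) = 1.
Proof. by apply: complex_ext; rewrite ?Re_cexp ?Im_cexp /= expR0 ?cos0 ?sin0 ?mul1r. Qed.

Lemma cexpD z w : cexp (z + w) = cexp z * cexp w.
Proof.
apply: complex_ext.
  by rewrite Re_cexp [RHS]ReM !Re_cexp !Im_cexp ReD ImD expRD cosD; ring.
by rewrite Im_cexp [RHS]ImM !Re_cexp !Im_cexp ReD ImD expRD sinD; ring.
Qed.

Lemma cabs_cis t : cabs (cis t) = 1.
Proof.
apply/eqP; rewrite -(@eqrXn2 _ 2) ?cabs_ge0 // cabs_sqr /= cos2Dsin2 expr1n //.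
Qed.

Lemma cabs_cexp z : cabs (cexp z) = expR (complex.Re z).
Proof. by rewrite /cexp cabsM cabs_cis mulr1 cabsR ger0_norm // expR_ge0. Qed.

Lemma cexp_polar r t : 0 < r -> cexp (ln r +i* t) = r%:C * cis t.
Proof. by move=> r0; rewrite /cexp /= lnK. Qed.

(** The principal logarithm inverts the exponential on the open strip of width
    2 pi, which contains all the keyhole contours. *)
Lemma clog_cexp l : `|complex.Im l| < pi -> clog (cexp l) = l.
Proof.
rewrite ltr_norml => /andP[l1 l2].
rewrite /clog -/(cabs _) cabs_cexp expRK; apply: complex_ext => //=.
rewrite /carg -/(cabs _) cabs_cexp Re_cexp Im_cexp.
rewrite [_ * cos _]mulrC mulfK ?gt_eqF ?expR_gt0 //.
have [i0|i0] := leP 0 (complex.Im l).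
  have -> : 0 <= expR (complex.Re l) * sin (complex.Im l).
    by rewrite mulr_ge0 ?expR_ge0 // sin_ge0_pi // i0 ltW.
  by rewrite cosK // in_itv /= i0 ltW.
rewrite cosKN ?opprK; last by rewrite (ltW l1) (ltW i0).
case: ifPn => //; rewrite pmulr_rge0 ?expR_gt0 // leNgt -oppr_gt0 -sinN sin_gt0_pi //.
by rewrite oppr_gt0 i0 ltrNl l1.
Qed.

Lemma cpow_cexp l w : `|complex.Im l| < pi -> cpow (cexp l) w = cexp (w * l).
Proof. by move=> l1; rewrite /cpow clog_cexp. Qed.

(** Each remainder has the previous one, times w, as its derivative along the
    segment from 0 to w. *)
Lemma cexp_taylor w :
  [/\ cabs (cexp w - 1) <= 2 * cabs w * expR (cabs w),
      cabs (cexp w - 1 - w) <= 4 * cabs w ^+ 2 * expR (cabs w) &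
      cabs (cexp w - 1 - w - 2^-1 * w ^+ 2) <= 8 * cabs w ^+ 3 * expR (cabs w)].
Proof.
pose a := complex.Re w; pose b := complex.Im w; pose E := expR (cabs w).
have E0 : 0 <= E by exact: expR_ge0.
pose f0 (s : R) := cexp (s%:C * w).
have f0R s : complex.Re (f0 s) = expR (s * a) * cos (s * b).
  by rewrite /f0 Re_cexp Re_realM Im_realM.
have f0I s : complex.Im (f0 s) = expR (s * a) * sin (s * b).
  by rewrite /f0 Im_cexp Re_realM Im_realM.
have f00 : f0 0 = 1 by rewrite /f0 mul0r cexp0.
have f0E s : 0 <= s <= 1 -> cabs (f0 s) <= E.
  move=> /andP[s0 s1]; rewrite /f0 cabs_cexp Re_realM ler_expR.
  apply: le_trans (ler_norm _) _; rewrite normrM ger0_norm //.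
  by have := Re_le_cabs w; have := normr_ge0 (complex.Re w); nra.
have dR0 (x : R) : is_derive x 1 (fun s : R => complex.Re (f0 s)) (complex.Re (w * f0 x)).
  rewrite (_ : (fun s : R => _) = (fun s : R => expR (s * a) * cos (s * b))); last exact/funext.
  apply: (derive_eq (derive_mul (derive_exp_lin a x) (derive_cos_lin b x))).
  by rewrite ReM f0R f0I -/a -/b; ring.
have dI0 (x : R) : is_derive x 1 (fun s : R => complex.Im (f0 s)) (complex.Im (w * f0 x)).
  rewrite (_ : (fun s : R => _) = (fun s : R => expR (s * a) * sin (s * b))); last exact/funext.
  apply: (derive_eq (derive_mul (derive_exp_lin a x) (derive_sin_lin b x))).
  by rewrite ImM f0R f0I -/a -/b; ring.
have step (F G : R -> R[i]) B :
    (forall x : R, is_derive x 1 (fun s : R => complex.Re (F s)) (complex.Re (w * G x))) ->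
    (forall x : R, is_derive x 1 (fun s : R => complex.Im (F s)) (complex.Im (w * G x))) ->
    F 0 = 0 -> (forall s, 0 <= s <= 1 -> cabs (G s) <= B) ->
    forall s, 0 <= s <= 1 -> cabs (F s) <= 2 * cabs w * B.
  move=> dR dI F0 GB s s01; apply: le_trans (cabs_le_ReIm _) _.
  have wB x : 0 <= x <= 1 -> cabs (w * G x) <= cabs w * B.
    by move=> /GB h; rewrite cabsM ler_wpM2l // cabs_ge0.
  have h1 : `|complex.Re (F s)| <= cabs w * B.
    apply: (mean_value_bound _ dR) => // [|x x01]; first by rewrite F0.
    exact: le_trans (Re_le_cabs _) (wB x x01).
  have h2 : `|complex.Im (F s)| <= cabs w * B.
    apply: (mean_value_bound _ dI) => // [|x x01]; first by rewrite F0.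
    exact: le_trans (Im_le_cabs _) (wB x x01).
  lra.
pose f1 s := f0 s - 1.
have b1 := step f1 f0 E _ _ _ f0E.
have {}b1 : forall s, 0 <= s <= 1 -> cabs (f1 s) <= 2 * cabs w * E.
  apply: b1 => [x|x|]; last by rewrite /f1 f00 subrr.
    rewrite (_ : (fun s : R => _) = (fun s : R => complex.Re (f0 s) - 1)); last by apply/funext => s; rewrite ReD.
    by apply: (derive_eq (derive_sub (dR0 x) (derive_const 1 x))); rewrite subr0.
  rewrite (_ : (fun s : R => _) = (fun s : R => complex.Im (f0 s) - 0)); last by apply/funext => s; rewrite ImD /= oppr0.
  by apply: (derive_eq (derive_sub (dI0 x) (derive_const 0 x))); rewrite subr0.
pose f2 s := f1 s - s%:C * w.
have dR1 (x : R) : is_derive x 1 (fun s : R => complex.Re (f1 s)) (complex.Re (w * f0 x)).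
  rewrite (_ : (fun s : R => _) = (fun s : R => complex.Re (f0 s) - 1)); last by apply/funext => s; rewrite ReD.
  by apply: (derive_eq (derive_sub (dR0 x) (derive_const 1 x))); rewrite subr0.
have dI1 (x : R) : is_derive x 1 (fun s : R => complex.Im (f1 s)) (complex.Im (w * f0 x)).
  rewrite (_ : (fun s : R => _) = (fun s : R => complex.Im (f0 s) - 0)); last by apply/funext => s; rewrite ImD /= oppr0.
  by apply: (derive_eq (derive_sub (dI0 x) (derive_const 0 x))); rewrite subr0.
have dR2 (x : R) : is_derive x 1 (fun s : R => complex.Re (f2 s)) (complex.Re (w * f1 x)).
  rewrite (_ : (fun s : R => _) = (fun s : R => complex.Re (f1 s) - s * a)); last first.
    by apply/funext => s; rewrite /f2 ReD ReN Re_realM.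
  apply: (derive_eq (derive_sub (dR1 x) (derive_lin a x))).
  by rewrite /f1 mulrBr mulr1 ReD ReN.
have dI2 (x : R) : is_derive x 1 (fun s : R => complex.Im (f2 s)) (complex.Im (w * f1 x)).
  rewrite (_ : (fun s : R => _) = (fun s : R => complex.Im (f1 s) - s * b)); last first.
    by apply/funext => s; rewrite /f2 ImD ImN Im_realM.
  apply: (derive_eq (derive_sub (dI1 x) (derive_lin b x))).
  by rewrite /f1 mulrBr mulr1 ImD ImN.
have f20 : f2 0 = 0 by rewrite /f2 /f1 f00 subrr mul0r subrr.
have b2 := step f2 f1 _ dR2 dI2 f20 b1.
pose f3 s := f2 s - (s * s)%:C * (2^-1 * w ^+ 2).
pose q := 2^-1 * w ^+ 2.
have dss (x : R) : is_derive x 1 (fun s : R => s * s) (2 * x).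
  apply: (derive_eq (derive_mul (is_derive_id x 1) (is_derive_id x 1))).
  by rewrite mulr1 mulr2n mulrDl mul1r.
have dq (x c : R) : is_derive x 1 (fun s : R => s * s * c) (2 * x * c).
  apply: (derive_eq (derive_mul (dss x) (derive_const c x))).
  by rewrite mulr0 add0r mulrC.
have q2 x : w * f2 x = w * f1 x - (2 * x)%:C * q.
  rewrite /f2 mulrBr; congr (_ - _); rewrite /q rmorphM rmorph_nat.
  by field.
have dR3 (x : R) : is_derive x 1 (fun s : R => complex.Re (f3 s)) (complex.Re (w * f2 x)).
  rewrite (_ : (fun s : R => _) = (fun s : R => complex.Re (f2 s) - s * s * complex.Re q)); last first.
    by apply/funext => s; rewrite /f3 ReD ReN Re_realM.
  apply: (derive_eq (derive_sub (dR2 x) (dq x _))).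
  by rewrite q2 ReD ReN Re_realM.
have dI3 (x : R) : is_derive x 1 (fun s : R => complex.Im (f3 s)) (complex.Im (w * f2 x)).
  rewrite (_ : (fun s : R => _) = (fun s : R => complex.Im (f2 s) - s * s * complex.Im q)); last first.
    by apply/funext => s; rewrite /f3 ImD ImN Im_realM.
  apply: (derive_eq (derive_sub (dI2 x) (dq x _))).
  by rewrite q2 ImD ImN Im_realM.
have f30 : f3 0 = 0 by rewrite /f3 f20 mul0r mul0r subrr.
have b3 := step f3 f2 _ dR3 dI3 f30 b2.
have u1 : 0 <= (1 : R) <= 1 by rewrite ler01 /=.
have one : (1 : R)%:C = 1 by [].
split.
- by have := b1 1 u1; rewrite /f1 /f0 one mul1r.
- have := b2 1 u1; rewrite /f2 /f1 /f0 one !mul1r => /le_trans; apply.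
  by rewrite le_eqVlt; apply/orP; left; apply/eqP; rewrite -/E; ring.
- have := b3 1 u1; rewrite /f3 /f2 /f1 /f0 !mulr1 one !mul1r => /le_trans; apply.
  by rewrite le_eqVlt; apply/orP; left; apply/eqP; rewrite -/E; ring.
Qed.

End ComplexExponential.

(** * Uniform complex differentiability *)

Section C11.
Variable R : realType.
Implicit Types (Z : set R[i]) (F G phi : R[i] -> R[i]).

(** Complex differentiability with uniform second-order control on a set: all
    that the integration arguments below use of holomorphy. *)
Definition C11 Z F F' : Prop := exists2 C : R, 0 <= C &
  forall z w, Z z -> Z w ->
  [/\ cabs (F z) <= C, cabs (F' z) <= C,
      cabs (F w - F z) <= C * cabs (w - z),
      cabs (F' w - F' z) <= C * cabs (w - z) &
      cabs (F w - F z - (w - z) * F' z) <= C * cabs (w - z) ^+ 2].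

Lemma C11_sub Z Z' F F' : Z `<=` Z' -> C11 Z' F F' -> C11 Z F F'.
Proof. by move=> ZZ' [C C0 h]; exists C => // z w /ZZ' Zz /ZZ' Zw; exact: h. Qed.

Lemma C11_mul Z F F' G G' : C11 Z F F' -> C11 Z G G' ->
  C11 Z (fun z => F z * G z) (fun z => F' z * G z + F z * G' z).
Proof.
move=> [C C0 hF] [D D0 hG]; exists (4 * (C * D)) => [|z w Zz Zw].
  by rewrite !mulr_ge0.
have [f1 f2 f3 f4 f5] := hF z w Zz Zw; have [g1 g2 g3 g4 g5] := hG z w Zz Zw.
have [fw1 fw2 _ _ _] := hF w w Zw Zw; have [gw1 gw2 _ _ _] := hG w w Zw Zw.
have CD0 : 0 <= C * D by exact: mulr_ge0.
set d := cabs (w - z) in f3 f4 f5 g3 g4 g5 *.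
have d0 : 0 <= d by exact: cabs_ge0.
have M (x y : R[i]) (a b : R) : cabs x <= a -> cabs y <= b -> cabs (x * y) <= a * b.
  by move=> hx hy; rewrite cabsM ler_pM // cabs_ge0.
split.
- by apply: le_trans (M _ _ _ _ f1 g1) _; lra.
- by apply: le_trans (cabsD _ _) _; have := M _ _ _ _ f2 g1; have := M _ _ _ _ f1 g2; lra.
- have -> : F w * G w - F z * G z = (F w - F z) * G w + F z * (G w - G z) by ring.
  apply: le_trans (cabsD _ _) _.
  have := M _ _ _ _ f3 gw1; have := M _ _ _ _ f1 g3.
  have : 0 <= C * D * d by rewrite mulr_ge0.
  lra.
- have -> : F' w * G w + F w * G' w - (F' z * G z + F z * G' z) =
    ((F' w - F' z) * G w + F' z * (G w - G z)) + ((F w - F z) * G' w + F z * (G' w - G' z)) by ring.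
  apply: le_trans (cabsD _ _) _.
  have h1 := cabsD ((F' w - F' z) * G w) (F' z * (G w - G z)).
  have h2 := cabsD ((F w - F z) * G' w) (F z * (G' w - G' z)).
  have := M _ _ _ _ f4 gw1; have := M _ _ _ _ f2 g3.
  have := M _ _ _ _ f3 gw2; have := M _ _ _ _ f1 g4; lra.
- have -> : F w * G w - F z * G z - (w - z) * (F' z * G z + F z * G' z) =
    (F w - F z - (w - z) * F' z) * G w +
    ((w - z) * (F' z * (G w - G z)) + F z * (G w - G z - (w - z) * G' z)) by ring.
  apply: le_trans (cabsD _ _) _.
  have h1 := cabsD ((w - z) * (F' z * (G w - G z))) (F z * (G w - G z - (w - z) * G' z)).
  have := M _ _ _ _ f5 gw1; have := M _ _ _ _ f1 g5.
  have := M _ _ _ _ (lexx d) (M _ _ _ _ f2 g3).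
  have : 0 <= C * D * d ^+ 2 by rewrite mulr_ge0 // sqr_ge0.
  by rewrite !expr2; lra.
Qed.

Lemma C11_comp Z Z' F F' phi phi' : (forall z, Z z -> Z' (phi z)) ->
  C11 Z' F F' -> C11 Z phi phi' ->
  C11 Z (F \o phi) (fun z => F' (phi z) * phi' z).
Proof.
move=> ZZ' [C C0 hF] [D D0 hp]; exists (C * (1 + D) * (1 + D)) => [|z w Zz Zw].
  by rewrite !mulr_ge0 // addr_ge0.
have [p1 p2 p3 p4 p5] := hp z w Zz Zw; have [pw1 pw2 _ _ _] := hp w w Zw Zw.
have [f1 f2 f3 f4 f5] := hF _ _ (ZZ' z Zz) (ZZ' w Zw).
have [fw1 fw2 _ _ _] := hF _ _ (ZZ' w Zw) (ZZ' w Zw).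
set d := cabs (w - z) in p3 p4 p5 *.
have d0 : 0 <= d by exact: cabs_ge0.
have CD0 : 0 <= C * D by exact: mulr_ge0.
have CDD0 : 0 <= C * D * D by exact: mulr_ge0.
have M (x y : R[i]) (a b : R) : cabs x <= a -> cabs y <= b -> cabs (x * y) <= a * b.
  by move=> hx hy; rewrite cabsM ler_pM // cabs_ge0.
set e := cabs (phi w - phi z) in f3 f4 f5 p3 *.
have e0 : 0 <= e by exact: cabs_ge0.
have Ce : C * e <= C * (D * d) by rewrite ler_wpM2l.
have EX : C * (1 + D) * (1 + D) = C + 2 * (C * D) + C * D * D by ring.
rewrite EX; split => /=.
- lra.
- by apply: le_trans (M _ _ _ _ f2 p2) _; lra.
- have : 0 <= C * d by exact: mulr_ge0.
  have : 0 <= C * D * d by exact: mulr_ge0.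
  have : 0 <= C * D * D * d by exact: mulr_ge0.
  lra.
- have -> : F' (phi w) * phi' w - F' (phi z) * phi' z =
    (F' (phi w) - F' (phi z)) * phi' w + F' (phi z) * (phi' w - phi' z) by ring.
  apply: le_trans (cabsD _ _) _.
  have := M _ _ _ _ (le_trans f4 Ce) pw2; have := M _ _ _ _ f2 p4.
  have : 0 <= C * d by exact: mulr_ge0.
  have : 0 <= C * D * d by exact: mulr_ge0.
  have : 0 <= C * D * D * d by exact: mulr_ge0.
  lra.
- have -> : F (phi w) - F (phi z) - (w - z) * (F' (phi z) * phi' z) =
    (F (phi w) - F (phi z) - (phi w - phi z) * F' (phi z)) +
    (phi w - phi z - (w - z) * phi' z) * F' (phi z) by ring.
  apply: le_trans (cabsD _ _) _.
  have := M _ _ _ _ p5 f2.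
  have : C * e ^+ 2 <= C * (D * d) ^+ 2.
    by rewrite ler_wpM2l // ler_pXn2r ?nnegrE // mulr_ge0.
  have : 0 <= C * d ^+ 2 by rewrite mulr_ge0 // sqr_ge0.
  have : 0 <= C * D * d ^+ 2 by rewrite mulr_ge0 // sqr_ge0.
  have -> : C * (D * d) ^+ 2 = C * D * D * d ^+ 2 by ring.
  lra.
Qed.

Lemma C11_lin Z (be : R[i]) (B : R) : (forall z, Z z -> cabs z <= B) ->
  C11 Z (fun z => be * z) (fun=> be).
Proof.
move=> ZB; have [->|/set0P[z0 Zz0]] := eqVneq Z set0; first by exists 0.
have B0 : 0 <= B by apply: le_trans (ZB _ Zz0); exact: cabs_ge0.
have b0 := cabs_ge0 be.
exists (cabs be * (1 + B)) => [|z w Zz Zw]; first by rewrite mulr_ge0 // addr_ge0.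
have d0 := cabs_ge0 (w - z).
have bB0 : 0 <= cabs be * B by exact: mulr_ge0.
split.
- by rewrite cabsM; have := ZB z Zz; nra.
- lra.
- rewrite -mulrBr cabsM.
  have : 0 <= cabs be * B * cabs (w - z) by exact: mulr_ge0.
  lra.
- by rewrite subrr cabs0 mulr_ge0 // mulr_ge0 // addr_ge0.
- rewrite (_ : _ - _ - _ = 0); last by ring.
  by rewrite cabs0 mulr_ge0 ?sqr_ge0 // mulr_ge0 // addr_ge0.
Qed.

Lemma C11_cexp Z (B : R) : (forall z, Z z -> cabs z <= B) ->
  C11 Z (@cexp R) (@cexp R).
Proof.
move=> ZB; have [->|/set0P[z0 Zz0]] := eqVneq Z set0; first by exists 0.
have B0 : 0 <= B by apply: le_trans (ZB _ Zz0); exact: cabs_ge0.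
pose E := expR (3 * B).
have E0 : 0 <= E by exact: expR_ge0.
have EB z : Z z -> cabs (cexp z) <= expR B.
  move=> Zz; rewrite cabs_cexp ler_expR.
  by apply: le_trans (ler_norm _) (le_trans (Re_le_cabs z) (ZB z Zz)).
exists (4 * E) => [|z w Zz Zw]; first exact: mulr_ge0.
have d0 := cabs_ge0 (w - z).
have dB : cabs (w - z) <= 2 * B.
  by apply: le_trans (cabsB _ _) _; have := ZB z Zz; have := ZB w Zw; lra.
have ed : expR (cabs (w - z)) <= expR (2 * B) by rewrite ler_expR.
have EE : expR B * expR (2 * B) = E by rewrite -expRD /E; congr expR; ring.
have [t1 t2 _] := cexp_taylor (w - z).
have e0 := cabs_ge0 (cexp z).
have BE : expR B <= E by rewrite ler_expR; lra.
have lip : cabs (cexp w - cexp z) <= 4 * E * cabs (w - z).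
  have -> : cexp w - cexp z = cexp z * (cexp (w - z) - 1).
    by rewrite mulrBr -cexpD mulr1 [z + _]addrC subrK.
  rewrite cabsM; apply: le_trans (ler_pM (cabs_ge0 _) (cabs_ge0 _) (EB z Zz) t1) _.
  have h : 2 * cabs (w - z) * expR (cabs (w - z)) <= 2 * cabs (w - z) * expR (2 * B).
    by rewrite ler_wpM2l // mulr_ge0.
  apply: le_trans (ler_wpM2l (expR_ge0 B) h) _.
  have -> : expR B * (2 * cabs (w - z) * expR (2 * B)) = 2 * cabs (w - z) * E.
    by rewrite -EE; ring.
  have : 0 <= cabs (w - z) * E by rewrite mulr_ge0.
  lra.
split => //.
- by apply: le_trans (EB z Zz) _; lra.
- by apply: le_trans (EB z Zz) _; lra.
- have -> : cexp w - cexp z - (w - z) * cexp z = cexp z * (cexp (w - z) - 1 - (w - z)).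
    have -> : cexp w = cexp z * cexp (w - z) by rewrite -cexpD [z + _]addrC subrK.
    by ring.
  rewrite cabsM; apply: le_trans (ler_pM (cabs_ge0 _) (cabs_ge0 _) (EB z Zz) t2) _.
  have h : 4 * cabs (w - z) ^+ 2 * expR (cabs (w - z)) <= 4 * cabs (w - z) ^+ 2 * expR (2 * B).
    by rewrite ler_wpM2l // mulr_ge0 // sqr_ge0.
  apply: le_trans (ler_wpM2l (expR_ge0 B) h) _.
  by rewrite -EE le_eqVlt; apply/orP; left; apply/eqP; ring.
Qed.

End C11.

(** * Integrals of complex-valued functions *)

Section ComplexIntegral.
Variable R : realType.
Notation mu := (@lebesgue_measure R).
Notation RM := (measurableTypeR R).
Implicit Types (F G : R -> R[i]) (D : set RM) (a b c L : R).

Lemma eq_cintegral D F G : (forall x, D x -> F x = G x) ->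
  cintegral D F = cintegral D G.
Proof.
move=> FG; rewrite /cintegral; apply: complex_ext => /=; apply: eq_Rintegral => x;
  by rewrite inE => /FG ->.
Qed.

Lemma eq_cintegrable D F G : measurable D -> (forall x, D x -> F x = G x) ->
  cintegrable D F -> cintegrable D G.
Proof.
move=> mD FG [h1 h2]; split; [apply: (eq_integrable mD _ _ _ h1) => x|apply: (eq_integrable mD _ _ _ h2) => x];
  by rewrite inE => /FG ->.
Qed.

Lemma cintegrableD D F G : measurable D -> cintegrable D F -> cintegrable D G ->
  cintegrable D (fun x => F x + G x).
Proof.
move=> mD [f1 f2] [g1 g2]; split.
  by apply: (eq_integrable mD _ _ _ (integrableD mD f1 g1)) => x _; rewrite /= ReD EFinD.
by apply: (eq_integrable mD _ _ _ (integrableD mD f2 g2)) => x _; rewrite /= ImD EFinD.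
Qed.

Lemma cintegrableZ D F (c : R[i]) : measurable D -> cintegrable D F ->
  cintegrable D (fun x => c * F x).
Proof.
move=> mD [f1 f2]; split.
  have h := integrableB mD (integrableZl mD (complex.Re c) f1) (integrableZl mD (complex.Im c) f2).
  by apply: (eq_integrable mD _ _ _ h) => x _; rewrite /= ReM EFinB !EFinM.
have h := integrableD mD (integrableZl mD (complex.Re c) f2) (integrableZl mD (complex.Im c) f1).
by apply: (eq_integrable mD _ _ _ h) => x _; rewrite /= ImM EFinD !EFinM.
Qed.

Lemma cintegralD D F G : measurable D -> cintegrable D F -> cintegrable D G ->
  cintegral D (fun x => F x + G x) = cintegral D F + cintegral D G.
Proof.
move=> mD [f1 f2] [g1 g2]; rewrite /cintegral; apply: complex_ext => /=.
  by under eq_Rintegral do rewrite ReD; rewrite RintegralD.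
by under eq_Rintegral do rewrite ImD; rewrite RintegralD.
Qed.

Lemma cintegralZ D F (c : R[i]) : measurable D -> cintegrable D F ->
  cintegral D (fun x => c * F x) = c * cintegral D F.
Proof.
move=> mD [f1 f2]; rewrite /cintegral; apply: complex_ext.
  rewrite ReM /=; under eq_Rintegral do rewrite ReM.
  rewrite RintegralB ?RintegralZl //.
    exact: (integrableZl mD (complex.Re c) f1).
  exact: (integrableZl mD (complex.Im c) f2).
rewrite ImM /=; under eq_Rintegral do rewrite ImM.
rewrite RintegralD ?RintegralZl //.
  exact: (integrableZl mD (complex.Re c) f2).
exact: (integrableZl mD (complex.Im c) f1).
Qed.

Lemma cintegralB D F G : measurable D -> cintegrable D F -> cintegrable D G ->
  cintegral D (fun x => F x - G x) = cintegral D F - cintegral D G.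
Proof.
move=> mD hF hG; under eq_cintegral do rewrite -[- G _]mulN1r.
by rewrite cintegralD ?cintegralZ ?mulN1r //; exact: cintegrableZ.
Qed.

Lemma cintegrableB D F G : measurable D -> cintegrable D F -> cintegrable D G ->
  cintegrable D (fun x => F x - G x).
Proof.
move=> mD hF hG; apply: (eq_cintegrable mD _ (cintegrableD mD hF (cintegrableZ (-1) mD hG))).
by move=> x _; rewrite mulN1r.
Qed.

(** The factor 2 comes from estimating the real and the imaginary part
    separately; no constant of this kind survives in the final bounds. *)
Lemma cintegral_bound D F (g : R -> R) : measurable D -> cintegrable D F ->
  mu.-integrable D (EFin \o g) -> (forall x, D x -> cabs (F x) <= g x) ->
  cabs (cintegral D F) <= 2 * \int[mu]_(x in D) g x.
Proof.
move=> mD [f1 f2] gi Fg; apply: le_trans (cabs_le_ReIm _) _.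
rewrite mulr2n mulrDl !mul1r /=; apply: lerD.
  apply: le_trans (le_normr_Rintegral mD f1) _.
  apply: le_Rintegral => //; first exact: (integrable_abse f1).
  by move=> x Dx; apply: le_trans (Re_le_cabs _) (Fg x Dx).
apply: le_trans (le_normr_Rintegral mD f2) _.
apply: le_Rintegral => //; first exact: (integrable_abse f2).
by move=> x Dx; apply: le_trans (Im_le_cabs _) (Fg x Dx).
Qed.

(** Lipschitz functions are integrable, and this regularity is inherited from
    C11 functions by restriction to rays and arcs. *)
Definition lip_on a b F L : Prop := 0 <= L /\
  forall s t, a <= s <= b -> a <= t <= b -> cabs (F t - F s) <= L * `|t - s|.

Lemma lip_on_continuous a b F L : lip_on a b F L ->
  {within `[a, b], continuous (fun x : R => complex.Re (F x))} /\
  {within `[a, b], continuous (fun x : R => complex.Im (F x))}.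
Proof.
move=> [L0 FL].
have key (g : R -> R) : (forall s t, a <= s <= b -> a <= t <= b -> `|g t - g s| <= L * `|t - s|) ->
    {within `[a, b], continuous g}.
  move=> gL; apply/subspace_continuousP => x /=; rewrite in_itv /= => xab.
  apply/cvgrPdist_lt => e e0; rewrite near_withinE.
  have L1 : 0 < L + 1 by rewrite ltr_wpDl.
  exists (e / (L + 1)) => /=; first by rewrite divr_gt0.
  move=> y /=; rewrite ltr_pdivlMr // => xy; rewrite in_itv /= => yab.
  apply: le_lt_trans (gL _ _ yab xab) _.
  by have := normr_ge0 (x - y); nra.
split; apply: key => s t hs ht; apply: le_trans (FL s t hs ht).
  by rewrite /= -ReN -ReD Re_le_cabs.
by rewrite /= -ImN -ImD Im_le_cabs.
Qed.

Lemma cintegrable_lip a b F L : lip_on a b F L -> cintegrable `[a, b] F.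
Proof.
by move=> /lip_on_continuous[h1 h2]; split; apply: continuous_compact_integrable => //;
  exact: segment_compact.
Qed.

Lemma Rintegral_const a b (M : R) : a <= b -> \int[mu]_(x in `[a, b]) M = M * (b - a).
Proof.
move=> ab; rewrite Rintegral_cst //= lebesgue_measure_itv /= lte_fin.
case: ltP => //= ba; have -> : a = b by apply/eqP; rewrite eq_le ab ba.
by rewrite subrr.
Qed.

Lemma integrable_const a b (M : R) : mu.-integrable `[a, b] (EFin \o (fun=> M)).
Proof.
apply: (@continuous_compact_integrable R (fun=> M)); first exact: segment_compact.
by move=> x; exact: cvg_cst.
Qed.

Lemma cintegrable_const a b (c : R[i]) : cintegrable `[a, b] (fun=> c).
Proof. by split; exact: integrable_const. Qed.

Lemma cintegral_le a b F (M : R) : a <= b -> cintegrable `[a, b] F ->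
  (forall x, a <= x <= b -> cabs (F x) <= M) ->
  cabs (cintegral `[a, b] F) <= 2 * (M * (b - a)).
Proof.
move=> ab iF FM; rewrite -Rintegral_const //.
by apply: cintegral_bound => //; exact: integrable_const.
Qed.

Lemma cintegral_const a b (c : R[i]) : a <= b ->
  cintegral `[a, b] (fun=> c) = c * (b - a)%:C.
Proof.
move=> ab; rewrite /cintegral !Rintegral_const //; apply: complex_ext => /=.
  by rewrite [RHS]ReM /= mulr0 subr0.
by rewrite [RHS]ImM /= mulr0 add0r.
Qed.

Lemma cintegrable_sub (D D' : set RM) F : measurable D -> measurable D' -> D' `<=` D ->
  cintegrable D F -> cintegrable D' F.
Proof. by move=> mD mD' DD' [h1 h2]; split; exact: integrableS h1 || exact: integrableS h2. Qed.

Lemma cintegral_split a (b : itv_bound R) c F : a <= c -> (BRight c <= b)%O ->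
  cintegrable [set` Interval (BLeft a) b] F ->
  cintegral [set` Interval (BLeft a) b] F =
  cintegral `[a, c] F + cintegral [set` Interval (BLeft c) b] F.
Proof.
move=> ac cb iF.
have ioF : cintegrable [set` Interval (BRight c) b] F.
  apply: cintegrable_sub iF => //; apply: subset_itvr.
  by rewrite bnd_simp.
have [i1 i2] := iF; have [j1 j2] := ioF.
have ac' : (BLeft a <= BRight c)%O by rewrite bnd_simp.
apply: complex_ext; rewrite ?ReD ?ImD /=.
  have := Rintegral_itvB i1 ac' cb; rewrite Rintegral_itv_obnd_cbnd // => <-.
  by rewrite addrC subrK.
have := Rintegral_itvB i2 ac' cb; rewrite Rintegral_itv_obnd_cbnd // => <-.
by rewrite addrC subrK.
Qed.

(** A function whose increments are quadratically small is constant: this takes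
    the place of differentiation throughout. *)
Lemma constant_of_quadratic a b F (C : R) : a <= b ->
  (forall s t, a <= s -> s <= t -> t <= b -> cabs (F t - F s) <= C * (t - s) ^+ 2) ->
  F a = F b.
Proof.
move=> ab FC; apply/esym/eqP; rewrite -subr_eq0; apply/eqP/cabs_eq0/eqP.
rewrite eq_le cabs_ge0 andbT; apply/ler_addgt0Pl => e e0; rewrite addr0.
pose D := `|C| * (b - a) ^+ 2.
have D0 : 0 <= D by rewrite mulr_ge0 // sqr_ge0.
have : 0 < e / (D + 1) by rewrite divr_gt0 // ltr_wpDl.
move=> /invS_small[n /(_ n (leqnn n)) hn].
(* The interval is cut in n + 1 equal steps; the quadratic errors add up to
   O(1/n). *)
pose h := (b - a) / n.+1%:R.
have h0 : 0 <= h by rewrite divr_ge0 // subr_ge0.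
have nh : n.+1%:R * h = b - a by rewrite mulrC divfK.
have step j : (j <= n.+1)%N -> cabs (F (a + j%:R * h) - F a) <= j%:R * (`|C| * h ^+ 2).
  elim: j => [_|j ih jn]; first by rewrite !mul0r addr0 subrr cabs0.
  have jh : j.+1%:R * h = j%:R * h + h by rewrite mulrS mulrDl mul1r addrC.
  have top : a + j.+1%:R * h <= b.
    rewrite -lerBrDl -nh ler_wpM2r // ler_nat //.
  have := FC (a + j%:R * h) (a + j.+1%:R * h).
  rewrite lerDl mulr_ge0 ?ler0n // jh -jh top lerD2l jh lerDl h0 => /(_ isT isT isT).
  have -> : a + (j%:R * h + h) - (a + j%:R * h) = h by ring.
  move=> h1; have := ih (ltnW jn).
  have := cabsD (F (a + (j%:R * h + h)) - F (a + j%:R * h)) (F (a + j%:R * h) - F a).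
  rewrite addrA subrK mulrS mulrDl mul1r.
  have : C * h ^+ 2 <= `|C| * h ^+ 2 by rewrite ler_wpM2r ?sqr_ge0 // ler_norm.
  lra.
have := step n.+1 (leqnn _); rewrite nh [a + _]addrC subrK => /le_trans; apply.
have -> : n.+1%:R * (`|C| * h ^+ 2) = D * n.+1%:R^-1.
  by rewrite /D -nh; field; rewrite addrC natr1 pnatr_eq0.
move: hn; rewrite ltr_pdivlMr ?ltr_wpDl // => hn.
have : 0 < n.+1%:R^-1 :> R by rewrite invr_gt0 ltr0n.
by move: hn; set x := _^-1; nra.
Qed.

(** The difference of the two sides, as a function of the upper end, has
    quadratically small increments. *)
Lemma cintegral_FTC a b F F' (C L : R) : a <= b -> lip_on a b F' L ->
  (forall s t, a <= s -> s <= t -> t <= b ->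
    cabs (F t - F s - (t - s)%:C * F' s) <= C * (t - s) ^+ 2) ->
  cintegral `[a, b] F' = F b - F a.
Proof.
move=> ab lF FC.
have iF := cintegrable_lip lF.
have lFs s t : a <= s -> t <= b -> lip_on s t F' L.
  move=> sa tb; split; first by case: lF.
  by move=> x y /andP[x1 x2] /andP[y1 y2]; apply: lF.2; rewrite ?(le_trans sa) ?(le_trans _ tb).
pose P t := F t - cintegral `[a, t] F'.
have : P a = P b.
  apply: (@constant_of_quadratic _ _ _ (C + 2 * L)) => // s t sa st tb.
  have ita : cintegrable `[a, t] F' by apply: cintegrable_lip (lFs a t (lexx a) tb).
  have its : cintegrable `[s, t] F' by apply: cintegrable_lip (lFs s t sa tb).
  have isp := @cintegral_split a (BRight t) s F' sa _ ita.
  rewrite /P {}isp ?bnd_simp //.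
  have -> : F t - (cintegral `[a, s] F' + cintegral `[s, t] F') - (F s - cintegral `[a, s] F')
    = (F t - F s - (t - s)%:C * F' s) - (cintegral `[s, t] F' - F' s * (t - s)%:C) by ring.
  apply: le_trans (cabsB _ _) _; rewrite mulrDl; apply: lerD; first exact: FC.
  rewrite -cintegral_const // -cintegralB //; last exact: cintegrable_const.
  have -> : 2 * L * (t - s) ^+ 2 = 2 * (L * (t - s) * (t - s)) by ring.
  apply: cintegral_le => // [|x /andP[sx xt]].
    by apply: cintegrableB => //; exact: cintegrable_const.
  have [L0 FL] := lF; apply: le_trans (FL s x _ _) _.
  - by rewrite sa (le_trans st).
  - by rewrite (le_trans sa) // (le_trans xt).
  - by rewrite ger0_norm ?subr_ge0 // ler_wpM2l // lerD2r.
rewrite /P => h.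
have : cintegral `[a, a] F' = 0.
  apply/cabs_eq0/eqP; rewrite eq_le cabs_ge0 andbT.
  apply: le_trans (@cintegral_le a a F' (cabs (F' a)) (lexx a) _ _) _.
  - by apply: cintegrable_lip (lFs a a (lexx a) ab).
  - by move=> x; rewrite -eq_le => /eqP ->.
  - by rewrite subrr !mulr0.
by move: h => /[swap] ->; rewrite subr0 => ->; ring.
Qed.

End ComplexIntegral.

(** * Cauchy's theorem on polar rectangles *)

Section PolarCauchy.
Variable R : realType.
Notation mu := (@lebesgue_measure R).
Implicit Types (K : R[i] -> R[i]) (a r t C : R).

Lemma ln_le_sub1 (x : R) : 0 < x -> ln x <= x - 1.
Proof.
move=> x0; have : ln (1 + (x - 1)) <= x - 1 by apply: le_ln1Dx; lra.
by rewrite [1 + _]addrC subrK.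
Qed.

(** The error of the tangent line of the logarithm, by applying ln x <= x - 1
    in both directions. *)
Lemma ln_quadratic (s t : R) : 0 < s -> 0 < t ->
  `|ln t - ln s - (t - s) / s| <= (t - s) ^+ 2 / (s * t).
Proof.
move=> s0 t0.
have ub (x y : R) : 0 < x -> 0 < y -> ln y - ln x <= (y - x) / x.
  move=> x0 y0; have yx : 0 < y / x by rewrite divr_gt0.
  have := ln_le_sub1 yx.
  by rewrite ln_div ?posrE // mulrBl divff // gt_eqF.
have h1 := ub s t s0 t0; have h2 := ub t s t0 s0.
have h3 : (t - s) / s - (t - s) ^+ 2 / (s * t) = - ((s - t) / t).
  by field; rewrite !gt_eqF.
have h4 : 0 <= (t - s) ^+ 2 / (s * t) by rewrite divr_ge0 ?sqr_ge0 // mulr_ge0 ?ltW.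
by rewrite ler_norml; lra.
Qed.

Lemma ln_lipschitz (m s t : R) : 0 < m -> m <= s -> m <= t ->
  `|ln t - ln s| <= `|t - s| / m.
Proof.
move=> m0.
suff key (x y : R) : m <= x -> m <= y -> x <= y -> `|ln y - ln x| <= `|y - x| / m.
  move=> ms mt; have [st|/ltW ts] := leP s t; first exact: key.
  by rewrite distrC (distrC t); exact: key.
move=> mx my xy; have x0 : 0 < x by exact: lt_le_trans mx.
have y0 : 0 < y by exact: lt_le_trans my.
rewrite !ger0_norm ?subr_ge0 ?ler_ln ?posrE //.
have yx : 0 < y / x by rewrite divr_gt0.
have := ln_le_sub1 yx.
rewrite ln_div ?posrE // => /le_trans; apply.
have -> : y / x - 1 = (y - x) / x by field; rewrite gt_eqF.
by rewrite ler_wpM2l ?subr_ge0 // lef_pV2.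
Qed.

(** In the logarithmic coordinate l = ln r + i t the form G(z) dz becomes
    K(l) dl with K(l) = G(exp l) exp l; its restriction to a ray is K dr / r. *)
Definition rayK K t r : R[i] := K (ln r +i* t) * (r^-1)%:C.

Definition rect (x1 x2 t1 t2 : R) : set R[i] :=
  [set l | x1 <= complex.Re l <= x2 /\ t1 <= complex.Im l <= t2].

Lemma lip_rayK K t (r1 r2 C : R) : 0 < r1 -> 0 <= C ->
  (forall r s, r1 <= r <= r2 -> r1 <= s <= r2 -> cabs (K (ln r +i* t)) <= C /\
     cabs (K (ln s +i* t) - K (ln r +i* t)) <= C * cabs ((ln s +i* t) - (ln r +i* t))) ->
  lip_on r1 r2 (rayK K t) (2 * C / r1 ^+ 2).
Proof.
move=> r0 C0 hK; split; first by rewrite divr_ge0 ?sqr_ge0 // mulr_ge0.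
move=> r s hr hs; have [k1 k2] := hK r s hr hs.
move: hr hs => /andP[r1r _] /andP[r1s _].
have rp : 0 < r by exact: lt_le_trans r1r.
have sp : 0 < s by exact: lt_le_trans r1s.
rewrite /rayK; set x := K _ in k1 k2 *; set y := K _ in k1 k2 *.
have -> : y * (s^-1)%:C - x * (r^-1)%:C = (y - x) * (s^-1)%:C + x * (s^-1 - r^-1)%:C.
  by rewrite rmorphB; ring.
apply: le_trans (cabsD _ _) _; rewrite !cabsM !cabsR.
have d1 : cabs ((ln s +i* t) - (ln r +i* t)) = `|ln s - ln r|.
  have -> : (ln s +i* t) - (ln r +i* t) = (ln s - ln r)%:C.
    by apply: complex_ext => //=; rewrite subrr.
  by rewrite cabsR.
rewrite d1 in k2; have d2 := ln_lipschitz r0 r1r r1s.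
have is1 : `|s^-1| <= r1^-1 by rewrite ger0_norm ?invr_ge0 ?(ltW sp) // lef_pV2.
have is2 : `|s^-1 - r^-1| <= `|s - r| / r1 ^+ 2.
  have -> : s^-1 - r^-1 = (r - s) / (r * s) by field; rewrite !gt_eqF.
  rewrite normrM distrC ler_wpM2l // ger0_norm; last by rewrite invr_ge0 mulr_ge0 ?ltW.
  by rewrite lef_pV2 ?posrE ?mulr_gt0 ?exprn_gt0 // expr2 ler_pM // ltW.
have := ler_pM (cabs_ge0 _) (normr_ge0 _) (le_trans k2 (ler_wpM2l C0 d2)) is1.
have := ler_pM (cabs_ge0 _) (normr_ge0 _) k1 is2.
have -> : 2 * C / r1 ^+ 2 * `|s - r| = C * (`|s - r| / r1) / r1 + C * (`|s - r| / r1 ^+ 2).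
  by field; rewrite gt_eqF.
lra.
Qed.

Lemma lip_arcK K x (t1 t2 C : R) : 0 <= C ->
  (forall s t, t1 <= s <= t2 -> t1 <= t <= t2 ->
     cabs (K (x +i* t) - K (x +i* s)) <= C * cabs ((x +i* t) - (x +i* s))) ->
  lip_on t1 t2 (fun t => K (x +i* t)) C.
Proof.
move=> C0 hK; split => // s t hs ht; apply: le_trans (hK s t hs ht) _.
rewrite ler_wpM2l // (_ : _ - _ = 'i%C * (t - s)%:C); last first.
  by apply: complex_ext; rewrite ?[RHS]ReM ?[RHS]ImM /=; ring.
rewrite cabsM cabsR (_ : cabs 'i%C = 1) ?mul1r //.
by apply/eqP; rewrite -(@eqrXn2 _ 2) ?cabs_ge0 // cabs_sqr /= expr0n add0r !expr1n.
Qed.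

Lemma cabs_i : cabs ('i%C : R[i]) = 1.
Proof.
by apply/eqP; rewrite -(@eqrXn2 _ 2) ?cabs_ge0 // cabs_sqr /= expr0n add0r !expr1n.
Qed.

(** Cauchy's theorem. As a function of the angle, the integral over the radius
    has the increments of i times the integral of the boundary terms, up to
    quadratic errors; so their difference is constant. *)
Lemma polar_cauchy K K' (r1 r2 t1 t2 : R) : 0 < r1 -> r1 <= r2 -> t1 <= t2 ->
  C11 (rect (ln r1) (ln r2) t1 t2) K K' ->
  cintegral `[r1, r2] (rayK K t2) - cintegral `[r1, r2] (rayK K t1) =
  'i%C * (cintegral `[t1, t2] (fun t => K (ln r2 +i* t))
          - cintegral `[t1, t2] (fun t => K (ln r1 +i* t))).
Proof.
move=> r10 r12 t12 [C C0 hK].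
have r20 : 0 < r2 by exact: lt_le_trans r12.
have inr r t : r1 <= r <= r2 -> t1 <= t <= t2 -> rect (ln r1) (ln r2) t1 t2 (ln r +i* t).
  move=> /andP[rr1 rr2] ht; have r0 := lt_le_trans r10 rr1.
  by split => //=; rewrite !ler_ln ?posrE // rr1.
have in1 t : t1 <= t <= t2 -> rect (ln r1) (ln r2) t1 t2 (ln r1 +i* t).
  by move=> ht; apply: inr; rewrite // lexx r12.
have in2 t : t1 <= t <= t2 -> rect (ln r1) (ln r2) t1 t2 (ln r2 +i* t).
  by move=> ht; apply: inr; rewrite // lexx r12.
have lipK t : t1 <= t <= t2 -> lip_on r1 r2 (rayK K t) (2 * C / r1 ^+ 2).
  move=> ht; apply: lip_rayK => // r s hr hs.
  by have [? _ ? _ _] := hK _ _ (inr r t hr ht) (inr s t hs ht).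
have lipK' t : t1 <= t <= t2 -> lip_on r1 r2 (rayK K' t) (2 * C / r1 ^+ 2).
  move=> ht; apply: lip_rayK => // r s hr hs.
  by have [_ ? _ ? _] := hK _ _ (inr r t hr ht) (inr s t hs ht).
pose d t := K (ln r2 +i* t) - K (ln r1 +i* t).
have lip1 : lip_on t1 t2 (fun t => K (ln r1 +i* t)) C.
  by apply: lip_arcK => // s t hs ht; have [_ _ ? _ _] := hK _ _ (in1 s hs) (in1 t ht).
have lip2 : lip_on t1 t2 (fun t => K (ln r2 +i* t)) C.
  by apply: lip_arcK => // s t hs ht; have [_ _ ? _ _] := hK _ _ (in2 s hs) (in2 t ht).
have lipd : lip_on t1 t2 d (2 * C).
  split; first exact: mulr_ge0.
  move=> s t hs ht; have [_ h1] := lip1; have [_ h2] := lip2.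
  have -> : d t - d s = (K (ln r2 +i* t) - K (ln r2 +i* s)) - (K (ln r1 +i* t) - K (ln r1 +i* s)).
    by rewrite /d; ring.
  by apply: le_trans (cabsB _ _) _; have := h1 s t hs ht; have := h2 s t hs ht; lra.
have ftc t : t1 <= t <= t2 -> cintegral `[r1, r2] (rayK K' t) = d t.
  move=> ht; rewrite (@cintegral_FTC _ r1 r2 (fun r => K (ln r +i* t)) _ (2 * C / r1 ^+ 2) _ r12 (lipK' t ht)) //.
  move=> r s r1r rs sr2; have hr : r1 <= r <= r2 by rewrite r1r (le_trans rs).
  have hs : r1 <= s <= r2 by rewrite sr2 (le_trans r1r).
  have r0 := lt_le_trans r10 r1r; have s0 := lt_le_trans r0 rs.
  have [_ k2 _ _ k5] := hK _ _ (inr r t hr ht) (inr s t hs ht).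
  have e1 : (ln s +i* t) - (ln r +i* t) = (ln s - ln r)%:C.
    by apply: complex_ext => //=; rewrite subrr.
  rewrite e1 cabsR in k5; rewrite /rayK.
  set x := K _ in k5 *; set y := K _ in k5 *; set z := K' _ in k2 k5 *.
  have -> : x - y - (s - r)%:C * (z * (r^-1)%:C) =
     (x - y - (ln s - ln r)%:C * z) + (ln s - ln r - (s - r) / r)%:C * z.
    by rewrite !rmorphB rmorphM rmorphB; ring.
  apply: le_trans (cabsD _ _) _; rewrite cabsM cabsR.
  have q1 := ln_quadratic r0 s0.
  have q2 : (s - r) ^+ 2 / (r * s) <= (s - r) ^+ 2 / r1 ^+ 2.
    rewrite ler_wpM2l ?sqr_ge0 // lef_pV2 ?posrE ?mulr_gt0 ?exprn_gt0 //.
    by rewrite expr2 ler_pM ?(ltW r10) // (le_trans r1r).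
  have q3 : `|ln s - ln r| ^+ 2 <= (s - r) ^+ 2 / r1 ^+ 2.
    rewrite -expr_div_n -[leRHS]real_normK ?num_real // ler_pXn2r ?nnegrE //.
    by rewrite normrM normfV (ger0_norm (ltW r10)); apply: ln_lipschitz => //; exact: le_trans rs.
  have := ler_pM (normr_ge0 _) (cabs_ge0 _) (le_trans q1 q2) k2.
  have := ler_wpM2l C0 q3.
  have -> : 2 * C / r1 ^+ 2 * (s - r) ^+ 2 = C * ((s - r) ^+ 2 / r1 ^+ 2) + (s - r) ^+ 2 / r1 ^+ 2 * C.
    by field; rewrite gt_eqF.
  lra.
have itm a b : t1 <= a -> b <= t2 -> cintegrable `[a, b] d.
  move=> ha hb; apply: (@cintegrable_lip _ _ _ _ (2 * C)); split; first by case: lipd.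
  by move=> s t /andP[s1 s2] /andP[u1 u2]; apply: lipd.2; rewrite ?(le_trans ha) ?(le_trans _ hb).
pose P t := cintegral `[r1, r2] (rayK K t) - 'i%C * cintegral `[t1, t] d.
have PP : P t1 = P t2.
  apply: (@constant_of_quadratic _ _ _ _ (2 * (C / r1 * (r2 - r1)) + 4 * C)) => // s t hs st ht.
  have ts : t1 <= s <= t2 by rewrite hs (le_trans st).
  have tt : t1 <= t <= t2 by rewrite ht (le_trans hs).
  rewrite /P (@cintegral_split _ t1 (BRight t) s d hs) ?bnd_simp //; last exact: itm.
  have -> : cintegral `[r1, r2] (rayK K t) - 'i%C * (cintegral `[t1, s] d + cintegral `[s, t] d) -
     (cintegral `[r1, r2] (rayK K s) - 'i%C * cintegral `[t1, s] d) =
     (cintegral `[r1, r2] (rayK K t) - cintegral `[r1, r2] (rayK K s) - ('i%C * (t - s)%:C) * d s)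
     - 'i%C * (cintegral `[s, t] d - d s * (t - s)%:C) by ring.
  apply: le_trans (cabsB _ _) _; rewrite [leRHS]mulrDl; apply: lerD.
    rewrite -(ftc s) // -cintegralZ //; last exact: cintegrable_lip (lipK' s ts).
    rewrite -!cintegralB //; last 4 first.
    - by apply: cintegrableB => //; [exact: cintegrable_lip (lipK t tt)|exact: cintegrable_lip (lipK s ts)].
    - by apply: cintegrableZ => //; exact: cintegrable_lip (lipK' s ts).
    - exact: cintegrable_lip (lipK t tt).
    - exact: cintegrable_lip (lipK s ts).
    apply: le_trans (@cintegral_le _ _ _ _ (C / r1 * (t - s) ^+ 2) r12 _ _) _.
    - apply: cintegrableB => //.
        by apply: cintegrableB => //; [exact: cintegrable_lip (lipK t tt)|exact: cintegrable_lip (lipK s ts)].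
      by apply: cintegrableZ => //; exact: cintegrable_lip (lipK' s ts).
    - move=> r hr; have [r1r _] := andP hr; have r0 := lt_le_trans r10 r1r.
      have [_ _ _ _ k5] := hK _ _ (inr r s hr ts) (inr r t hr tt).
      have e1 : (ln r +i* t) - (ln r +i* s) = 'i%C * (t - s)%:C.
        by apply: complex_ext; rewrite ?[RHS]ReM ?[RHS]ImM /=; ring.
      rewrite e1 [cabs ('i%C * _)]cabsM cabs_i mul1r cabsR real_normK ?num_real // in k5.
      rewrite /rayK; set x := K _ in k5 *; set y := K _ in k5 *; set z := K' _ in k5 *.
      have -> : x * (r^-1)%:C - y * (r^-1)%:C - 'i%C * (t - s)%:C * (z * (r^-1)%:C)
        = (x - y - 'i%C * (t - s)%:C * z) * (r^-1)%:C by ring.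
      rewrite cabsM cabsR ger0_norm ?invr_ge0 ?(ltW r0) // [leRHS]mulrAC.
      by rewrite ler_pM ?cabs_ge0 ?invr_ge0 ?(ltW r0) // lef_pV2.
    by rewrite le_eqVlt; apply/orP; left; apply/eqP; ring.
  rewrite cabsM cabs_i mul1r -cintegral_const // -cintegralB //; last exact: cintegrable_const.
    apply: le_trans (@cintegral_le _ _ _ _ (2 * C * (t - s)) st _ _) _.
    - by apply: cintegrableB => //; [exact: itm|exact: cintegrable_const].
    - move=> x /andP[sx xt]; have [L0 FL] := lipd.
      apply: le_trans (FL s x ts _) _; first by rewrite (le_trans hs) // (le_trans xt).
      by rewrite ger0_norm ?subr_ge0 // ler_wpM2l ?mulr_ge0 // lerD2r.
    by rewrite le_eqVlt; apply/orP; left; apply/eqP; ring.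
  exact: itm.
have d1 : cintegral `[t1, t1] d = 0.
  apply/cabs_eq0/eqP; rewrite eq_le cabs_ge0 andbT.
  apply: le_trans (@cintegral_le _ t1 t1 d (cabs (d t1)) (lexx _) _ _) _.
  - exact: itm.
  - by move=> x; rewrite -eq_le => /eqP ->.
  - by rewrite subrr !mulr0.
have dd : cintegral `[t1, t2] d = cintegral `[t1, t2] (fun t => K (ln r2 +i* t))
          - cintegral `[t1, t2] (fun t => K (ln r1 +i* t)).
  by rewrite /d cintegralB //; [exact: cintegrable_lip lip2|exact: cintegrable_lip lip1].
move: PP; rewrite /P d1 mulr0 subr0 dd => ->; ring.
Qed.

End PolarCauchy.

(** * Rays to infinity *)

Section RaysToInfinity.
Variable R : realType.
Notation mu := (@lebesgue_measure R).
Notation RM := (measurableTypeR R).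
Implicit Types (K : R[i] -> R[i]) (F : R -> R[i]) (a r t C : R).

(** The function r^(-a-1), the majorant of all integrands on the rays. *)
Definition decay (a r : R) : R := expR (- a * ln r) / r.

Lemma derive_exp_ln a r : 0 < r ->
  is_derive r 1 (fun s : R => expR (- a * ln s)) (- a * decay a r).
Proof.
move=> r0.
have h : is_derive r 1 (fun s : R => - a * ln s) (- a / r).
  by apply: (derive_eq (derive_mul (derive_const (- a) r) (is_derive1_ln r0))); rewrite mulr0 addr0.
apply: (derive_eq (is_derive1_comp (is_derive_expR _) h)).
by rewrite /decay; ring.
Qed.

Lemma decay_continuous a (A : R) : 0 < A -> {within `[A, +oo[, continuous (decay a)}.
Proof.
move=> A0; apply: derivable_within_continuous => r; rewrite in_itv /= andbT => Ar.
have r0 := lt_le_trans A0 Ar.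
have rn0 : (@id R) r != 0 by rewrite gt_eqF.
exact: (@ex_derive _ _ _ _ _ _ _ (derive_mul (derive_exp_ln a r0) (is_deriveV rn0 (is_derive_id r 1)))).
Qed.

Lemma exp_ln_small a (A e : R) : 0 < a -> 0 < e -> exists2 B, A <= B & expR (- a * ln B) < e.
Proof.
move=> a0 e0; pose B := Num.max A (expR (ln (2 / e) / a)).
exists B; first by rewrite le_max lexx.
have B0 : 0 < B by rewrite lt_max expR_gt0 orbT.
have e2 : 0 < 2 / e by rewrite divr_gt0.
have hB : ln (2 / e) <= a * ln B.
  have : expR (ln (2 / e) / a) <= B by rewrite le_max lexx orbT.
  by rewrite -ler_ln ?posrE ?expR_gt0 // expRK ler_pdivrMr // [ln B * a]mulrC.
apply: (@le_lt_trans _ _ (expR (- ln (2 / e)))); first by rewrite ler_expR; lra.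
by rewrite expRN lnK // invf_div; lra.
Qed.

Lemma integral_decay a (A : R) : 0 < a -> 0 < A ->
  mu.-integrable (`[A, +oo[ : set RM) (EFin \o decay a) /\
  \int[mu]_(r in `[A, +oo[) decay a r = expR (- a * ln A) / a.
Proof.
move=> a0 A0.
have f0 r : A <= r -> 0 <= decay a r.
  by move=> Ar; rewrite divr_ge0 ?expR_ge0 // ltW // (lt_le_trans A0).
pose F (r : R) := expR (- a * ln r) * (- a^-1).
have dF (r : R) : 0 < r -> is_derive r 1 F (decay a r).
  move=> r0; apply: (derive_eq (derive_mul (derive_exp_ln a r0) (derive_const (- a^-1) r))).
  by rewrite mulr0 add0r; field; rewrite gt_eqF.
have FTC : (\int[mu]_(r in `[A, +oo[) (decay a r)%:E = 0%:E - (F A)%:E)%E.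
  apply: ge0_continuous_FTC2y => //.
  - exact: decay_continuous.
  - apply/cvgrPdist_lt => e e0; have ea : 0 < e * a by rewrite mulr_gt0.
    have [B _ hB] := exp_ln_small 1 a0 ea.
    near=> r.
    have rB : Num.max B 1 < r by near: r; apply: nbhs_pinfty_gt; exact: num_real.
    move: rB; rewrite gt_max => /andP[rB r1].
    rewrite sub0r normrN /F normrM normrN (ger0_norm (expR_ge0 _)) (gtr0_norm (x := a^-1)) ?invr_gt0 //.
    rewrite ltr_pdivrMr //; apply: le_lt_trans hB; rewrite ler_expR.
    have [B0|B0] := ltP 0 B.
      by rewrite !mulNr lerN2 ler_pM2l // ler_ln ?posrE ?ltW // (lt_trans B0).
    by rewrite (ln0 B0) mulr0 mulNr oppr_le0 mulr_ge0 ?(ltW a0) // ln_ge0 // ltW.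
  - by move=> r Ar; exact: (@ex_derive _ _ _ _ _ _ _ (dF r (lt_trans A0 Ar))).
  - apply: cvg_at_right_filter; apply: differentiable_continuous.
    by apply/derivable1_diffP; exact: (@ex_derive _ _ _ _ _ _ _ (dF A A0)).
  - move=> r; rewrite in_itv /= andbT => Ar.
    by rewrite derive1E; exact: (@derive_val _ _ _ _ _ _ _ (dF r (lt_trans A0 Ar))).
have FA : - F A = expR (- a * ln A) / a by rewrite /F mulrN opprK.
split; last by rewrite /Rintegral FTC sub0e /= FA.
apply/integrableP; split.
  apply/measurable_realfun.measurable_EFinP; apply: measurable_realfun.subspace_continuous_measurable_fun => //.
  exact: decay_continuous.
have -> : (\int[mu]_(r in `[A, +oo[) `|(EFin \o decay a) r| =
    \int[mu]_(r in `[A, +oo[) (decay a r)%:E)%E.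
  apply: eq_integral => r; rewrite inE /= in_itv /= andbT => /f0 h.
  by rewrite ger0_norm.
by rewrite FTC ltry.
Unshelve. all: by end_near.
Qed.

Lemma cintegrable_ray F (A C a : R) : 0 < A -> 0 < a ->
  (forall B, exists L, lip_on A B F L) ->
  (forall r, A <= r -> cabs (F r) <= C * decay a r) ->
  cintegrable `[A, +oo[ F.
Proof.
move=> A0 a0 FL FC; have [gi _] := integral_decay a0 A0.
have mA : measurable (`[A, +oo[ : set RM) by exact: measurable_itv.
have gCi := integrableZl mA C gi.
have key (h : R -> R) : (forall r, A <= r -> `|h r| <= cabs (F r)) ->
   (forall r s, `|h s - h r| <= cabs (F s - F r)) ->
   mu.-integrable (`[A, +oo[ : set RM) (fun t => (h t)%:E).
  move=> hF hFL; apply: (le_integrable mA _ _ gCi); last first.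
    move=> r; rewrite /= in_itv /= andbT => Ar; rewrite lee_fin.
    apply: le_trans (hF r Ar) (le_trans (FC r Ar) (ler_norm _)).
  apply/measurable_realfun.measurable_EFinP; apply: measurable_realfun.subspace_continuous_measurable_fun => //.
  apply/subspace_continuousP => x /=; rewrite in_itv /= andbT => Ax.
  have [L [L0 hL]] := FL (x + 1).
  apply/cvgrPdist_lt => e e0; rewrite near_withinE.
  have L1 : 0 < L + 1 by rewrite ltr_wpDl.
  exists (Num.min 1 (e / (L + 1))) => /=; first by rewrite lt_min ltr01 divr_gt0.
  move=> y /=; rewrite lt_min ltr_pdivlMr // => /andP[y1 xy].
  rewrite in_itv /= andbT => Ay.
  have yx : y <= x + 1 by move: y1; rewrite ltr_norml; lra.
  apply: le_lt_trans (hFL _ _) _; apply: le_lt_trans (hL y x _ _) _.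
  - by rewrite Ay yx.
  - by rewrite Ax lerDl ler01.
  - by have := normr_ge0 (x - y); nra.
split; (apply: key => [r _|r s]).
- exact: Re_le_cabs.
- by rewrite -ReN -ReD Re_le_cabs.
- exact: Im_le_cabs.
- by rewrite -ImN -ImD Im_le_cabs.
Qed.

Lemma cintegral_ray_le F (A C a : R) : 0 < A -> 0 < a ->
  cintegrable `[A, +oo[ F ->
  (forall r, A <= r -> cabs (F r) <= C * decay a r) ->
  cabs (cintegral `[A, +oo[ F) <= 2 * (C * (expR (- a * ln A) / a)).
Proof.
have mA : measurable (`[A, +oo[ : set RM) by exact: measurable_itv.
move=> A0 a0 iF FC; have [gi gE] := integral_decay a0 A0.
rewrite -gE -RintegralZl //; apply: cintegral_bound => //.
  exact: (integrableZl mA C gi).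
by move=> r; rewrite /= in_itv /= andbT; exact: FC.
Qed.

Lemma rayK_le K t r C a : 0 < r -> cabs (K (ln r +i* t)) <= C * expR (- a * ln r) ->
  cabs (rayK K t r) <= C * decay a r.
Proof.
move=> r0 h; rewrite /rayK cabsM cabsR ger0_norm ?invr_ge0 ?(ltW r0) //.
by rewrite /decay mulrA ler_pM2r // invr_gt0.
Qed.

Lemma rayK_lip_of_C11 K (A t1 t2 t : R) : 0 < A -> t1 <= t <= t2 ->
  (forall B, exists K', C11 (rect (ln A) (ln B) t1 t2) K K') ->
  forall B, exists L, lip_on A B (rayK K t) L.
Proof.
move=> A0 ht hK B; have [K' [C C0 h]] := hK B.
exists (2 * C / A ^+ 2); apply: lip_rayK => // r s /andP[r1 r2] /andP[s1 s2].
have r0 := lt_le_trans A0 r1; have s0 := lt_le_trans A0 s1.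
have B0 := lt_le_trans r0 r2.
have [] // := h (ln r +i* t) (ln s +i* t).
- by split => //=; rewrite !ler_ln ?posrE // r1.
- by split => //=; rewrite !ler_ln ?posrE // s1.
Qed.

(** The polar rectangles from the radius A to a large radius B are exhausted;
    the arc of radius B contributes at most a multiple of B^(-a). *)
Lemma ray_cauchy K (A t1 t2 C a : R) : 0 < A -> t1 <= t2 -> 0 < a -> 0 <= C ->
  (forall B, exists K', C11 (rect (ln A) (ln B) t1 t2) K K') ->
  (forall l, ln A <= complex.Re l -> t1 <= complex.Im l <= t2 ->
     cabs (K l) <= C * expR (- a * complex.Re l)) ->
  cintegral `[A, +oo[ (rayK K t2) - cintegral `[A, +oo[ (rayK K t1)
  = - 'i%C * cintegral `[t1, t2] (fun t => K (ln A +i* t)).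
Proof.
move=> A0 t12 a0 C0 hK KC.
have e1 : t1 <= t1 <= t2 by rewrite lexx.
have e2 : t1 <= t2 <= t2 by rewrite lexx t12.
have rC t r : t1 <= t <= t2 -> A <= r -> cabs (rayK K t r) <= C * decay a r.
  move=> ht Ar; have r0 := lt_le_trans A0 Ar; apply: rayK_le => //.
  by apply: KC => //=; rewrite ler_ln.
have ir t : t1 <= t <= t2 -> cintegrable `[A, +oo[ (rayK K t).
  move=> ht; apply: (@cintegrable_ray _ _ C a) => //; last by move=> r; exact: rC.
  exact: rayK_lip_of_C11 ht hK.
apply/eqP; rewrite -subr_eq0; apply/eqP/cabs_eq0/eqP; rewrite eq_le cabs_ge0 andbT.
apply/ler_addgt0Pl => e e0; rewrite addr0.
pose W := 4 * C / a + 2 * C * (t2 - t1) + 1.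
have W0 : 0 < W.
  by rewrite ltr_wpDl // addr_ge0 // ?divr_ge0 ?mulr_ge0 ?subr_ge0 // ltW.
have [B AB hB] := exp_ln_small A a0 (divr_gt0 e0 W0).
have B0 := lt_le_trans A0 AB.
have key t : t1 <= t <= t2 -> cintegral `[A, +oo[ (rayK K t) =
    cintegral `[A, B] (rayK K t) + cintegral `[B, +oo[ (rayK K t).
  by move=> ht; apply: cintegral_split => //; exact: ir.
have iB t : t1 <= t <= t2 -> cintegrable `[B, +oo[ (rayK K t).
  by move=> ht; apply: cintegrable_sub (ir t ht) => //; apply: subset_itvr; rewrite bnd_simp.
have tail t : t1 <= t <= t2 -> cabs (cintegral `[B, +oo[ (rayK K t)) <= 2 * (C * (expR (- a * ln B) / a)).
  move=> ht; apply: cintegral_ray_le => //; first exact: iB.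
  by move=> r Br; apply: rC => //; exact: le_trans Br.
have arc : cabs (cintegral `[t1, t2] (fun t => K (ln B +i* t))) <= 2 * (C * expR (- a * ln B) * (t2 - t1)).
  apply: cintegral_le => //; last by move=> t ht; apply: KC => //=; rewrite ler_ln.
  have [K' [D D0 hD]] := hK B; apply: (cintegrable_lip (lip_arcK D0 _)) => s t hs ht.
  by have [] // := hD (ln B +i* s) (ln B +i* t); split => //=; rewrite ler_ln ?posrE // AB lexx.
rewrite (key _ e1) (key _ e2).
have [K' hKB] := hK B; have pc := polar_cauchy A0 AB t12 hKB.
have -> : cintegral `[A, B] (rayK K t2) + cintegral `[B, +oo[ (rayK K t2) -
   (cintegral `[A, B] (rayK K t1) + cintegral `[B, +oo[ (rayK K t1)) -
   - 'i%C * cintegral `[t1, t2] (fun t => K (ln A +i* t)) =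
   (cintegral `[A, B] (rayK K t2) - cintegral `[A, B] (rayK K t1)) +
   (cintegral `[B, +oo[ (rayK K t2) - cintegral `[B, +oo[ (rayK K t1)) +
   'i%C * cintegral `[t1, t2] (fun t => K (ln A +i* t)) by ring.
rewrite pc mulrBr.
set x := cintegral _ _; set y := cintegral _ _; set z := cintegral _ _; set u := cintegral _ _.
have -> : 'i%C * x - 'i%C * y + (z - u) + 'i%C * y = 'i%C * x + (z - u) by ring.
apply: le_trans (cabsD _ _) _; rewrite cabsM cabs_i mul1r.
have h1 := cabsB z u; have h2 : cabs z <= _ := tail t2 e2; have h3 : cabs u <= _ := tail t1 e1.
rewrite -/x in arc; move: hB; rewrite ltr_pdivlMr // /W.
set E := expR _ in arc h2 h3 *; have E0 : 0 <= E by exact: expR_ge0.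
move: arc h1 h2 h3.
have -> : 2 * (C * (E / a)) = 2 * C / a * E by field; rewrite gt_eqF.
have -> : 4 * C / a = 2 * (2 * C / a) by field; rewrite gt_eqF.
set q := 2 * C / a; lra.
Qed.

End RaysToInfinity.

(** * Keyhole contour integrals *)

Section Keyhole.
Variable R : realType.
Implicit Types (K : R[i] -> R[i]) (phi eps a C : R).

(** In logarithmic coordinates the keyhole contour is made of straight lines,
    and a power of the variable is an exponential with no branch to choose. *)
Definition log_keyhole phi eps : set R[i] :=
  [set l | (ln eps <= complex.Re l /\ (complex.Im l = phi \/ complex.Im l = - phi)) \/
           (complex.Re l = ln eps /\ - phi <= complex.Im l <= phi)].

Definition KI phi eps K : R[i] :=
  - cintegral `[eps, +oo[ (rayK K (- phi))
  + 'i%C * cintegral `[- phi, phi] (fun t => K (ln eps +i* t))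
  + cintegral `[eps, +oo[ (rayK K phi).

Definition kint phi eps K : Prop :=
  [/\ cintegrable `[eps, +oo[ (rayK K (- phi)),
      cintegrable `[- phi, phi] (fun t => K (ln eps +i* t)) &
      cintegrable `[eps, +oo[ (rayK K phi)].

(** The conditions under which the contour integral converges absolutely and
    is estimated by C alone. *)
Definition kgood phi eps a C K : Prop :=
  [/\ 0 <= C,
      forall l, log_keyhole phi eps l -> cabs (K l) <= C * expR (- a * complex.Re l) &
      forall B, exists2 L, 0 <= L & forall l m, log_keyhole phi eps l ->
        log_keyhole phi eps m -> complex.Re l <= B -> complex.Re m <= B ->
        cabs (K m - K l) <= L * cabs (m - l)].

Definition keyhole_const phi eps a : R :=
  4 * (expR (- a * ln eps) / a) + 4 * (expR (- a * ln eps) * phi).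

Lemma KID phi eps K1 K2 : kint phi eps K1 -> kint phi eps K2 ->
  KI phi eps (fun l => K1 l + K2 l) = KI phi eps K1 + KI phi eps K2.
Proof.
move=> [a1 a2 a3] [b1 b2 b3]; rewrite /KI.
have rD t r : rayK (fun l => K1 l + K2 l) t r = rayK K1 t r + rayK K2 t r.
  by rewrite /rayK mulrDl.
rewrite (@eq_cintegral _ _ (rayK _ (- phi)) _ (fun r _ => rD (- phi) r)).
rewrite (@eq_cintegral _ _ (rayK _ phi) _ (fun r _ => rD phi r)).
by rewrite !cintegralD //; ring.
Qed.

Lemma KIZ phi eps K (c : R[i]) : kint phi eps K ->
  KI phi eps (fun l => c * K l) = c * KI phi eps K.
Proof.
move=> [a1 a2 a3]; rewrite /KI.
have rZ t r : rayK (fun l => c * K l) t r = c * rayK K t r.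
  by rewrite /rayK mulrA.
rewrite (@eq_cintegral _ _ (rayK _ (- phi)) _ (fun r _ => rZ (- phi) r)).
rewrite (@eq_cintegral _ _ (rayK _ phi) _ (fun r _ => rZ phi r)).
by rewrite !cintegralZ //; ring.
Qed.

Lemma kintD phi eps K1 K2 : kint phi eps K1 -> kint phi eps K2 ->
  kint phi eps (fun l => K1 l + K2 l).
Proof.
have rD t r : rayK (fun l => K1 l + K2 l) t r = rayK K1 t r + rayK K2 t r.
  by rewrite /rayK mulrDl.
move=> [a1 a2 a3] [b1 b2 b3]; split.
- by apply: eq_cintegrable (cintegrableD _ a1 b1) => // r _; rewrite rD.
- exact: cintegrableD.
- by apply: eq_cintegrable (cintegrableD _ a3 b3) => // r _; rewrite rD.
Qed.

Lemma kintZ phi eps K (c : R[i]) : kint phi eps K -> kint phi eps (fun l => c * K l).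
Proof.
have rZ t r : rayK (fun l => c * K l) t r = c * rayK K t r.
  by rewrite /rayK mulrA.
move=> [a1 a2 a3]; split.
- by apply: eq_cintegrable (cintegrableZ c _ a1) => // r _; rewrite rZ.
- exact: cintegrableZ.
- by apply: eq_cintegrable (cintegrableZ c _ a3) => // r _; rewrite rZ.
Qed.

Lemma eq_KI phi eps K1 K2 : 0 < eps ->
  (forall l, log_keyhole phi eps l -> K1 l = K2 l) -> KI phi eps K1 = KI phi eps K2.
Proof.
move=> e0 h; rewrite /KI; congr (- _ + 'i%C * _ + _); apply: eq_cintegral => r /=;
  rewrite in_itv /= ?andbT => hr.
- rewrite /rayK h //; left; split => /=; last by right.
  by rewrite ler_ln ?posrE // (lt_le_trans e0).
- by rewrite h //; right.
- rewrite /rayK h //; left; split => /=; last by left.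
  by rewrite ler_ln ?posrE // (lt_le_trans e0).
Qed.

Section Good.
Variables (phi eps a C : R) (K : R[i] -> R[i]).
Hypotheses (phi0 : 0 <= phi) (e0 : 0 < eps) (a0 : 0 < a).
Hypothesis hK : kgood phi eps a C K.

Let ray_in r t : eps <= r -> t = phi \/ t = - phi -> log_keyhole phi eps (ln r +i* t).
Proof. by move=> er ht; left; split => //=; rewrite ler_ln ?posrE // (lt_le_trans e0). Qed.

Let ray_le t r : t = phi \/ t = - phi -> eps <= r -> cabs (rayK K t r) <= C * decay a r.
Proof.
move=> ht er; apply: rayK_le; first exact: lt_le_trans er.
by have [_ h _] := hK; apply: (h (ln r +i* t)); exact: ray_in.
Qed.

Let ray_int t : t = phi \/ t = - phi -> cintegrable `[eps, +oo[ (rayK K t).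
Proof.
move=> ht; apply: (cintegrable_ray e0 a0 (C := C)) => [B|r]; last exact: ray_le.
have [C0 hC hL] := hK; have [L L0 {}hL] := hL (ln B).
pose D := Num.max L (C * expR (`|a| * (`|ln eps| + `|ln B|))).
have D0 : 0 <= D by rewrite le_max L0.
exists (2 * D / eps ^+ 2); apply: lip_rayK => // r s /andP[r1 r2] /andP[s1 s2].
have r0 := lt_le_trans e0 r1; have s0 := lt_le_trans e0 s1; have B0 := lt_le_trans r0 r2.
split.
  apply: le_trans (hC _ (ray_in r1 ht)) _; rewrite /D le_max; apply/orP; right.
  rewrite ler_wpM2l // ler_expR /=.
  apply: le_trans (ler_norm _) _; rewrite normrM normrN ler_wpM2l //.
  have h1 : ln eps <= ln r by rewrite ler_ln.
  have h2 : ln r <= ln B by rewrite ler_ln.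
  have := ler_norm (ln eps); have := ler_norm (- ln eps); rewrite normrN.
  by have := ler_norm (ln B); have := normr_ge0 (ln B); rewrite ler_norml; lra.
apply: le_trans (hL _ _ (ray_in r1 ht) (ray_in s1 ht) _ _) _; rewrite /= ?ler_ln ?posrE //.
by rewrite ler_wpM2r ?cabs_ge0 // le_max lexx.
Qed.

Let arc_int : cintegrable `[- phi, phi] (fun t => K (ln eps +i* t)).
Proof.
have [C0 _ hL] := hK; have [L L0 {}hL] := hL (ln eps).
by apply: (cintegrable_lip (lip_arcK L0 _)) => s t hs ht; apply: hL; rewrite //=; right.
Qed.

Lemma kgood_int : kint phi eps K.
Proof. by split => //; apply: ray_int; [right|left]. Qed.

Lemma KI_le : cabs (KI phi eps K) <= C * keyhole_const phi eps a.
Proof.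
have [C0 hC _] := hK; have [i1 i2 i3] := kgood_int.
have h1 := cintegral_ray_le e0 a0 i1 (fun r => @ray_le (- phi) r (or_intror erefl)).
have h3 := cintegral_ray_le e0 a0 i3 (fun r => @ray_le phi r (or_introl erefl)).
have pp : - phi <= phi by rewrite (le_trans _ phi0) // oppr_le0.
have h2 := @cintegral_le _ _ _ _ (C * expR (- a * ln eps)) pp i2 _.
rewrite /KI; apply: le_trans (cabsD _ _) _.
have := cabsD (- cintegral `[eps, +oo[ (rayK K (- phi))) ('i%C * cintegral `[- phi, phi] (fun t => K (ln eps +i* t))).
rewrite cabsN cabsM cabs_i mul1r => h4.
have {}h2 := h2 (fun t ht => hC (ln eps +i* t) (or_intror (conj erefl ht))).
move: h1 h2 h3 h4; rewrite /keyhole_const opprK; set E := expR _; set u := E / a.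
have -> : 2 * (C * E * (phi + phi)) = C * (4 * (E * phi)) by ring.
set x := cabs _; set y := cabs _; set z := cabs _; lra.
Qed.

End Good.

Lemma KI_angle phi phi' eps K a C L : 0 < eps -> 0 <= phi -> phi <= phi' -> 0 < a -> 0 <= C ->
  (forall B, exists K', C11 (rect (ln eps) (ln B) phi phi') K K') ->
  (forall B, exists K', C11 (rect (ln eps) (ln B) (- phi') (- phi)) K K') ->
  (forall l, ln eps <= complex.Re l -> phi <= complex.Im l <= phi' ->
     cabs (K l) <= C * expR (- a * complex.Re l)) ->
  (forall l, ln eps <= complex.Re l -> - phi' <= complex.Im l <= - phi ->
     cabs (K l) <= C * expR (- a * complex.Re l)) ->
  lip_on (- phi') phi' (fun t => K (ln eps +i* t)) L ->
  KI phi eps K = KI phi' eps K.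
Proof.
move=> e0 phi0 pp a0 C0 h1 h2 k1 k2 lip.
have pp' : - phi' <= - phi by rewrite lerN2.
have r1 := ray_cauchy e0 pp a0 C0 h1 k1.
have r2 := ray_cauchy e0 pp' a0 C0 h2 k2.
have iarc := cintegrable_lip lip.
have s1 := @cintegral_split _ (- phi') (BRight phi') (- phi) _ pp' _ iarc.
have iarc' : cintegrable `[- phi, phi'] (fun t => K (ln eps +i* t)).
  by apply: cintegrable_sub iarc => //; apply: subset_itvr; rewrite bnd_simp.
have np : - phi <= phi by lra.
have s2 := @cintegral_split _ (- phi) (BRight phi') phi _ np _ iarc'.
rewrite /KI {}s1 ?{}s2 ?bnd_simp //; last lra.
move: r1 r2; set x1 := cintegral _ _; set x2 := cintegral _ _; set x3 := cintegral _ _.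
set x4 := cintegral _ _; set x5 := cintegral _ _; set x6 := cintegral _ _; set x7 := cintegral _ _.
move=> /eqP; rewrite subr_eq => /eqP -> /eqP; rewrite subr_eq => /eqP ->.
ring.
Qed.

Lemma KI_radius phi eps eps' K K' : 0 < eps' -> eps' <= eps -> 0 <= phi ->
  C11 (rect (ln eps') (ln eps) (- phi) phi) K K' -> kint phi eps' K ->
  KI phi eps' K = KI phi eps K.
Proof.
move=> e0 ee phi0 hK [i1 i2 i3].
have np : - phi <= phi by lra.
have pc := polar_cauchy e0 ee np hK.
rewrite /KI (@cintegral_split _ eps' +oo%O eps _ ee _ i1) //.
rewrite (@cintegral_split _ eps' +oo%O eps _ ee _ i3) //.
move: pc; set x1 := cintegral _ _; set x2 := cintegral _ _; set x3 := cintegral _ _.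
set x4 := cintegral _ _; set x5 := cintegral _ _; set x6 := cintegral _ _.
move=> /eqP; rewrite subr_eq => /eqP ->; ring.
Qed.

(** The integrand is analytic to the right of the contour, which can thus be
    closed down to the angle zero, where the two rays cancel. *)
Lemma KI_exp_eq0 phi eps (w : R[i]) : 0 < eps -> 0 <= phi -> 0 < complex.Re w ->
  KI phi eps (fun l => cexp (- w * l)) = 0.
Proof.
move=> e0 phi0 w0.
pose C := expR (`|complex.Im w| * phi).
have bnd l : - phi <= complex.Im l <= phi ->
    cabs (cexp (- w * l)) <= C * expR (- complex.Re w * complex.Re l).
  move=> /andP[l1 l2]; rewrite cabs_cexp /C -expRD ler_expR ReM ReN ImN.
  rewrite [leRHS]addrC lerD2l [- _ * complex.Im l]mulNr opprK; apply: le_trans (ler_norm _) _; rewrite normrM ler_wpM2l //.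
  by rewrite ler_norml l1.
have c11 x1 x2 t1 t2 : C11 (rect x1 x2 t1 t2) (fun l => cexp (- w * l))
    (fun l => cexp (- w * l) * - w).
  pose B := `|x1| + `|x2| + `|t1| + `|t2|.
  have bl l : rect x1 x2 t1 t2 l -> cabs l <= B.
    move=> [/andP[u1 u2] /andP[v1 v2]]; apply: le_trans (cabs_le_ReIm l) _.
    have : `|complex.Re l| <= `|x1| + `|x2|.
      rewrite ler_norml; have := ler_norm x2; have := normr_ge0 x1; have := normr_ge0 x2.
      by have := ler_norm (- x1); rewrite normrN; lra.
    have : `|complex.Im l| <= `|t1| + `|t2|.
      rewrite ler_norml; have := ler_norm t2; have := normr_ge0 t1; have := normr_ge0 t2.
      by have := ler_norm (- t1); rewrite normrN; lra.
    by rewrite /B; lra.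
  apply: (@C11_comp _ _ [set z | cabs z <= cabs w * B] _ _ (fun l => - w * l) (fun=> - w)).
  - by move=> l /bl hl; rewrite /= cabsM cabsN ler_wpM2l // cabs_ge0.
  - exact: (@C11_cexp _ _ (cabs w * B)).
  - exact: C11_lin bl.
have pp : 0 <= phi by [].
have [D D0 hD] := c11 (ln eps) (ln eps) (- phi) phi.
have lip : lip_on (- phi) phi (fun t => cexp (- w * (ln eps +i* t))) D.
  apply: (@lip_arcK _ (fun l => cexp (- w * l))) => // s t hs ht.
  by have [] // := hD (ln eps +i* s) (ln eps +i* t); split => //=; rewrite lexx.
rewrite -(@KI_angle 0 phi eps _ (complex.Re w) C D) //.
- rewrite /KI oppr0 addrAC addNr add0r.
  rewrite (_ : cintegral _ _ = 0) ?mulr0 //.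
  apply/cabs_eq0/eqP; rewrite eq_le cabs_ge0 andbT.
  apply: le_trans (@cintegral_le _ 0 0 _ (cabs (cexp (- w * (ln eps +i* 0)))) (lexx _) _ _) _.
  + apply: (@cintegrable_lip _ _ _ _ D); split => // s t /andP[s1 s2] /andP[u1 u2].
    by apply: lip.2; lra.
  + by move=> x; rewrite -eq_le => /eqP <-.
  + by rewrite subrr !mulr0.
- exact: expR_ge0.
- by move=> B; eexists; exact: c11.
- by move=> B; eexists; exact: c11.
- by move=> l _ /andP[l1 l2]; apply: bnd; rewrite l2; lra.
- by rewrite oppr0 => l _ /andP[l1 l2]; apply: bnd; rewrite l1; lra.
Qed.

End Keyhole.

(** * The resolvent *)

Section Resolvent.
Variables (R : realType) (H : hilbertType R) (T : oper H H).
Implicit Types (z l : R[i]) (f g : H).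

Notation Rf := (resolvent_fun T).

Lemma resolvent_funP z : resolvent_set T z ->
  (exists M, blin (Rf z) M) /\ (forall f g, T (g, f + z *: g) <-> g = Rf z f).
Proof.
move=> /bounded_operP[a [M [aM aE]]].
have E f : Rf z f = a f.
  have /= h : resolvent T z (f, Rf z f).
    by apply: (@xgetPex _ 0 [set g | resolvent T z (f, g)]); exists (a f); apply/aE.
  by apply/aE.
have -> : Rf z = a by apply/funext.
by split; [exists M|move=> f g; exact: aE].
Qed.

Lemma resolvent_identity z l f : resolvent_set T z -> resolvent_set T l ->
  Rf z f - Rf l f = (z - l) *: Rf z (Rf l f).
Proof.
move=> rz rl; have [[M aM] zE] := resolvent_funP rz; have [_ lE] := resolvent_funP rl.
have h : T (Rf l f, f + l *: Rf l f) by apply/lE.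
have : Rf l f = Rf z (f + (l - z) *: Rf l f).
  by apply/zE; rewrite -addrA -scalerDl subrK.
rewrite (blinD aM) (blinZ aM) => {1}->.
by rewrite opprD addrA subrr add0r -scaleNr opprB.
Qed.

Lemma resolvent_commute z l f : resolvent_set T z -> resolvent_set T l ->
  Rf z (Rf l f) = Rf l (Rf z f).
Proof.
move=> rz rl; have [->//|zl] := eqVneq z l.
have h1 := resolvent_identity f rz rl; have h2 := resolvent_identity f rl rz.
have : (z - l) *: Rf z (Rf l f) = (z - l) *: Rf l (Rf z f).
  by rewrite -h1 -opprB h2 -scaleNr opprB.
by apply: scalerI; rewrite subr_eq0.
Qed.

(** From the resolvent identity, as half of the norm is absorbed by the left-
    hand side. *)
Lemma resolvent_near z l (M : R) f : resolvent_set T z -> resolvent_set T l ->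
  (forall g, hnorm (Rf l g) <= M * hnorm g) -> cabs (z - l) * M <= 2^-1 ->
  hnorm (Rf z f) <= 2 * M * hnorm f.
Proof.
move=> rz rl lM zlM.
have h := resolvent_identity f rl rz.
have h1 : hnorm (Rf z f) <= hnorm (Rf l f) + cabs (l - z) * hnorm (Rf l (Rf z f)).
  rewrite -hnormZ -h -[X in hnorm X <= _](subrK (Rf l f)) addrC hnorm_subC.
  by apply: le_trans (hnormD _ _) _; rewrite hnorm_subC lerD2l hnorm_subC.
rewrite cabs_subC in h1; have h2 := lM (Rf z f); have h3 := lM f.
have := hnorm_ge0 (Rf z f); have := cabs_ge0 (z - l).
have : cabs (z - l) * hnorm (Rf l (Rf z f)) <= cabs (z - l) * (M * hnorm (Rf z f)).
  by rewrite ler_wpM2l // cabs_ge0.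
have : cabs (z - l) * M * hnorm (Rf z f) <= 2^-1 * hnorm (Rf z f).
  by rewrite ler_wpM2r // hnorm_ge0.
lra.
Qed.

(** The derivative of the resolvent is its square, and the resolvent identity
    gives the remainders in closed form. *)
Lemma C11_resolvent (Z : set R[i]) (M : R) f g : 0 <= M ->
  (forall z, Z z -> resolvent_set T z /\ forall h, hnorm (Rf z h) <= M * hnorm h) ->
  C11 Z (fun z => hdot (Rf z f) g) (fun z => hdot (Rf z (Rf z f)) g).
Proof.
move=> M0 ZM; pose W := hnorm f * hnorm g; have W0 : 0 <= W by rewrite mulr_ge0 ?hnorm_ge0.
pose D := M + M ^+ 2 + 2 * M ^+ 3.
have M2 : 0 <= M ^+ 2 by rewrite exprn_ge0. have M3 : 0 <= M ^+ 3 by rewrite exprn_ge0.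
exists (D * W) => [|z w Zz Zw]; first by rewrite mulr_ge0 // /D; lra.
have [rz zM] := ZM z Zz; have [rw wM] := ZM w Zw.
have dd : forall h, cabs (hdot h g) <= hnorm h * hnorm g by move=> h; exact: hdot_CS.
have [[Mz az] _] := resolvent_funP rz; have [[Mw aw] _] := resolvent_funP rw.
have n2 x y h : (forall h, hnorm (Rf x h) <= M * hnorm h) -> (forall h, hnorm (Rf y h) <= M * hnorm h) ->
    hnorm (Rf x (Rf y h)) <= M ^+ 2 * hnorm h.
  move=> hx hy; apply: le_trans (hx _) _; rewrite expr2 -mulrA ler_wpM2l //.
have n3 x y v h : (forall h, hnorm (Rf x h) <= M * hnorm h) -> (forall h, hnorm (Rf y h) <= M * hnorm h) ->
    (forall h, hnorm (Rf v h) <= M * hnorm h) -> hnorm (Rf x (Rf y (Rf v h))) <= M ^+ 3 * hnorm h.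
  move=> hx hy hv; apply: le_trans (hx _) _; rewrite exprS -mulrA ler_wpM2l //; exact: n2.
have fin h (c : R) : hnorm h <= c * hnorm f -> cabs (hdot h g) <= c * W.
  by move=> hc; apply: le_trans (dd h) _; rewrite /W mulrA ler_wpM2r ?hnorm_ge0.
have d0 := cabs_ge0 (w - z).
have MW : 0 <= M * W by rewrite mulr_ge0.
have M2W : 0 <= M ^+ 2 * W by rewrite mulr_ge0.
have M3W : 0 <= M ^+ 3 * W by rewrite mulr_ge0.
have DW : D * W = M * W + M ^+ 2 * W + 2 * (M ^+ 3 * W) by rewrite /D; ring.
have e1 : Rf w f - Rf z f = (w - z) *: Rf w (Rf z f) by exact: resolvent_identity.
split.
- by have := fin _ _ (zM f); lra.
- by have := fin _ _ (n2 z z f zM zM); lra.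
- rewrite -hdotBl e1 hdotZl cabsM mulrC ler_wpM2r //.
  by have := fin _ _ (n2 w z f wM zM); lra.
- have -> : hdot (Rf w (Rf w f)) g - hdot (Rf z (Rf z f)) g =
     (w - z) * (hdot (Rf w (Rf w (Rf z f))) g + hdot (Rf w (Rf z (Rf z f))) g).
    have -> : hdot (Rf w (Rf w f)) g - hdot (Rf z (Rf z f)) g =
       hdot (Rf w (Rf w f - Rf z f) + (Rf w (Rf z f) - Rf z (Rf z f))) g.
      by rewrite (blinB aw) addrA subrK hdotBl.
    by rewrite (resolvent_identity (Rf z f)) // e1 (blinZ aw) -scalerDr hdotZl hdotDl.
  rewrite cabsM mulrC ler_wpM2r //; apply: le_trans (cabsD _ _) _.
  by have := fin _ _ (n3 w w z f wM wM zM); have := fin _ _ (n3 w z z f wM zM zM); lra.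
- have -> : hdot (Rf w f) g - hdot (Rf z f) g - (w - z) * hdot (Rf z (Rf z f)) g =
     (w - z) ^+ 2 * hdot (Rf w (Rf z (Rf z f))) g.
    rewrite -hdotBl e1 hdotZl -mulrBr -hdotBl.
    by rewrite (resolvent_identity (Rf z f)) // hdotZl mulrA -expr2.
  rewrite cabsM cabsX mulrC ler_wpM2r ?sqr_ge0 //.
  by have := fin _ _ (n3 w z z f wM zM zM); lra.
Qed.

(** The partial sums of the Neumann series are Cauchy, because the increments
    halve at each step. *)
Lemma contraction_fixpoint (a : H -> H) f : blin a 2^-1 -> exists g, g = f + a g.
Proof.
move=> aM; pose s := fix s n := if n is n'.+1 then f + a (s n') else 0.
have step n : hnorm (s n.+1 - s n) <= 2^-1 ^+ n * hnorm f.
  elim: n => [|n ih]; first by rewrite /= (blin0 aM) addr0 subr0 expr0 mul1r.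
  have -> : s n.+2 - s n.+1 = a (s n.+1 - s n).
    by rewrite (blinB aM) /= opprD addrACA subrr add0r.
  apply: le_trans (blin_le aM _) _; rewrite exprS -mulrA ler_wpM2l // invr_ge0 //.
have far m n : (m <= n)%N -> hnorm (s n - s m) <= 2 * (2^-1 ^+ m - 2^-1 ^+ n) * hnorm f.
  elim: n => [|n ih]; first by rewrite leqn0 => /eqP ->; rewrite !subrr hnorm0 mulr0 mul0r.
  rewrite leq_eqVlt => /predU1P[->|]; first by rewrite !subrr hnorm0 mulr0 mul0r.
  rewrite ltnS => mn; apply: le_trans (hnorm_dist3 (s n) _ _) _.
  apply: le_trans (lerD (step n) (ih mn)) _.
  rewrite -mulrDl ler_wpM2r ?hnorm_ge0 // exprS; lra.
have sC : hcauchy s.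
  have key : forall e, 0 < e -> exists N, forall n, (N <= n)%N -> hnorm (s n - s N) < e.
    move=> e e0; have q0 : 0 < e / (2 * (hnorm f + 1)).
      by rewrite divr_gt0 // mulr_gt0 // ltr_wpDl // hnorm_ge0.
    have [N hN] := invS_small q0; exists N => n Nn; apply: le_lt_trans (far _ _ Nn) _.
    have pw k : 2^-1 ^+ k <= k.+1%:R^-1 :> R.
      rewrite exprVn lef_pV2 ?posrE ?exprn_gt0 ?ltr0n // -natrX ler_nat; exact: ltn_expl.
    have := hN N (leqnn N); rewrite ltr_pdivlMr ?mulr_gt0 ?ltr_wpDl ?hnorm_ge0 //.
    have := pw N; have : 0 <= 2^-1 ^+ n :> R by rewrite exprn_ge0 // invr_ge0.
    have : 0 <= 2^-1 ^+ N :> R by rewrite exprn_ge0 // invr_ge0.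
    have := hnorm_ge0 f; set x := hnorm f; set u := _ ^+ N; set v := _ ^+ n; set w := _^-1.
    by nra.
  move=> e e0; have e2 : 0 < e / 2 by rewrite divr_gt0.
  have [N hN] := key _ e2; exists N => m n Nm Nn.
  by have := hnorm_dist3 (s N) (s m) (s n); have := hN _ Nm; have := hN _ Nn;
    rewrite (hnorm_subC (s N)); lra.
have [g sg] := hcauchy_cvg sC; exists g.
have : hlim (fun n => s n.+1) g.
  by move=> e /sg[N hN]; exists N => n Nn; apply: hN; exact: leqW.
move/hlim_unique; apply => e /(blin_hlim aM sg)[N hN]; exists N => n Nn.
by rewrite /= opprD addrACA subrr add0r; exact: hN.
Qed.

Hypothesis Tlin : linear_oper T.
Hypothesis invT : bounded_oper (T^-1)%relation.

Lemma resolvent0 : resolvent_set T 0.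
Proof.
rewrite /resolvent_set /= (_ : resolvent T 0 = (T^-1)%relation) //.
by apply/seteqP; split=> -[f g]; rewrite /resolvent /= scale0r addr0.
Qed.

(** T - z = T (1 - z T^{-1}), so the resolvent of a point near 0 is a fixed
    point of a contraction. *)
Lemma resolvent_disc : exists2 e : R, 0 < e &
  forall z, cabs z <= e -> resolvent_set T z.
Proof.
have [[M aM] aE] := resolvent_funP resolvent0.
have M0 := blin_ge0 aM.
exists (2 * (M + 1))^-1; first by rewrite invr_gt0 mulr_gt0 // ltr_wpDl.
move=> z zle; pose a := Rf 0; have {}aM : blin a M by [].
have TE f g : T (g, f) <-> g = a f by rewrite -aE scale0r addr0.
have zM : cabs z * M <= 2^-1.
  have : cabs z * (2 * (M + 1)) <= 1.
    by rewrite -ler_pdivlMr ?mul1r // mulr_gt0 // ltr_wpDl.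
  by have := cabs_ge0 z; lra.
have za : blin (fun g => z *: a g) 2^-1.
  split => [|c u v|u]; first by rewrite invr_ge0.
    by rewrite (blin_lin aM) scalerDr !scalerA [z * c]mulrC.
  rewrite hnormZ; have := blin_le aM u; have := hnorm_ge0 u; have := cabs_ge0 z.
  rewrite -/a => z0 u0 au.
  have : cabs z * hnorm (a u) <= cabs z * (M * hnorm u) by rewrite ler_wpM2l.
  have : cabs z * M * hnorm u <= 2^-1 * hnorm u by rewrite ler_wpM2r.
  lra.
have ex f : exists g, g = a f + z *: a g by exact: contraction_fixpoint.
have [b hb] := choice ex.
have bnd f g : g = a f + z *: a g -> hnorm g <= 2 * M * hnorm f.
  move=> h; have : hnorm g <= hnorm (a f) + hnorm (z *: a g) by rewrite {1}h hnormD.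
  by have := blin_le za g; have := blin_le aM f; rewrite /= -/a; lra.
have rE f g : resolvent T z (f, g) <-> g = b f.
  have eqv : resolvent T z (f, g) <-> g = a f + z *: a g.
    by rewrite /resolvent /= TE (blinD aM) (blinZ aM).
  split=> [/eqv h|->]; last first.
    by rewrite /resolvent /= TE (blinD aM) (blinZ aM) -/a; exact: hb.
  apply/eqP; rewrite -subr_eq0; apply/eqP/hnorm_eq0/eqP; rewrite eq_le hnorm_ge0 andbT.
  have := bnd 0 (g - b f); rewrite hnorm0 mulr0; apply.
  rewrite (blin0 aM) add0r (blinB aM) scalerBr {1}h {1}(hb f) opprD addrACA.
  by rewrite subrr add0r.
have bM : blin b (2 * M).
  split => [|c u v|u]; first exact: mulr_ge0; last exact: bnd.
  apply/esym/rE; rewrite /resolvent /= TE (blinD aM) (blinD aM) !(blinZ aM) -/a.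
  rewrite (blinD aM) (blinZ aM) -/a {1}(hb u) {1}(hb v) !scalerDr !scalerA [c * z]mulrC.
  by rewrite addrACA.
rewrite /resolvent_set /= (_ : resolvent T z = graph b); first exact: bounded_oper_graph bM.
by apply/seteqP; split=> -[f g]; [move/rE|move=> h; apply/rE].
Qed.

(** The resolvent identity bounds the resolvent near a point by twice its norm
    there; compactness makes the bound uniform. *)
Lemma resolvent_compact_bound (x1 x2 t1 t2 : R) :
  (forall l, rect x1 x2 t1 t2 l -> resolvent_set T (cexp l)) ->
  exists2 M, 0 <= M & forall l f, rect x1 x2 t1 t2 l -> hnorm (Rf (cexp l) f) <= M * hnorm f.
Proof.
move=> hr.
have cpt : compact (`[x1, x2] `*` `[t1, t2] : set (R * R)).
  by apply: compact_setX; exact: segment_compact.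
have /compact_near_coveringP nc := cpt.
have [M [M0 hM]] : exists M, 0 <= M /\ forall p : R * R, (`[x1, x2] `*` `[t1, t2]) p ->
    forall f, hnorm (Rf (cexp (p.1 +i* p.2)) f) <= M * hnorm f; last first.
  by exists M => // -[x t] f [hx ht]; apply: (hM (x, t)); split; rewrite /= in_itv.
pose P (M : R) (p : R * R) := rect x1 x2 t1 t2 (p.1 +i* p.2) ->
  forall f, hnorm (Rf (cexp (p.1 +i* p.2)) f) <= M * hnorm f.
have : \forall M \near +oo, forall p : R * R, (`[x1, x2] `*` `[t1, t2]) p -> P M p.
  apply: (nc R (pinfty_nbhs R) P) => -[x t] [/= hx ht].
  rewrite in_itv /= in hx; rewrite in_itv /= in ht.
  have rxt : rect x1 x2 t1 t2 (x +i* t) by [].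
  have [[M aM] _] := resolvent_funP (hr _ rxt).
  have M0 := blin_ge0 aM.
  have [C C0 hC] := @C11_cexp R [set l | cabs l <= `|x| + `|t| + 2] _ (fun _ h => h).
  pose d := Num.min 1 ((4 * (C + 1) * (M + 1))^-1).
  have den : 0 < 4 * (C + 1) * (M + 1) by rewrite !mulr_gt0 // ltr_wpDl.
  have d0 : 0 < d by rewrite lt_min ltr01 invr_gt0.
  exists (ball ((x, t) : R * R) d, [set M' | 2 * M <= M']).
    split; first exact: nbhsx_ballx.
    by exists (2 * M); split; [exact: num_real|move=> y /= /ltW].
  move=> [[y s] M'] [/= [by1 bs] MM'] rys f.
  apply: le_trans (_ : _ <= 2 * M * hnorm f) _; last by rewrite ler_wpM2r ?hnorm_ge0.
  apply: resolvent_near; [exact: hr|exact: (hr _ rxt)|exact: blin_le aM|].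
  have [by1' bs'] : `|x - y| < d /\ `|t - s| < d by split.
  have dist : cabs ((y +i* s) - (x +i* t)) <= 2 * d.
    apply: le_trans (cabs_le_ReIm _) _; rewrite /= distrC [X in _ + X]distrC; lra.
  have dl1 : d <= 1 by rewrite ge_min lexx.
  have dl2 : d * (4 * (C + 1) * (M + 1)) <= 1.
    by rewrite -ler_pdivlMr ?mul1r // ge_min lexx orbT.
  have ax : cabs (x +i* t) <= `|x| + `|t| by exact: (cabs_le_ReIm (x +i* t)).
  have [||_ _ k _ _] := hC (x +i* t) (y +i* s); rewrite /=.
  - lra.
  - have := cabsD ((y +i* s) - (x +i* t)) (x +i* t); rewrite subrK; lra.
  have : cabs (cexp (y +i* s) - cexp (x +i* t)) <= 2 * C * d.
    by apply: le_trans k _; rewrite [2 * C]mulrC -mulrA ler_wpM2l.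
  move=> k2; apply: le_trans (_ : _ <= 2 * C * d * M) _; first by rewrite ler_wpM2r.
  have cd : 0 <= C * d by rewrite mulr_ge0 // ltW.
  have dM : 0 <= d * M by rewrite mulr_ge0 // ltW.
  by nra.
move=> [M [_ hM]]; exists (Num.max 0 (M + 1)); split; first by rewrite le_max lexx.
move=> [x t] pxt f; have [/= hx ht] := pxt; rewrite in_itv /= in hx; rewrite in_itv /= in ht.
by apply: (hM _ _ (x, t)) => //; rewrite lt_max ltrDl ltr01 orbT.
Qed.

End Resolvent.

(** * The resolvent of a sectorial operator off its sector *)

Section SectorBound.
Variable R : realType.

(** The principal argument is known up to its sign by the arc cosine. *)
Lemma cabs_acos (z : R[i]) : z != 0 ->
  `|carg z| = acos (complex.Re z / cabs z) /\ -1 <= complex.Re z / cabs z <= 1.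
Proof.
move=> z0; have c0 := cabs_gt0 z0.
have b : -1 <= complex.Re z / cabs z <= 1.
  rewrite ler_pdivrMr // ler_pdivlMr // mul1r mulN1r.
  by have := Re_le_cabs z; rewrite ler_norml.
split => //; rewrite /carg -/(cabs z).
have h := acos_ge0 b.
by case: ifP => _; rewrite ?normrN ger0_norm.
Qed.

(** The description of the sector by the cosine of the argument is a closed
    condition, which makes the closure accessible. *)
Lemma sector_closure (v w : R) z : 0 <= v <= w -> w <= pi ->
  closure (sector v) z -> cos w * cabs z <= complex.Re z.
Proof.
move=> /andP[v0 vw] wpi zcl.
have inS u : sector v u -> cos w * cabs u <= complex.Re u.
  have cw := cos_le1 w; rewrite /sector; case: eqP => [_ /=|_ [/= u0]].
    move=> u0; have [-> Re0] := complex_gt0 u0.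
    by rewrite cabsR gtr0_norm //= ger_pMl.
  have [-> /[dup] b /andP[b1 b2]] := cabs_acos u0; move=> h; rewrite -ler_pdivlMr ?cabs_gt0 //.
  rewrite -[leRHS]acosK ?in_itv //=.
  have w0 := le_trans v0 vw.
  by rewrite leNgt ltr_cos ?in_itv /= ?acos_ge0 ?acos_lepi ?w0 ?wpi // -leNgt (le_trans (ltW h)).
rewrite leNgt; apply/negP => d.
pose e := (cos w * cabs z - complex.Re z) / 2.
have e0 : 0 < e by rewrite divr_gt0 // subr_gt0.
have [u [/inS hu /=]] := zcl _ (nbhsx_ballx z e%:C (eqbRL (ltcR _ _) e0)).
rewrite -ball_normE /= (_ : `|z - u| = (cabs (z - u))%:C) ?cabsE // ltcR => zu.
have h1 := Re_le_cabs (z - u); rewrite ReD ReN in h1.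
have h2 := cabs_dist z u.
have h3 : `|cos w| <= 1 by rewrite ler_norml cos_geN1 cos_le1.
have h4 : cos w * cabs z - cos w * cabs u <= cabs (z - u).
  rewrite -mulrBr; apply: le_trans (ler_norm _) _; rewrite normrM.
  rewrite -[leRHS]mul1r ler_pM //.
move: h1; rewrite ler_norml /e in zu * => /andP[h5 h6]; lra.
Qed.

Variables (H : hilbertType R) (T : oper H H).
Notation Rf := (resolvent_fun T).

(** The part of the strip of logarithms that lies on the outer side of the
    keyhole contour of angle phi and radius eps, the contour included. *)
Definition keyhole_side (phi eps : R) : set R[i] :=
  [set l | `|complex.Im l| <= pi /\ (phi <= `|complex.Im l| \/ complex.Re l <= ln eps)].

(** Sectoriality bounds z times the resolvent outside of any larger sector;
    the angle between w and phi leaves room for one. *)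
Lemma sector_resolvent (phi eps : R) : admissible_keyhole T phi eps ->
  exists2 M, 0 <= M & forall l, phi <= `|complex.Im l| <= pi ->
    resolvent_set T (cexp l) /\
    forall f, hnorm (Rf (cexp l) f) <= M * expR (- complex.Re l) * hnorm f.
Proof.
move=> [[w [/andP[w0 wpi] sp bnd] /andP[wphi phipi]] e0 _].
(* An angle strictly between those of the sector and of the contour. *)
pose w' := (w + phi) / 2.
have ww' : w < w' by rewrite /w' ltr_pdivlMr //; lra.
have w'phi : w' < phi by rewrite /w' ltr_pdivrMr //; lra.
have w'pi := lt_trans w'phi phipi.
have out v l : w <= v -> v <= w' -> phi <= `|complex.Im l| <= pi -> ~ closure (sector v) (cexp l).
  move=> wv vw' /andP[l1 l2] h.
  have h2 : 0 <= v <= w' by rewrite vw' (le_trans w0).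
  have := sector_closure h2 (ltW w'pi) h.
  rewrite cabs_cexp Re_cexp mulrC ler_pM2l ?expR_gt0 //; apply/negP; rewrite -ltNge.
  have -> : cos (complex.Im l) = cos `|complex.Im l|.
    by case: (ger0P (complex.Im l)) => // _; rewrite cosN.
  rewrite ltr_cos ?in_itv /= ?normr_ge0 ?l2 ?(le_trans w0) ?(ltW ww') ?(ltW w'pi) //.
  exact: lt_le_trans l1.
have := bnd w'; rewrite ww' w'pi => /(_ isT); set s := ereal_sup _ => soo.
have [M [M0 sM]] : exists M, 0 <= M /\ (s <= M%:E)%E.
  case: s soo => [r _|h|_]; [|by rewrite ltxx in h|by exists 0; rewrite leNye].
  by exists (Num.max 0 r); rewrite le_max lexx lee_fin le_max lexx orbT.
exists M => // l hl.
have rl : resolvent_set T (cexp l).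
  by apply: contrapT => nl; exact: (out w l (lexx _) (ltW ww') hl (sp _ nl)).
split => // f; have [[N aN] aE] := resolvent_funP rl.
have lin : linear_oper (scale_oper (cexp l) (resolvent T (cexp l))).
  have [[rl0 rl1 rl2] _ _] := rl; split.
  - by exists 0; rewrite ?scaler0.
  - move=> c [u1 u2] [v1 v2] [g /= ug ->] [h /= vh ->]; exists (c *: g + h) => /=.
      exact: (rl1 c (u1, g) (v1, h)).
    by rewrite scalerDr !scalerA [c * _]mulrC.
  - by move=> u v1 v2 [g /= ug ->] [h /= vh ->]; rewrite (rl2 u g h).
have mem : scale_oper (cexp l) (resolvent T (cexp l)) (f, cexp l *: Rf (cexp l) f).
  by exists (Rf (cexp l) f) => //=; exact/aE.
have := opnorm_le lin mem (le_trans _ sM) M0; rewrite /= hnormZ cabs_cexp => h.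
rewrite mulrAC expRN ler_pdivlMr ?expR_gt0 // mulrC; apply: h.
by apply: ereal_sup_ubound; exists (cexp l) => //; exact: (out w' l (ltW ww') (lexx _) hl).
Qed.

(** Outside of the sector this is sectoriality; the rest of the region, cut at
    x1, is compact. *)
Lemma keyhole_side_resolvent (phi eps x1 : R) : admissible_keyhole T phi eps ->
  exists2 M, 0 <= M & forall l, keyhole_side phi eps l -> x1 <= complex.Re l ->
    resolvent_set T (cexp l) /\
    forall f, hnorm (Rf (cexp l) f) <= M * expR (- complex.Re l) * hnorm f.
Proof.
move=> ad; have [M M0 hM] := sector_resolvent ad; have [_ e0 hd] := ad.
have rd l : complex.Re l <= ln eps -> resolvent_set T (cexp l).
  move=> l1; apply: hd; rewrite cabsE cabs_cexp lecR.
  by rewrite -[leRHS]lnK // ler_expR.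
have [|N N0 hN] := @resolvent_compact_bound R H T x1 (ln eps) (- pi) pi.
  by move=> l [/andP[_ l1] _]; exact: rd.
exists (Num.max M (N * expR (ln eps))); first by rewrite le_max M0.
move=> l [l1 l2] xl; have [Re_le|Re_gt] := leP (complex.Re l) (ln eps).
  split => [|f]; first exact: rd.
  apply: le_trans (hN l f _) _; first by split; rewrite ?xl // -ler_norml.
  rewrite ler_wpM2r ?hnorm_ge0 //.
  apply: le_trans (_ : N * expR (ln eps) * expR (- complex.Re l) <= _).
    by rewrite -mulrA -expRD ler_peMr // -expR0 ler_expR subr_ge0.
  by rewrite ler_wpM2r ?expR_ge0 // le_max lexx orbT.
have [|rl h] := hM l; first by case: l2 => [->//|]; rewrite leNgt Re_gt.
split => // f; apply: le_trans (h f) _.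
by rewrite ler_wpM2r ?hnorm_ge0 // ler_wpM2r ?expR_ge0 // le_max lexx.
Qed.

Lemma C11_log_resolvent (phi eps x1 x2 : R) f g : admissible_keyhole T phi eps ->
  exists F', C11 [set l | keyhole_side phi eps l /\ x1 <= complex.Re l <= x2]
    (fun l => hdot (Rf (cexp l) f) g) F'.
Proof.
move=> ad; have [M M0 hM] := keyhole_side_resolvent x1 ad.
set Z := [set l | _].
have B l : Z l -> cabs l <= `|x1| + `|x2| + pi.
  move=> [[l1 _] /andP[r1 r2]]; apply: le_trans (cabs_le_ReIm l) _.
  rewrite lerD // ler_norml; have := ler_norm x2; have := normr_ge0 x1; have := normr_ge0 x2.
  by have := ler_norm (- x1); rewrite normrN; lra.
eexists; apply: (@C11_comp _ _ [set z | exists2 l, Z l & z = cexp l]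
  (fun z => hdot (Rf z f) g) _ (@cexp R) (@cexp R)).
- by move=> l Zl; exists l.
- apply: (@C11_resolvent _ _ _ _ (M * expR (- x1))); first by rewrite mulr_ge0 ?expR_ge0.
  move=> _ [l [l1 /andP[l2 l3]] ->]; have [rl h] := hM l l1 l2; split => // u.
  apply: le_trans (h u) _; rewrite ler_wpM2r ?hnorm_ge0 // ler_wpM2l // ler_expR lerN2 //.
- exact: C11_cexp B.
Qed.

End SectorBound.

(** * Weights of contour integrals *)

Section Weights.
Variable R : realType.
Implicit Types (a C : R) (w : R[i] -> R[i]) (z l : R[i]).

(** A weight grows at most like exp ((1 - a) Re l) on the strip of logarithms:
    against the resolvent, which decays like exp (- Re l), it leaves a decay
    of order a. *)
Definition weight (x1 a C : R) w : Prop :=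
  [/\ 0 <= C,
      forall l, x1 <= complex.Re l -> `|complex.Im l| <= pi ->
        cabs (w l) <= C * expR ((1 - a) * complex.Re l) &
      forall x2, exists w', C11 (rect x1 x2 (- pi) pi) w w'].

Lemma rect_bounded (x1 x2 t1 t2 : R) l : rect x1 x2 t1 t2 l ->
  cabs l <= `|x1| + `|x2| + (`|t1| + `|t2|).
Proof.
have key (x y s : R) : x <= s <= y -> `|s| <= `|x| + `|y|.
  move=> /andP[xs sy]; rewrite ler_norml; have := ler_norm y; have := normr_ge0 x; have := normr_ge0 y.
  by have := ler_norm (- x); rewrite normrN; lra.
by move=> [hx ht]; apply: le_trans (cabs_le_ReIm l) (lerD (key _ _ _ hx) (key _ _ _ ht)).
Qed.

(** In logarithmic coordinates the form zeta^(-z) d zeta is exp ((1 - z) l) d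
    l. *)
Definition power_weight z l : R[i] := cexp ((1 - z) * l).

Lemma C11_cexp_lin z (x1 x2 t1 t2 : R) : 
  C11 (rect x1 x2 t1 t2) (fun l => cexp (z * l)) (fun l => cexp (z * l) * z).
Proof.
pose B := `|x1| + `|x2| + (`|t1| + `|t2|).
apply: (@C11_comp _ _ [set u | cabs u <= cabs z * B] _ _ (fun l => z * l) (fun=> z)).
- by move=> l /rect_bounded hl; rewrite /= cabsM ler_wpM2l // cabs_ge0.
- exact: (@C11_cexp _ _ (cabs z * B)).
- exact: C11_lin (@rect_bounded x1 x2 t1 t2).
Qed.

Lemma cexp_lin_le z l : `|complex.Im l| <= pi ->
  cabs (cexp (z * l)) <= expR (pi * `|complex.Im z|) * expR (complex.Re z * complex.Re l).
Proof.
move=> l1; rewrite cabs_cexp -expRD ler_expR ReM addrC lerD2r.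
apply: le_trans (ler_norm _) _; rewrite normrN normrM mulrC ler_wpM2r //.
Qed.

Lemma power_weightP x1 z :
  weight x1 (complex.Re z) (expR (pi * `|complex.Im z|)) (power_weight z).
Proof.
split; first exact: expR_ge0.
  move=> l _ l1; apply: le_trans (cexp_lin_le (1 - z) l1) _.
  by rewrite ReD ReN ImD ImN /= sub0r normrN.
by move=> x2; eexists; exact: C11_cexp_lin.
Qed.

End Weights.

(** * Operators defined by contour integrals *)

Section ContourOperators.
Variables (R : realType) (H : hilbertType R) (T : oper H H).
Implicit Types (a C phi eps : R) (w : R[i] -> R[i]) (z l : R[i]) (f g : H).
Notation Rf := (resolvent_fun T).

Definition weighted w f g l : R[i] := w l * hdot (Rf (cexp l) f) g.

Lemma C11_weighted phi eps x1 x2 a C w f g : admissible_keyhole T phi eps ->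
  weight x1 a C w ->
  exists K', C11 [set l | keyhole_side phi eps l /\ x1 <= complex.Re l <= x2] (weighted w f g) K'.
Proof.
move=> ad [_ _ /(_ x2)[w' hw]]; have [F' hF] := C11_log_resolvent x1 x2 f g ad.
eexists; apply: C11_mul hF; apply: C11_sub hw.
by move=> l [[l1 _] l2]; split => //; rewrite -ler_norml.
Qed.

Lemma weighted_le phi eps x1 : admissible_keyhole T phi eps ->
  exists2 M, 0 <= M & forall a C w f g l, weight x1 a C w -> keyhole_side phi eps l ->
    x1 <= complex.Re l ->
    cabs (weighted w f g l) <= C * (M * (hnorm f * hnorm g)) * expR (- a * complex.Re l).
Proof.
move=> ad; have [M M0 hM] := keyhole_side_resolvent x1 ad; exists M => //.
move=> a C w f g l [C0 wC _] hl xl; have [_ h] := hM l hl xl; have [l1 _] := hl.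
rewrite /weighted cabsM.
have h1 := le_trans (hdot_CS (Rf (cexp l) f) g) (ler_wpM2r (hnorm_ge0 g) (h f)).
apply: le_trans (ler_pM (cabs_ge0 _) (cabs_ge0 _) (wC l xl l1) h1) _.
rewrite (_ : - a * _ = (1 - a) * complex.Re l + - complex.Re l); last by ring.
by rewrite expRD le_eqVlt; apply/orP; left; apply/eqP; ring.
Qed.

Lemma keyhole_angle phi eps : admissible_keyhole T phi eps -> 0 < phi < pi.
Proof. by move=> [[w [/andP[w0 _] _ _] /andP[wphi ->]] _ _]; rewrite (le_lt_trans w0). Qed.

Lemma log_keyhole_side phi eps l : 0 < phi < pi -> log_keyhole phi eps l ->
  keyhole_side phi eps l /\ ln eps <= complex.Re l.
Proof.
move=> /andP[p0 ppi] [[l1 l2]|[l1 /[!(=^~ ler_norml)] l2]].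
  have e : `|complex.Im l| = phi by case: l2 => ->; rewrite ?normrN gtr0_norm.
  by split => //; split; rewrite ?e ?(ltW ppi) //; left.
by split; rewrite ?l1 //; split; [exact: le_trans (ltW ppi)|right; rewrite l1].
Qed.

Lemma weighted_kgood phi eps : admissible_keyhole T phi eps ->
  exists2 M, 0 <= M & forall a C w f g, weight (ln eps) a C w ->
    kgood phi eps a (C * (M * (hnorm f * hnorm g))) (weighted w f g).
Proof.
move=> ad; have [M M0 hM] := weighted_le (ln eps) ad; exists M => // a C w f g hw.
have hp := keyhole_angle ad.
split.
- by rewrite !mulr_ge0 ?hnorm_ge0 //; case: hw.
- by move=> l /(log_keyhole_side hp)[h1 h2]; exact: hM.
- move=> B; have [K' [L L0 hL]] := C11_weighted B f g ad hw.
  exists L => // l m /(log_keyhole_side hp)[h1 h2] /(log_keyhole_side hp)[h3 h4] h5 h6.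
  by have [] // := hL l m; split; rewrite ?h2 ?h4.
Qed.

Definition contour_const : R[i] := (2 * pi%:C * 'i%C)^-1.

Lemma contour_const_le : cabs contour_const <= 1.
Proof.
rewrite /contour_const cabsV !cabsM cabs_i mulr1 cabsR (_ : 2 = 2%:R%:C); last by rewrite rmorph_nat.
have pi2 : 2 <= pi :> R by exact: pi_ge2.
by rewrite cabsR ger0_norm // ger0_norm ?pi_ge0 // invf_le1; lra.
Qed.

(** The operator (2 pi i)^{-1} times the integral of w (log zeta) / zeta
    against the resolvent (T - zeta)^{-1}, in the weak sense. *)
Definition contour_op phi eps w (A : H -> H) : Prop :=
  forall f g, hdot (A f) g = contour_const * KI phi eps (weighted w f g).

(** The sesquilinear form given by the contour integral is bounded, hence
    represented by an operator. *)
Lemma contour_op_exists phi eps : admissible_keyhole T phi eps ->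
  exists2 M, 0 <= M & forall a C w, 0 < a -> weight (ln eps) a C w ->
    exists A, blin A (C * M * keyhole_const phi eps a) /\ contour_op phi eps w A.
Proof.
move=> ad; have [M M0 hM] := weighted_kgood ad; exists M => // a C w a0 hw.
have /andP[p0 ppi] := keyhole_angle ad; have [_ e0 _] := ad.
pose L f g := contour_const * KI phi eps (weighted w f g).
have ki f g := kgood_int e0 a0 (hM _ _ _ f g hw).
set N := C * M * _.
have LM f g : cabs (L f g) <= N * hnorm f * hnorm g.
  rewrite cabsM -[leRHS]mul1r ler_pM ?cabs_ge0 ?contour_const_le //.
  apply: le_trans (KI_le (ltW p0) e0 a0 (hM _ _ _ f g hw)) _.
  by rewrite le_eqVlt; apply/orP; left; apply/eqP; rewrite /N; ring.
have Lr f c u v : L f (c *: u + v) = cj c * L f u + L f v.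
  rewrite /L (eq_KI (K2 := fun l => cj c * weighted w f u l + weighted w f v l)) //; last first.
    by move=> l _; rewrite /weighted hdotDr hdotZr; ring.
  by rewrite KID ?KIZ //; [ring|exact: kintZ].
have Ll c u v g : L (c *: u + v) g = c * L u g + L v g.
  rewrite /L (eq_KI (K2 := fun l => c * weighted w u g l + weighted w v g l)) //; last first.
    move=> l /(log_keyhole_side (keyhole_angle ad))[hl xl]; rewrite /weighted.
    have [N' _ hN] := keyhole_side_resolvent (ln eps) ad.
    have [rl _] := hN l hl xl; have [[B aB] _] := resolvent_funP rl.
    by rewrite (blin_lin aB) hdotDl hdotZl; ring.
  by rewrite KID ?KIZ //; [ring|exact: kintZ].
have /choice[A hA] : forall f, exists q, forall g, hdot q g = L f g.
  move=> f; have [||q hq] := @riesz _ H (fun g => cj (L f g)) (N * hnorm f).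
  - by move=> c u v; rewrite Lr cjD cjM cjK.
  - by move=> u; rewrite cabsJ.
  - by exists q => g; rewrite hdotC -hq cjK.
have kc : 0 <= keyhole_const phi eps a.
  by rewrite addr_ge0 // mulr_ge0 ?divr_ge0 ?mulr_ge0 ?expR_ge0 // ltW.
have N0 : 0 <= N by rewrite !mulr_ge0 //; case: hw.
exists A; split=> //; split => // [c u v|u].
  by apply: hdot_inj => g; rewrite hdotDl hdotZl !hA Ll.
by apply: hnorm_sup => [|g]; rewrite ?hA // mulr_ge0 ?hnorm_ge0.
Qed.

End ContourOperators.

(** * Independence of the contour *)

Section NegativePowers.
Variables (R : realType) (H : hilbertType R) (T : oper H H).
Implicit Types (a C phi eps : R) (w : R[i] -> R[i]) (z l : R[i]) (f g : H).
Notation Rf := (resolvent_fun T).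

Lemma weight_sub x1 x2 a C w : x1 <= x2 -> weight x1 a C w -> weight x2 a C w.
Proof.
move=> x12 [C0 h1 h2]; split => // [l xl|x]; first exact: h1 (le_trans x12 xl).
by have [w' hw] := h2 x; exists w'; apply: C11_sub hw => l [/andP[u1 u2] u3]; split; rewrite // (le_trans x12).
Qed.

(** The radius is diminished first, then the angle is enlarged: the integrand
    is analytic in the regions swept. *)
Lemma KI_shrink phi phi' eps eps' a C w f g :
  admissible_keyhole T phi eps -> admissible_keyhole T phi' eps' ->
  phi <= phi' -> eps' <= eps -> 0 < a -> weight (ln eps') a C w ->
  KI phi eps (weighted T w f g) = KI phi' eps' (weighted T w f g).
Proof.
move=> ad ad' pp ee a0 hw; set K := weighted T w f g.
have [ang e0 disc] := ad; have [_ e0' _] := ad'.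
have /andP[p0 ppi] := keyhole_angle ad; have /andP[p0' ppi'] := keyhole_angle ad'.
have le : ln eps' <= ln eps by rewrite ler_ln ?posrE.
have ad2 : admissible_keyhole T phi eps'.
  by split => // z hz; apply: disc; apply: le_trans hz _; rewrite lecR.
have [M M0 kg] := weighted_kgood ad2.
have [N N0 wl] := weighted_le (ln eps') ad2.
have ki := kgood_int e0' a0 (kg _ _ _ f g hw).
have [K1 hK1] := C11_weighted (ln eps) f g ad hw.
rewrite -(@KI_radius _ phi eps eps' K K1) ?(ltW p0) //; last first.
  apply: C11_sub hK1 => l [/andP[l1 l2]]; rewrite -ler_norml => l3; split; last by rewrite l1.
  by split; [exact: le_trans (ltW ppi)|right].
have sub t1 t2 : (phi <= t1 /\ t2 <= phi') \/ (- phi' <= t1 /\ t2 <= - phi) ->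
    forall l, t1 <= complex.Im l <= t2 -> keyhole_side phi eps' l.
  move=> ht l /andP[l2 l3].
  have : phi <= `|complex.Im l| <= phi'.
    by case: ht => -[h1 h2]; [rewrite ger0_norm|rewrite ler0_norm]; lra.
  by move=> /andP[h1 h2]; split; [rewrite (le_trans h2) ?ltW|left].
have hC t1 t2 : (phi <= t1 /\ t2 <= phi') \/ (- phi' <= t1 /\ t2 <= - phi) ->
    forall B, exists K', C11 (rect (ln eps') (ln B) t1 t2) K K'.
  move=> ht B; have [K' hK'] := C11_weighted (ln B) f g ad2 hw; exists K'.
  by apply: C11_sub hK' => l [l1 l2]; split => //; exact: sub l2.
have [K' [L L0 hL]] := C11_weighted (ln eps') f g ad hw.
have c1 : (phi <= phi /\ phi' <= phi') \/ (- phi' <= phi /\ phi' <= - phi) by left.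
have c2 : (phi <= - phi' /\ - phi <= phi') \/ (- phi' <= - phi' /\ - phi <= - phi) by right.
have C0 : 0 <= C by case: hw.
apply: (@KI_angle _ phi phi' eps' K a (C * (N * (hnorm f * hnorm g))) L) => //.
- exact: ltW.
- by rewrite !mulr_ge0 ?hnorm_ge0.
- exact: hC.
- exact: hC.
- by move=> l l1 l2; apply: wl => //; exact: sub l2.
- by move=> l l1 l2; apply: wl => //; exact: sub l2.
- apply: lip_arcK => // s t; rewrite -!ler_norml => hs ht.
  have arc u : `|u| <= phi' -> keyhole_side phi eps (ln eps' +i* u).
    by move=> hu; split; [exact: le_trans (ltW ppi')|right].
  by have [] // := hL (ln eps' +i* s) (ln eps' +i* t); split; rewrite ?lexx //; exact: arc.
Qed.

(** Both contours are compared with the one of larger angle and smaller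
    radius, which lies on the outer side of each. *)
Lemma KI_contour phi phi' eps eps' x1 a C w f g :
  admissible_keyhole T phi eps -> admissible_keyhole T phi' eps' ->
  x1 <= ln eps -> x1 <= ln eps' -> 0 < a -> weight x1 a C w ->
  KI phi eps (weighted T w f g) = KI phi' eps' (weighted T w f g).
Proof.
wlog pp : phi phi' eps eps' / phi <= phi'.
  move=> h ad ad' h1 h2 a0 hw; have [pp|/ltW pp] := leP phi phi'; first exact: h.
  by apply/esym; exact: h.
move=> ad ad' h1 h2 a0 hw; have [_ e0 d] := ad; have [ang' e0' d'] := ad'.
pose e2 := Num.min eps eps'.
have e20 : 0 < e2 by rewrite lt_min e0.
have le1 : e2 <= eps by rewrite ge_min lexx.
have le2 : e2 <= eps' by rewrite ge_min lexx orbT.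
have ad2 : admissible_keyhole T phi' e2.
  by split => // z hz; apply: d; apply: le_trans hz _; rewrite lecR.
have hw2 : weight (ln e2) a C w.
  by apply: weight_sub hw; rewrite /e2 minEle; case: ifP.
by rewrite (KI_shrink f g ad ad2 pp le1 a0 hw2) (KI_shrink f g ad' ad2 (lexx _) le2 a0 hw2).
Qed.

(** The change of variables zeta = exp l, piece by piece. *)
Lemma keyhole_integral_log phi eps z f g : 0 < phi < pi -> 0 < eps ->
  let G zeta := cpow zeta (- z) * hdot (Rf zeta f) g in
  let K := weighted T (power_weight z) f g in
  kint phi eps K ->
  keyhole_integrable phi eps G /\ keyhole_integral phi eps G = KI phi eps K.
Proof.
move=> /andP[p0 ppi] e0 G K [i1 i2 i3].
have GK l : `|complex.Im l| < pi -> G (cexp l) * cexp l = K l.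
  move=> h; rewrite /G /K /weighted /power_weight cpow_cexp // mulrAC -cexpD.
  by congr (cexp _ * _); ring.
have ray t r : `|t| < pi -> eps <= r -> rayK K t r = ray_integrand t G r.
  move=> ht er; have r0 := lt_le_trans e0 er.
  rewrite /rayK -GK //= cexp_polar // /ray_integrand; set u := G _.
  have rr : r%:C * (r^-1)%:C = 1 :> R[i] by rewrite -rmorphM divff ?gt_eqF.
  by rewrite (mulrC r%:C) -!mulrA rr mulr1.
have arc t : - phi <= t <= phi -> 'i%C * K (ln eps +i* t) = arc_integrand eps G t.
  move=> ht; rewrite -GK /=; last by rewrite (le_lt_trans _ ppi) // ler_norml.
  by rewrite cexp_polar // /arc_integrand mulrCA.
have np : `|- phi| < pi by rewrite normrN gtr0_norm.
have pp : `|phi| < pi by rewrite gtr0_norm.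
have m1 : measurable (`[eps, +oo[ : set (measurableTypeR R)) by exact: measurable_itv.
have e1 r : `[eps, +oo[%classic r -> rayK K (- phi) r = ray_integrand (- phi) G r.
  by rewrite /= in_itv /= andbT; exact: ray.
have e3 r : `[eps, +oo[%classic r -> rayK K phi r = ray_integrand phi G r.
  by rewrite /= in_itv /= andbT; exact: ray.
have e2 t : `[- phi, phi]%classic t -> 'i%C * K (ln eps +i* t) = arc_integrand eps G t.
  by rewrite /= in_itv /=; exact: arc.
split; first split.
- exact: eq_cintegrable e1 i1.
- by apply: eq_cintegrable e2 _ => //; exact: cintegrableZ.
- exact: eq_cintegrable e3 i3.
- rewrite /keyhole_integral /KI (eq_cintegral e1) (eq_cintegral e3) -(eq_cintegral e2).
  by rewrite cintegralZ.
Qed.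

(** The definition leaves the contour to depend on z; analyticity in z becomes
    visible once a single contour represents all the powers. *)
Lemma neg_power_spec phi eps z : admissible_keyhole T phi eps -> 0 < complex.Re z ->
  contour_op T phi eps (power_weight z) (neg_power_fun T z).
Proof.
move=> ad z0; have hw x1 := power_weightP x1 z.
have kk phi' eps' f g : admissible_keyhole T phi' eps' ->
    kint phi' eps' (weighted T (power_weight z) f g).
  move=> ad'; have [M M0 hM] := weighted_kgood ad'; have [_ e0' _] := ad'.
  exact: (kgood_int e0' z0 (hM _ _ _ f g (hw _))).
have conv phi' eps' f g (ad' : admissible_keyhole T phi' eps') :
    let G zeta := cpow zeta (- z) * hdot (Rf zeta f) g in
    keyhole_integrable phi' eps' G /\
    keyhole_integral phi' eps' G = KI phi' eps' (weighted T (power_weight z) f g).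
  have [_ e0' _] := ad'; exact: (keyhole_integral_log (keyhole_angle ad') e0' (kk _ _ f g ad')).
have [M M0 hM] := contour_op_exists ad.
have [A [_ hA]] := hM _ _ _ z0 (hw _).
have ex : is_neg_power T z A.
  exists phi, eps; split => // f g; have [i1 i2] := conv phi eps f g ad.
  by split => //; rewrite i2; exact: hA.
have : is_neg_power T z (neg_power_fun T z) by apply: (@xgetPex _ (fun=> 0) [set A | is_neg_power T z A]); exists A.
move=> [phi' [eps' [ad' h]]] f g; have [_ ->] := h f g; have [_ ->] := conv phi' eps' f g ad'.
congr (_ * _).
apply: (@KI_contour phi' phi eps' eps (Num.min (ln eps) (ln eps')) _ _ _ f g ad' ad _ _ z0 (hw _)).
- by rewrite ge_min lexx orbT.
- by rewrite ge_min lexx.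
Qed.

End NegativePowers.

(** * Dependence of the weights on the exponent *)

Section WeightAlgebra.
Variable R : realType.
Implicit Types (a C : R) (w v : R[i] -> R[i]) (z l h : R[i]).

Lemma C11_comb Z c (F F' G G' : R[i] -> R[i]) : C11 Z F F' -> C11 Z G G' ->
  C11 Z (fun l => c * F l + G l) (fun l => c * F' l + G' l).
Proof.
move=> [C C0 hF] [D D0 hG]; exists (cabs c * C + D); first by rewrite addr_ge0 // mulr_ge0 // cabs_ge0.
have c0 := cabs_ge0 c.
have cb (x y : R[i]) A B : cabs x <= A -> cabs y <= B -> cabs (c * x + y) <= cabs c * A + B.
  by move=> hx hy; apply: le_trans (cabsD _ _) _; rewrite cabsM lerD // ler_wpM2l.
move=> z w Zz Zw; have [a1 a2 a3 a4 a5] := hF z w Zz Zw; have [b1 b2 b3 b4 b5] := hG z w Zz Zw.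
split; first exact: cb.
- exact: cb.
- rewrite (_ : _ - _ = c * (F w - F z) + (G w - G z)); last by ring.
  by apply: le_trans (cb _ _ _ _ a3 b3) _; rewrite mulrDl mulrA.
- rewrite (_ : _ - _ = c * (F' w - F' z) + (G' w - G' z)); last by ring.
  by apply: le_trans (cb _ _ _ _ a4 b4) _; rewrite mulrDl mulrA.
- rewrite (_ : _ - _ = c * (F w - F z - (w - z) * F' z) + (G w - G z - (w - z) * G' z)); last by ring.
  by apply: le_trans (cb _ _ _ _ a5 b5) _; rewrite mulrDl mulrA.
Qed.

Lemma C11_eq Z (F F' G : R[i] -> R[i]) : (forall l, F l = G l) -> C11 Z F F' -> C11 Z G F'.
Proof. by move=> /funext ->. Qed.

(** The Taylor coefficients of the power weight as a function of the exponent. *)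
Definition power_weight1 z l : R[i] := - l * power_weight z l.
Definition power_weight2 z l : R[i] := 2^-1 * l ^+ 2 * power_weight z l.
Definition power_weight_rem z h l : R[i] :=
  power_weight (z + h) l - power_weight z l - h * power_weight1 z l - h ^+ 2 * power_weight2 z l.

Lemma power_weight_remE z h l : power_weight_rem z h l =
  power_weight z l * (cexp (- h * l) - 1 - (- h * l) - 2^-1 * (- h * l) ^+ 2).
Proof.
rewrite /power_weight_rem /power_weight1 /power_weight2.
have -> : power_weight (z + h) l = power_weight z l * cexp (- h * l).
  by rewrite /power_weight -cexpD; congr (cexp _); ring.
by field.
Qed.

Lemma power_weight1_C11 z (x1 x2 t1 t2 : R) : exists w', C11 (rect x1 x2 t1 t2) (power_weight1 z) w'.
Proof.
eexists; apply: (C11_eq (F := fun l => (- 1) * l * cexp ((1 - z) * l))).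
  by move=> l; rewrite mulN1r.
exact: C11_mul (C11_lin (-1) (@rect_bounded _ x1 x2 t1 t2)) (C11_cexp_lin (1 - z) x1 x2 t1 t2).
Qed.

Lemma power_weight2_C11 z (x1 x2 t1 t2 : R) : exists w', C11 (rect x1 x2 t1 t2) (power_weight2 z) w'.
Proof.
have [w' hw] := power_weight1_C11 z x1 x2 t1 t2.
eexists; apply: (C11_eq (F := fun l => (- 2^-1) * l * power_weight1 z l)).
  by move=> l; rewrite /power_weight1 /power_weight2; ring.
exact: C11_mul (C11_lin (- 2^-1) (@rect_bounded _ x1 x2 t1 t2)) hw.
Qed.

Lemma power_weight_rem_C11 z h (x1 x2 t1 t2 : R) :
  exists w', C11 (rect x1 x2 t1 t2) (power_weight_rem z h) w'.
Proof.
have [w1 h1] := power_weight1_C11 z x1 x2 t1 t2; have [w2 h2] := power_weight2_C11 z x1 x2 t1 t2.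
have p u := C11_cexp_lin (1 - u) x1 x2 t1 t2.
eexists; apply: (C11_eq (F := fun l => (- h ^+ 2) * power_weight2 z l + ((- h) * power_weight1 z l +
   ((-1) * power_weight z l + power_weight (z + h) l)))).
  by move=> l; rewrite /power_weight_rem; ring.
exact: C11_comb h2 (C11_comb _ h1 (C11_comb _ (p z) (p (z + h)))).
Qed.

(** One term of the exponential series; for n <= 3 the factorials are at most
    6. *)
Lemma pow_le_expR (x d : R) (n : nat) : 0 <= x -> 0 < d -> (n <= 3)%N ->
  x ^+ n <= 6 / d ^+ n * expR (d * x).
Proof.
move=> x0 d0 n3; have dx : 0 <= d * x by rewrite mulr_ge0 // ltW.
have h (y : R) : 0 <= y -> y ^+ n <= 6 * expR y.
  move=> y0; case: n n3 => [_|n n3].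
    by rewrite expr0; have := expR_ge1Dx y; lra.
  have := expR_ge1Dxn n y0; have f6 : (n.+1)`!%:R <= 6 :> R.
    by rewrite ler_nat; case: n n3 => [|[|[|]]].
  have f0 : 0 < (n.+1)`!%:R :> R by rewrite ltr0n fact_gt0.
  have := expR_ge0 y; set u := expR y; set k := _%:R in f0 f6 *.
  move=> u0 hu; have : y ^+ n.+1 / k <= u by lra.
  rewrite ler_pdivrMr // => /le_trans; apply; rewrite mulrC ler_wpM2r //.
by rewrite mulrAC ler_pdivlMr ?exprn_gt0 // mulrC -exprMn; exact: h.
Qed.

(** Factors exp (2 d |l|) change the decay exponent by 2 d, since |l| and Re l
    differ by a bounded amount on the half-strip. *)
Lemma weight_growth x1 z (d K : R) v : 0 <= d -> 0 <= K ->
  (forall l, cabs (v l) <= K * expR (2 * d * cabs l) * cabs (power_weight z l)) ->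
  (forall x2, exists w', C11 (rect x1 x2 (- pi) pi) v w') ->
  weight x1 (complex.Re z - 2 * d)
    (K * (expR (2 * d * (2 * `|x1| + pi)) * expR (pi * `|complex.Im z|))) v.
Proof.
move=> d0 K0 hv hC; split => // [|l xl l1]; first by rewrite !mulr_ge0 ?expR_ge0.
have [_ pw _] := power_weightP x1 z.
apply: le_trans (hv l) _; apply: le_trans (ler_wpM2l _ (pw l xl l1)) _.
  by rewrite mulr_ge0 ?expR_ge0.
have lc : cabs l <= complex.Re l + (2 * `|x1| + pi).
  apply: le_trans (cabs_le_ReIm l) _; rewrite addrA lerD //.
  rewrite ler_norml; have := ler_norm (- x1); have := normr_ge0 x1; rewrite normrN.
  lra.
have -> : (1 - (complex.Re z - 2 * d)) * complex.Re l = 2 * d * complex.Re l + (1 - complex.Re z) * complex.Re l.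
  by ring.
rewrite expRD -!mulrA ler_wpM2l // mulrCA [leRHS]mulrCA ler_wpM2l ?expR_ge0 //.
rewrite [leRHS]mulrA ler_wpM2r ?expR_ge0 // -expRD ler_expR.
have := ler_wpM2l (mulr_ge0 (ler0n _ 2) d0) lc.
by rewrite mulrDr !mulrA; lra.
Qed.

(** The remainder is of third order in h, and the price for the polynomial
    factors in l is a slightly smaller decay exponent. *)
Lemma power_weight_taylor x1 z : 0 < complex.Re z ->
  exists a d K, [/\ 0 < a, 0 < d, weight x1 a K (power_weight1 z), weight x1 a K (power_weight2 z) &
    forall h, cabs h <= d -> weight x1 a (K * cabs h ^+ 3) (power_weight_rem z h)].
Proof.
(* Two losses of d, one for the powers of l and one for the exponential in the
   remainder, keep the decay exponent positive. *)
move=> z0; pose d := complex.Re z / 8; have d0 : 0 < d by rewrite divr_gt0.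
pose E := expR (2 * d * (2 * `|x1| + pi)) * expR (pi * `|complex.Im z|).
have E0 : 0 <= E by rewrite mulr_ge0 ?expR_ge0.
pose K := 6 / d ^+ 1 + 6 / d ^+ 2 + 48 / d ^+ 3.
have q n (c : R) : 0 <= c -> 0 <= c / d ^+ n by move=> c0; rewrite divr_ge0 // exprn_ge0 // ltW.
have K0 : 0 <= K by rewrite !addr_ge0 ?q.
have grow n l : (n <= 3)%N -> cabs l ^+ n <= 6 / d ^+ n * expR (2 * d * cabs l).
  move=> n3; apply: le_trans (pow_le_expR (cabs_ge0 l) d0 n3) _.
  by rewrite ler_wpM2l ?q // ler_expR; have := cabs_ge0 l; nra.
have up C C' v : C <= C' -> weight x1 (complex.Re z - 2 * d) C v -> weight x1 (complex.Re z - 2 * d) C' v.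
  move=> cc [C0 h1 h2]; split => // [|l xl l1]; first exact: le_trans cc.
  by apply: le_trans (h1 l xl l1) _; rewrite ler_wpM2r ?expR_ge0.
exists (complex.Re z - 2 * d), d, (K * E); split => //.
- by rewrite /d; lra.
- apply: (up ((6 / d ^+ 1) * E)).
    by rewrite ler_wpM2r // /K; have := q 2%N 6; have := q 3%N 48; lra.
  apply: weight_growth; [exact: ltW|by apply: q|move=> l|by move=> x2; exact: power_weight1_C11].
  rewrite /power_weight1 cabsM cabsN ler_wpM2r ?cabs_ge0 //; exact: (grow 1%N).
- apply: (up ((6 / d ^+ 2) * E)).
    by rewrite ler_wpM2r // /K; have := q 1%N 6; have := q 3%N 48; lra.
  apply: weight_growth; [exact: ltW|by apply: q|move=> l|by move=> x2; exact: power_weight2_C11].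
  rewrite /power_weight2 2!cabsM cabsX cabsV ler_wpM2r ?cabs_ge0 //.
  rewrite cabs_nat; have := @grow 2%N l isT; have := cabs_ge0 l; have := sqr_ge0 (cabs l).
  by set x := _ ^+ 2; lra.
move=> h hd.
apply: (up ((48 / d ^+ 3 * cabs h ^+ 3) * E)).
  rewrite mulrAC ler_wpM2r ?exprn_ge0 ?cabs_ge0 // ler_wpM2r // /K.
  by have := q 1%N 6; have := q 2%N 6; lra.
apply: weight_growth; [exact: ltW|by rewrite mulr_ge0 ?exprn_ge0 ?cabs_ge0 // q|move=> l|by move=> x2; exact: power_weight_rem_C11].
rewrite power_weight_remE cabsM mulrC ler_wpM2r ?cabs_ge0 //.
have [_ _ h3] := cexp_taylor (- h * l); apply: le_trans h3 _.
rewrite cabsM cabsN exprMn.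
have g3 := pow_le_expR (cabs_ge0 l) d0 (leqnn 3).
have e1 : expR (cabs h * cabs l) <= expR (d * cabs l) by rewrite ler_expR ler_wpM2r ?cabs_ge0.
have h0 : 0 <= cabs h ^+ 3 by rewrite exprn_ge0 ?cabs_ge0.
have -> : 48 / d ^+ 3 * cabs h ^+ 3 * expR (2 * d * cabs l) =
   8 * cabs h ^+ 3 * (6 / d ^+ 3 * expR (d * cabs l) * expR (d * cabs l)).
  rewrite (_ : 2 * d * cabs l = d * cabs l + d * cabs l) ?expRD; last by ring.
  by field; rewrite gt_eqF.
have := ler_pM (exprn_ge0 _ (cabs_ge0 l)) (expR_ge0 _) g3 e1.
by move/(ler_wpM2l (mulr_ge0 (ler0n _ 8) h0)); rewrite !mulrA.
Qed.

End WeightAlgebra.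

(** * Properties of the negative powers *)

Section PowerOperators.
Variables (R : realType) (H : hilbertType R) (T : oper H H).
Implicit Types (a C phi eps : R) (w v : R[i] -> R[i]) (z l : R[i]) (f g : H).
Notation Rf := (resolvent_fun T).
Notation Q := (neg_power_fun T).

Lemma keyhole_exists : sectorial T -> bounded_oper (T^-1)%relation ->
  exists phi eps, admissible_keyhole T phi eps.
Proof.
move=> [_ _ [w hw]] invT; have [/andP[w0 wpi] _ _] := hw.
have [e e0 he] := resolvent_disc invT.
exists ((w + pi) / 2), e; split => //; last by move=> z; rewrite cabsE lecR; exact: he.
by exists w => //; apply/andP; split; rewrite ?ltr_pdivlMr ?ltr_pdivrMr //; lra.
Qed.

Section FixedContour.
Variables (phi eps : R).
Hypothesis ad : admissible_keyhole T phi eps.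

Lemma weighted_kint a C w f g : 0 < a -> weight (ln eps) a C w ->
  kint phi eps (weighted T w f g).
Proof.
move=> a0 hw; have [M M0 hM] := weighted_kgood ad; have [_ e0 _] := ad.
exact: kgood_int e0 a0 (hM _ _ _ f g hw).
Qed.

Lemma contour_op_unique w A B : contour_op T phi eps w A -> contour_op T phi eps w B ->
  A =1 B.
Proof. by move=> hA hB f; apply: hdot_inj => g; rewrite hA hB. Qed.

Let r0 : resolvent_set T 0.
Proof. by have [_ e0 h] := ad; apply: h; rewrite normr0 lecR ltW. Qed.

Let on_contour l : log_keyhole phi eps l -> resolvent_set T (cexp l).
Proof.
move=> /(log_keyhole_side (keyhole_angle ad))[hl xl].
by have [M _ /(_ l hl xl)[]] := keyhole_side_resolvent (ln eps) ad.
Qed.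

(** The resolvents commute with each other. *)
Lemma contour_op_commute w A : contour_op T phi eps w A ->
  forall f, A (Rf 0 f) = Rf 0 (A f).
Proof.
move=> hA f; apply: hdot_inj => g; have [_ e0 _] := ad.
have [[M aM] _] := resolvent_funP r0; have [b [_ _ _ bE]] := blin_adjoint aM.
rewrite bE !hA; congr (_ * _); apply: eq_KI => // l /on_contour hl.
by rewrite /weighted -bE resolvent_commute.
Qed.

Lemma power_kgood z : kgood phi eps (complex.Re z) (expR (pi * `|complex.Im z|)) (fun l => cexp (- z * l)).
Proof.
have hp := keyhole_angle ad.
split; first exact: expR_ge0.
  move=> l /(log_keyhole_side hp)[[l1 _] _].
  by apply: le_trans (cexp_lin_le (- z) l1) _; rewrite ReN ImN normrN.
move=> B; have [L L0 hL] := C11_cexp_lin (- z) (ln eps) B (- pi) pi.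
exists L => // l m /(log_keyhole_side hp)[[l1 _] xl] /(log_keyhole_side hp)[[m1 _] xm] lB mB.
by have [] // := hL l m; split; rewrite -?ler_norml // ?xl ?xm.
Qed.

(** T^{-z} T^{-1} = T^{-z-1}: by the resolvent identity the integrands differ by
    a multiple of a power that is integrated to zero. *)
Lemma neg_power_shift z f : 0 < complex.Re z -> Q z (Rf 0 f) = Q (z + 1) f.
Proof.
move=> z0; apply: hdot_inj => g; have [_ e0 _] := ad.
have z1 : 0 < complex.Re (z + 1) by rewrite ReD /= addr_gt0.
rewrite (neg_power_spec ad z0) (neg_power_spec ad z1); congr (_ * _).
have kz := weighted_kint f g z1 (power_weightP (ln eps) (z + 1)).
have kp := kgood_int e0 z0 (power_kgood z).
rewrite (eq_KI (K1 := weighted T (power_weight z) (Rf 0 f) g) (K2 := fun l => weighted T (power_weight (z + 1)) f g l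
    + (- hdot (Rf 0 f) g) * cexp (- z * l))) //.
  have /andP[p0 _] := keyhole_angle ad.
  by rewrite KID ?KIZ //; [rewrite KI_exp_eq0 ?mulr0 ?addr0 // ltW|exact: kintZ].
move=> l /on_contour hl; rewrite /weighted /power_weight.
have h := resolvent_identity f hl r0; rewrite subr0 in h.
have e1 : cexp ((1 - z) * l) = cexp (- z * l) * cexp l by rewrite -cexpD; congr (cexp _); ring.
have e2 : cexp ((1 - (z + 1)) * l) = cexp (- z * l) by congr (cexp _); ring.
rewrite e1 e2 -mulrA -hdotZl -h hdotBl; ring.
Qed.

Lemma neg_power_shiftl z f : 0 < complex.Re z -> Rf 0 (Q z f) = Q (z + 1) f.
Proof.
by move=> z0; rewrite -neg_power_shift // (contour_op_commute (neg_power_spec ad z0)).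
Qed.

Lemma neg_power_blin z : 0 < complex.Re z -> exists M, blin (Q z) M.
Proof.
move=> z0; have [M _ hM] := contour_op_exists ad.
have [A [aA hA]] := hM _ _ _ z0 (power_weightP (ln eps) z).
by rewrite (_ : Q z = A); [eexists; exact: aA|apply/funext/(contour_op_unique (neg_power_spec ad z0) hA)].
Qed.

Lemma neg_power_growth : exists2 C, 0 <= C &
  forall z, 1 <= complex.Re z <= 2 -> blin (Q z) (C * expR (pi * `|complex.Im z|)).
Proof.
have [M M0 hM] := contour_op_exists ad; have /andP[p0 _] := keyhole_angle ad.
pose E := expR (2 * `|ln eps|).
exists (M * (4 * E + 4 * (E * phi))).
  by rewrite mulr_ge0 // addr_ge0 // !mulr_ge0 ?expR_ge0 // ltW.
move=> z /andP[z1 z2]; have z0 : 0 < complex.Re z by exact: lt_le_trans z1.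
have [A [aA hA]] := hM _ _ _ z0 (power_weightP (ln eps) z).
rewrite (_ : Q z = A); last exact/funext/(contour_op_unique (neg_power_spec ad z0) hA).
apply: (blin_weaken aA); set u := expR (pi * _).
have -> : u * M * keyhole_const phi eps (complex.Re z) = M * keyhole_const phi eps (complex.Re z) * u by ring.
rewrite ler_wpM2r ?expR_ge0 // ler_wpM2l // /keyhole_const; set X := expR _.
have XE : X <= E.
  rewrite ler_expR; apply: le_trans (ler_norm _) _; rewrite normrM normrN (gtr0_norm z0).
  by rewrite ler_wpM2r.
have Xz : X / complex.Re z <= X by rewrite ler_pdivrMr // ler_peMr ?expR_ge0.
have Xp : X * phi <= E * phi by rewrite ler_wpM2r // ltW.
lra.
Qed.

(** The expansion of the weight gives that of the power, since a contour
    operator is bounded linearly by the size of its weight. *)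
Lemma neg_power_taylor z : 0 < complex.Re z ->
  exists Q1 Q2 M C d, [/\ 0 < d, blin Q1 M, blin Q2 M &
    forall h f, cabs h <= d ->
      hnorm (Q (z + h) f - Q z f - h *: Q1 f - h ^+ 2 *: Q2 f) <= C * cabs h ^+ 3 * hnorm f].
Proof.
move=> z0; have [a [d [K [a0 d0 w1 w2 w3]]]] := power_weight_taylor (ln eps) z0.
have [N N0 hN] := contour_op_exists ad.
have [Q1 [b1 c1]] := hN _ _ _ a0 w1; have [Q2 [b2 c2]] := hN _ _ _ a0 w2.
pose kc := keyhole_const phi eps a.
exists Q1, Q2, (K * N * kc), (K * N * kc), (Num.min d (complex.Re z / 2)); split => //.
  by rewrite lt_min d0 divr_gt0.
move=> h f; rewrite le_min => /andP[hd hz].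
have zh : 0 < complex.Re (z + h).
  by rewrite ReD; have := Re_le_cabs h; rewrite ler_norml; lra.
have [A [bA cA]] := hN _ _ _ a0 (w3 h hd).
have pz := power_weightP (ln eps) z; have pzh := power_weightP (ln eps) (z + h).
have s0 := neg_power_spec ad z0; have s1 := neg_power_spec ad zh.
have k0 f g := weighted_kint f g z0 pz.
have k1 f g := weighted_kint f g a0 w1; have k2 f g := weighted_kint f g a0 w2.
have k3 f g := weighted_kint f g a0 (w3 h hd).
have AE : A f = Q (z + h) f - Q z f - h *: Q1 f - h ^+ 2 *: Q2 f.
  apply: hdot_inj => g; have [_ e0 _] := ad.
  rewrite !hdotBl !hdotZl s0 s1 c1 c2 cA.
  rewrite (eq_KI (K1 := weighted T (power_weight (z + h)) f g)
     (K2 := fun l => weighted T (power_weight_rem z h) f g l + (weighted T (power_weight z) f g l +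
       (h * weighted T (power_weight1 z) f g l + h ^+ 2 * weighted T (power_weight2 z) f g l)))) //; last first.
    by move=> l _; rewrite /weighted /power_weight_rem; ring.
  have i1 := kintZ h (k1 f g); have i2 := kintZ (h ^+ 2) (k2 f g).
  have i12 := kintD i1 i2; have i012 := kintD (k0 f g) i12.
  by rewrite (KID (k3 f g) i012) (KID (k0 f g) i12) (KID i1 i2) (KIZ h (k1 f g)) (KIZ _ (k2 f g)); ring.
rewrite -AE; apply: le_trans (blin_le bA f) _.
by rewrite le_eqVlt; apply/orP; left; apply/eqP; rewrite /kc; ring.
Qed.

End FixedContour.
End PowerOperators.

(** * The powers of an operator with bounded imaginary powers *)

Section PowerFamily.
Variables (R : realType) (H : hilbertType R).
Implicit Types (z h : R[i]) (f g : H).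

(** What the interpolation argument uses of the powers P z = T^{-z} of an
    operator with inverse r and bounded imaginary powers. *)
Record power_family (T : oper H H) (N th : R) (r : H -> H) (P : R[i] -> H -> H) : Prop := PowerFamily {
  pf_inv : forall f g, T (g, f) <-> g = r f;
  pf_inv_blin : exists M, blin r M;
  pf_blin : forall z, 0 <= complex.Re z -> exists M, blin (P z) M;
  pf_graph : forall z, 0 <= complex.Re z -> neg_power T z = graph (P z);
  pf_shift : forall z f, 0 <= complex.Re z -> P z (r f) = P (z + 1) f;
  pf_shiftl : forall z f, 0 <= complex.Re z -> r (P z f) = P (z + 1) f;
  pf_imag : forall z, complex.Re z = 0 -> blin (P z) (N * expR (th * `|complex.Im z|));
  pf_growth : exists2 C, 0 <= C &
    forall z, 1 <= complex.Re z <= 2 -> blin (P z) (C * expR (pi * `|complex.Im z|));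
  pf_taylor : forall z, 0 < complex.Re z ->
    exists Q1 Q2 M C d, [/\ 0 < d, blin Q1 M, blin Q2 M &
    forall h f, cabs h <= d ->
      hnorm (P (z + h) f - P z f - h *: Q1 f - h ^+ 2 *: Q2 f) <= C * cabs h ^+ 3 * hnorm f]
}.

Variable T : oper H H.
Notation Q := (neg_power_fun T).

(** The sequence approaches the imaginary axis along the horizontal half-line
    that ends at z. *)
Lemma imag_power_limit (z : R[i]) f g : complex.Re z = 0 -> imag_power T (- complex.Im z) (f, g) ->
  hlim (fun n => Q (z + (n.+1%:R^-1)%:C) f) g.
Proof.
move=> z0; rewrite /imag_power /= (_ : - ((- complex.Im z)%:C * 'i%C) = z); last first.
  by apply: complex_ext; rewrite ?ReN ?ImN ?ReM ?ImM /= ?z0; ring.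
move=> lim e e0.
have : nbhs g [set y | hnorm (g - y) < e] by apply/nbhs_hnorm; exists e.
move=> /lim; rewrite /= /within /= => /nbhs_ballP[d /= /complex_gt0[dE d0] hd].
have [n0 hn0] := invS_small d0; exists n0 => n hn; rewrite hnorm_subC.
apply: hd; last by rewrite /= ReD z0 add0r /= invr_gt0 ltr0n.
rewrite -ball_normE /= opprD addrA subrr add0r normrN cabsE dE ltcR cabsR ger0_norm; first exact: hn0.
by rewrite invr_ge0.
Qed.

Lemma taylor_limit z f Q1 Q2 M C d : 0 < d -> blin Q1 M -> blin Q2 M ->
  (forall h f, cabs h <= d ->
      hnorm (Q (z + h) f - Q z f - h *: Q1 f - h ^+ 2 *: Q2 f) <= C * cabs h ^+ 3 * hnorm f) ->
  hlim (fun n => Q (z + (n.+1%:R^-1)%:C) f) (Q z f).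
Proof.
move=> d0 b1 b2 hQ e e0; have M0 := blin_ge0 b1.
pose K := (M + M + `|C|) * hnorm f; have K0 : 0 <= K by rewrite mulr_ge0 ?hnorm_ge0 // !addr_ge0.
have q0 : 0 < Num.min (Num.min 1 d) (e / (K + 1)).
  by rewrite !lt_min ltr01 d0 divr_gt0 // ltr_wpDl.
have [n0 hn0] := invS_small q0; exists n0 => n hn; have := hn0 n hn.
set x := n.+1%:R^-1; have x0 : 0 <= x by rewrite invr_ge0.
rewrite !lt_min => /andP[/andP[x1 xd]]; rewrite ltr_pdivlMr ?ltr_wpDl // => xK.
have cx : cabs x%:C = x by rewrite cabsR ger0_norm.
have := hQ x%:C f; rewrite cx => /(_ (ltW xd)).
set u := Q _ f - Q z f; set v := x%:C *: Q1 f; set w := _ *: Q2 f => hu.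
have -> : u = (u - v - w) + (v + w) by rewrite addrACA addrA !subrK.
apply: le_lt_trans (hnormD _ _) _; have := hnormD v w.
have hv : hnorm v <= x * (M * hnorm f) by rewrite hnormZ cx ler_wpM2l // (blin_le b1).
have hw : hnorm w <= x * (M * hnorm f).
  rewrite hnormZ cabsX cx ler_pM ?sqr_ge0 ?hnorm_ge0 ?(blin_le b2) //.
  by rewrite expr2 ler_piMr // ltW.
have h3 : C * x ^+ 3 * hnorm f <= x * (`|C| * hnorm f).
  rewrite [leRHS]mulrA ler_wpM2r ?hnorm_ge0 // mulrC; apply: le_trans (ler_wpM2l _ (ler_norm C)) _.
    by rewrite exprn_ge0.
  by rewrite ler_wpM2r // exprS ler_piMr // exprn_ile1 // ltW.
have KE : x * K = x * (M * hnorm f) + x * (M * hnorm f) + x * (`|C| * hnorm f) by rewrite /K; ring.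
rewrite mulrDr mulr1 in xK; lra.
Qed.

(** The relations with T^{-1} pass to the imaginary axis because T^{-z-1} is
    continuous there. *)
Lemma bip_power_family (N th : R) : 0 <= N -> BIP T N th ->
  exists r P, power_family T N th r P.
Proof.
move=> N0 [sT invT bip].
have [phi [eps ad]] := keyhole_exists sT invT.
pose r := resolvent_fun T 0.
have r0 := resolvent0 invT; have [rB rE] := resolvent_funP r0.
have im z : complex.Re z = 0 -> exists a, blin a (N * expR (th * `|complex.Im z|)) /\
    forall f g, imag_power T (- complex.Im z) (f, g) <-> g = a f.
  move=> z0; have [bz oz] := bip (- complex.Im z); have [a [M [aM aE]]] := bounded_operP bz.
  exists a; split => //; rewrite normrN in oz.
  have C0 : 0 <= N * expR (th * `|complex.Im z|) by rewrite mulr_ge0 ?expR_ge0.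
  split => // [|u]; first exact: blin_lin aM.
  have [lz _ _] := bz; have e : imag_power T (- complex.Im z) (u, a u) by apply/aE.
  exact: (opnorm_le lz e oz C0).
have /choice[P hP] : forall z, exists a : H -> H, (0 < complex.Re z -> a = Q z) /\
    (complex.Re z = 0 -> blin a (N * expR (th * `|complex.Im z|)) /\
      forall f g, imag_power T (- complex.Im z) (f, g) <-> g = a f).
  move=> z; have [z0|z0] := ltP 0 (complex.Re z).
    by exists (Q z); split => // h; rewrite h ltxx in z0.
  have [e|ne] := eqVneq (complex.Re z) 0.
    by have [a ha] := im z e; exists a; split => // h; rewrite e ltxx in h.
  by exists (Q z); split => // h; rewrite h eqxx in ne.
have PQ z : 0 < complex.Re z -> P z = Q z by case: (hP z).
have Pi z : complex.Re z = 0 -> blin (P z) (N * expR (th * `|complex.Im z|)) /\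
      forall f g, imag_power T (- complex.Im z) (f, g) <-> g = P z f.
  by move=> z0; have [_ h] := hP z; exact: h.
have cases z : 0 <= complex.Re z -> complex.Re z = 0 \/ 0 < complex.Re z.
  by rewrite le_eqVlt => /predU1P[->|]; [left|right].
have shiftI z f : complex.Re z = 0 -> P z (r f) = P (z + 1) f /\ r (P z f) = P (z + 1) f.
  move=> z0; have [bz zE] := Pi z z0.
  have z1 : 0 < complex.Re (z + 1) by rewrite ReD z0 add0r.
  rewrite (PQ _ z1); have [Q1 [Q2 [M [C [d [d0 b1 b2 hQ]]]]]] := neg_power_taylor ad z1.
  have lim1 := taylor_limit f d0 b1 b2 hQ.
  have zn n : 0 < complex.Re (z + (n.+1%:R^-1)%:C) by rewrite ReD z0 add0r /= invr_gt0 ltr0n.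
  have comm n : z + 1 + (n.+1%:R^-1)%:C = z + (n.+1%:R^-1)%:C + 1 by rewrite addrAC.
  have [Mr hr] := rB.
  split; apply: hlim_unique lim1.
  - have : imag_power T (- complex.Im z) (r f, P z (r f)) by apply/zE.
    move/(imag_power_limit z0) => l e /l[n0 hn0]; exists n0 => n /hn0.
    by rewrite comm -(neg_power_shift ad _ (zn n)).
  - have : imag_power T (- complex.Im z) (f, P z f) by apply/zE.
    move/(imag_power_limit z0)/(blin_hlim hr) => l e /l[n0 hn0]; exists n0 => n /hn0 /=.
    by rewrite comm -(neg_power_shiftl ad _ (zn n)).
exists r, P; split.
- by move=> f g; rewrite -rE scale0r addr0.
- exact: rB.
- move=> z /cases[z0|z0]; first by eexists; exact: (Pi z z0).1.
  by rewrite PQ //; exact: neg_power_blin ad _ z0.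
- move=> z /cases[z0|z0]; rewrite /neg_power; last by rewrite z0 PQ.
  rewrite z0 ltxx; have [_ zE] := Pi z z0.
  by apply/seteqP; split=> -[f g]; [move/zE|move=> h; apply/zE].
- move=> z f /cases[z0|z0]; first by have [] := shiftI z f z0.
  have z1 : 0 < complex.Re (z + 1) by rewrite ReD addr_gt0.
  by rewrite (PQ _ z0) (PQ _ z1) (neg_power_shift ad f z0).
- move=> z f /cases[z0|z0]; first by have [] := shiftI z f z0.
  have z1 : 0 < complex.Re (z + 1) by rewrite ReD addr_gt0.
  by rewrite /r (PQ _ z0) (PQ _ z1) (neg_power_shiftl ad f z0).
- by move=> z z0; exact: (Pi z z0).1.
- have [C C0 hC] := neg_power_growth ad; exists C => // z hz.
  by rewrite PQ; [exact: hC|case/andP: hz => /(lt_le_trans ltr01)].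
- move=> z z0; have [Q1 [Q2 [M [C [d [d0 b1 b2 hQ]]]]]] := neg_power_taylor ad z0.
  exists Q1, Q2, M, C, (Num.min d (complex.Re z / 2)); split => //.
    by rewrite lt_min d0 divr_gt0.
  move=> h f; rewrite le_min => /andP[hd hz]; rewrite !PQ //; first exact: hQ.
  by rewrite ReD; have := Re_le_cabs h; rewrite ler_norml; lra.
Qed.

End PowerFamily.

(** * Second-order expansions *)

Section Taylor.
Variable R : realType.
Implicit Types (F G : R[i] -> R[i]) (z h : R[i]).

(** Second-order expansions: all that the maximum principle uses of
    holomorphy. *)
Definition taylor2 F z : Prop := exists b c C d, 0 < d /\
  forall h, cabs h <= d -> cabs (F (z + h) - F z - b * h - c * h ^+ 2) <= C * cabs h ^+ 3.

Lemma taylor2_mul F G z : taylor2 F z -> taylor2 G z -> taylor2 (fun w => F w * G w) z.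
Proof.
move=> [b [c [C [d [d0 hF]]]]] [b' [c' [C' [d' [d0' hG]]]]].
pose B := cabs (F z) + cabs b + cabs c; pose B' := cabs (G z) + cabs b' + cabs c' + `|C'|.
have B0 : 0 <= B by rewrite !addr_ge0 ?cabs_ge0.
have B0' : 0 <= B' by rewrite !addr_ge0 ?cabs_ge0.
pose K := cabs b * cabs c' + cabs c * cabs b' + cabs c * cabs c'.
exists (b * G z + F z * b'), (c * G z + b * b' + F z * c'), (`|C| * B' + B * `|C'| + K), (Num.min 1 (Num.min d d')).
split; first by rewrite !lt_min ltr01 d0.
move=> h; rewrite !le_min => /andP[h1 /andP[hd hd']].
have h0 := cabs_ge0 h; have {}hF := hF h hd; have {}hG := hG h hd'.
set x := cabs h in h1 h0 hF hG *.
have x2 : x ^+ 2 <= 1 by rewrite exprn_ile1.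
have x3 : x ^+ 3 <= 1 by rewrite exprn_ile1.
have x30 : 0 <= x ^+ 3 by rewrite exprn_ge0.
set e := F _ - _ - _ - _ in hF; set e' := G _ - _ - _ - _ in hG.
have up (u v : R) : 0 <= v -> u * v <= `|u| * v by move=> v0; rewrite ler_wpM2r ?ler_norm.
have He : cabs e <= `|C| * x ^+ 3 by apply: le_trans hF (up _ _ x30).
have He' : cabs e' <= `|C'| * x ^+ 3 by apply: le_trans hG (up _ _ x30).
have GB : cabs (G (z + h)) <= B'.
  have -> : G (z + h) = G z + b' * h + c' * h ^+ 2 + e' by rewrite /e'; ring.
  apply: le_trans (cabsD _ _) _; rewrite lerD //; last first.
    by apply: le_trans He' _; rewrite ler_piMr.
  apply: le_trans (cabsD _ _) _; rewrite cabsM cabsX; apply: lerD; last by rewrite ler_piMr ?cabs_ge0.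
  by apply: le_trans (cabsD _ _) _; rewrite cabsM lerD // ler_piMr ?cabs_ge0.
have FB : cabs (F z + b * h + c * h ^+ 2) <= B.
  apply: le_trans (cabsD _ _) _; rewrite cabsM cabsX; apply: lerD; last by rewrite ler_piMr ?cabs_ge0.
  by apply: le_trans (cabsD _ _) _; rewrite cabsM lerD // ler_piMr ?cabs_ge0.
have -> : F (z + h) * G (z + h) - F z * G z - (b * G z + F z * b') * h - (c * G z + b * b' + F z * c') * h ^+ 2 =
  e * G (z + h) + (F z + b * h + c * h ^+ 2) * e' + (b * c' + c * b' + c * c' * h) * h ^+ 3.
  by rewrite /e /e'; ring.
apply: le_trans (cabsD _ _) _; rewrite [leRHS]mulrDl; apply: lerD; last first.
  rewrite cabsM cabsX ler_wpM2r //; apply: le_trans (cabsD _ _) _.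
  rewrite cabsM /K lerD //; last by rewrite cabsM ler_piMr // mulr_ge0 ?cabs_ge0.
  by apply: le_trans (cabsD _ _) _; rewrite !cabsM.
apply: le_trans (cabsD _ _) _; rewrite [leRHS]mulrDl !cabsM; apply: lerD.
  by rewrite mulrAC ler_pM ?cabs_ge0.
by rewrite -mulrA ler_pM ?cabs_ge0.
Qed.

Lemma taylor2_sum n (F : 'I_n -> R[i] -> R[i]) (c : 'I_n -> R[i]) z :
  (forall i, taylor2 (F i) z) -> taylor2 (fun w => \sum_i c i * F i w) z.
Proof.
elim: n F c => [|n ih] F c hF.
  by exists 0, 0, 0, 1; split => // h _; rewrite !big_ord0 !mul0r !subr0 cabs0.
have [b1 [c1 [C1 [d1 [d10 h1]]]]] := ih (fun i => F (lift ord0 i)) (fun i => c (lift ord0 i)) (fun i => hF _).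
have [b2 [c2 [C2 [d2 [d20 h2]]]]] := hF ord0.
exists (b1 + c ord0 * b2), (c1 + c ord0 * c2), (C1 + cabs (c ord0) * C2), (Num.min d1 d2).
split; first by rewrite lt_min d10.
move=> h; rewrite le_min => /andP[/h1 {}h1 /h2 {}h2]; rewrite !big_ord_recl.
move: h1; set x := \sum_i _; set y := \sum_i _ => h1.
have -> : c ord0 * F ord0 (z + h) + x - (c ord0 * F ord0 z + y) - (b1 + c ord0 * b2) * h - (c1 + c ord0 * c2) * h ^+ 2
  = (x - y - b1 * h - c1 * h ^+ 2) + c ord0 * (F ord0 (z + h) - F ord0 z - b2 * h - c2 * h ^+ 2) by ring.
by apply: le_trans (cabsD _ _) _; rewrite [leRHS]mulrDl lerD // cabsM -[leRHS]mulrA ler_wpM2l // cabs_ge0.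
Qed.

(** The Gaussian factors of the three lines argument and their corrections by
    constants. *)
Lemma taylor2_gauss (k be ga : R[i]) z : taylor2 (fun w => cexp (k * w ^+ 2 + be * w + ga)) z.
Proof.
pose q (w : R[i]) := k * w ^+ 2 + be * w + ga; pose b := 2 * k * z + be.
pose L := cabs b + cabs k; have L0 : 0 <= L by rewrite addr_ge0 ?cabs_ge0.
pose K := 8 * L ^+ 3 * expR L + (cabs b * cabs k + cabs k ^+ 2).
exists (cexp (q z) * b), (cexp (q z) * (k + 2^-1 * b ^+ 2)), (cabs (cexp (q z)) * K), 1; split => // h h1.
have h0 := cabs_ge0 h.
pose w := b * h + k * h ^+ 2.
have -> : cexp (k * (z + h) ^+ 2 + be * (z + h) + ga) = cexp (q z) * cexp w.
  by rewrite -cexpD; congr (cexp _); rewrite /q /w /b; ring.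
have -> : cexp (q z) * cexp w - cexp (k * z ^+ 2 + be * z + ga) - cexp (q z) * b * h - cexp (q z) * (k + 2^-1 * b ^+ 2) * h ^+ 2 =
  cexp (q z) * ((cexp w - 1 - w - 2^-1 * w ^+ 2) + (b * k + 2^-1 * k ^+ 2 * h) * h ^+ 3).
  by rewrite -/(q z) /w; field.
rewrite cabsM -[leRHS]mulrA ler_wpM2l ?cabs_ge0 //.
apply: le_trans (cabsD _ _) _; rewrite [leRHS]mulrDl; apply: lerD.
  have wL : cabs w <= L * cabs h.
    apply: le_trans (cabsD _ _) _; rewrite !cabsM [leRHS]mulrDl lerD // ler_wpM2l ?cabs_ge0 //.
    by rewrite ler_piMr.
  have [_ _ h3] := cexp_taylor w; apply: le_trans h3 _.
  rewrite [leRHS]mulrAC -(mulrA 8 (L ^+ 3)) -exprMn; apply: ler_pM.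
  - by rewrite mulr_ge0 ?exprn_ge0 ?cabs_ge0.
  - exact: expR_ge0.
  - by rewrite ler_wpM2l // lerXn2r ?nnegrE ?cabs_ge0 // mulr_ge0.
  - by rewrite ler_expR (le_trans wL) // ler_piMr.
rewrite cabsM cabsX ler_wpM2r ?exprn_ge0 //; apply: le_trans (cabsD _ _) _.
rewrite cabsM lerD // 2!cabsM cabsX cabsV cabs_nat.
have : cabs k ^+ 2 * cabs h <= cabs k ^+ 2 by rewrite ler_piMr // sqr_ge0.
by have := mulr_ge0 (sqr_ge0 (cabs k)) h0; rewrite -mulrA; lra.
Qed.

(** The average over the four points z + h, h^4 = r^4, kills the terms of first
    and second order, so |F|^2 has the sub-mean value property up to r^3. *)
Lemma taylor2_submean F z : taylor2 F z -> exists C d, [/\ 0 <= C, 0 < d & forall r : R, 0 <= r <= d ->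
  4 * cabs (F z) ^+ 2 - C * r ^+ 3 <= cabs (F (z + r%:C)) ^+ 2 + cabs (F (z - r%:C)) ^+ 2
    + cabs (F (z + 'i%C * r%:C)) ^+ 2 + cabs (F (z - 'i%C * r%:C)) ^+ 2].
Proof.
move=> [b [c [C [d [d0 hF]]]]].
pose A := cabs (F z) + cabs b + cabs c.
have A0 : 0 <= A by rewrite !addr_ge0 ?cabs_ge0.
exists (8 * A * `|C|), (Num.min 1 d); split; [by rewrite !mulr_ge0|by rewrite lt_min ltr01|].
move=> r /andP[r0]; rewrite le_min => /andP[r1 rd].
pose p h := F z + b * h + c * h ^+ 2.
have one h : cabs h = r -> cabs (p h) ^+ 2 - 2 * A * `|C| * r ^+ 3 <= cabs (F (z + h)) ^+ 2.
  move=> hr; have := hF h; rewrite hr => /(_ rd); set e := F _ - _ - _ - _ => he.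
  have {}he : cabs e <= `|C| * r ^+ 3.
    by apply: le_trans he _; rewrite ler_wpM2r ?exprn_ge0 ?ler_norm.
  have pA : cabs (p h) <= A.
    apply: le_trans (cabsD _ _) _; rewrite cabsM cabsX hr; apply: lerD; last first.
      by rewrite ler_piMr ?cabs_ge0 // exprn_ile1.
    by apply: le_trans (cabsD _ _) _; rewrite cabsM hr lerD // ler_piMr ?cabs_ge0.
  have : cabs (p h) <= cabs (F (z + h)) + cabs e.
    have -> : p h = F (z + h) - e by rewrite /p /e; ring.
    exact: cabsB.
  have := ler_pM (cabs_ge0 (p h)) (cabs_ge0 e) pA he.
  have := cabs_ge0 (p h); have := cabs_ge0 e; have := cabs_ge0 (F (z + h)).
  set u := cabs (F _); set v := cabs e; set w := cabs (p h) => u0 v0 w0 wv wuv.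
  have : w ^+ 2 - 2 * (w * v) <= u ^+ 2.
    have [wv'|wv'] := leP v w; last by nra.
    have : (w - v) ^+ 2 <= u ^+ 2 by rewrite lerXn2r ?nnegrE ?subr_ge0 // lerBlDr.
    by have := sqr_ge0 v; nra.
  by lra.
have cpar (u v : R[i]) : cabs (u + v) ^+ 2 + cabs (u - v) ^+ 2 = 2 * cabs u ^+ 2 + 2 * cabs v ^+ 2.
  by rewrite !cabs_sqr !ReD !ImD ReN ImN; ring.
have ii : 'i%C ^+ 2 = -1 :> R[i] by exact: sqr_i.
have cr : cabs r%:C = r by rewrite cabsR ger0_norm.
have h1 := one r%:C cr; have h2 := one (- r%:C); rewrite cabsN in h2; have {}h2 := h2 cr.
have h3 := one ('i%C * r%:C); rewrite cabsM cabs_i mul1r in h3; have {}h3 := h3 cr.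
have h4 := one (- ('i%C * r%:C)); rewrite cabsN cabsM cabs_i mul1r in h4; have {}h4 := h4 cr.
have p12 := cpar (F z + c * r%:C ^+ 2) (b * r%:C).
have p34 := cpar (F z - c * r%:C ^+ 2) (b * ('i%C * r%:C)).
have pp := cpar (F z) (c * r%:C ^+ 2).
have e1 : p r%:C = F z + c * r%:C ^+ 2 + b * r%:C by rewrite /p; ring.
have e2 : p (- r%:C) = F z + c * r%:C ^+ 2 - b * r%:C by rewrite /p; ring.
have e3 : p ('i%C * r%:C) = F z - c * r%:C ^+ 2 + b * ('i%C * r%:C) by rewrite /p exprMn ii; ring.
have e4 : p (- ('i%C * r%:C)) = F z - c * r%:C ^+ 2 - b * ('i%C * r%:C) by rewrite /p sqrrN exprMn ii; ring.
rewrite -e1 -e2 in p12; rewrite -e3 -e4 in p34.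
have := sqr_ge0 (cabs (b * r%:C)); have := sqr_ge0 (cabs (b * ('i%C * r%:C))); have := sqr_ge0 (cabs (c * r%:C ^+ 2)).
move: h1 h2 h3 h4 p12 p34 pp; set q1 := cabs (p _) ^+ 2; set q2 := cabs (p _) ^+ 2.
set q3 := cabs (p _) ^+ 2; set q4 := cabs (p _) ^+ 2.
have -> : 8 * A * `|C| * r ^+ 3 = 4 * (2 * A * `|C| * r ^+ 3) by ring.
lra.
Qed.

End Taylor.

(** * The three lines theorem *)

Section ThreeLines.
Variable R : realType.
Implicit Types (F G : R[i] -> R[i]) (z h : R[i]).

Lemma taylor2_lipschitz F z : taylor2 F z -> exists L d, [/\ 0 <= L, 0 < d &
  forall h, cabs h <= d -> cabs (F (z + h) - F z) <= L * cabs h].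
Proof.
move=> [b [c [C [d [d0 hF]]]]].
exists (cabs b + cabs c + `|C|), (Num.min 1 d); split.
- by rewrite !addr_ge0 ?cabs_ge0.
- by rewrite lt_min ltr01.
move=> h; rewrite le_min => /andP[h1 /hF {}hF]; have h0 := cabs_ge0 h.
have -> : F (z + h) - F z = (F (z + h) - F z - b * h - c * h ^+ 2) + (b * h + c * h ^+ 2) by ring.
apply: le_trans (cabsD _ _) _; have := cabsD (b * h) (c * h ^+ 2); rewrite (cabsM b) (cabsM c) cabsX.
have : cabs c * cabs h ^+ 2 <= cabs c * cabs h by rewrite ler_wpM2l ?cabs_ge0 // expr2 ler_piMr.
have : C * cabs h ^+ 3 <= `|C| * cabs h.
  apply: le_trans (_ : _ <= `|C| * cabs h ^+ 3) _.
    by rewrite ler_wpM2r ?exprn_ge0 ?ler_norm.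
  by rewrite ler_wpM2l // exprS ler_piMr // exprn_ile1.
lra.
Qed.

(** Maximum principle; adding a small multiple of x^2 makes the sub-mean value
    inequality strict. *)
Lemma maximum_principle F (Y B : R) : 0 <= B ->
  (forall z, rect 0 1 (- Y) Y z -> taylor2 F z) ->
  (forall z, rect 0 1 (- Y) Y z ->
     [\/ complex.Re z = 0, complex.Re z = 1 | `|complex.Im z| = Y] -> cabs (F z) <= B) ->
  forall z, rect 0 1 (- Y) Y z -> cabs (F z) <= B.
Proof.
move=> B0 hF bd z1 hz1; rewrite leNgt; apply/negP => BF.
(* The increase of ep x^2 over the strip, at most ep, is half of the presumed
   excess. *)
pose ep := (cabs (F z1) ^+ 2 - B ^+ 2) / 2.
have ep0 : 0 < ep by rewrite divr_gt0 // subr_gt0 ltrXn2r ?nnegrE ?cabs_ge0.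
pose f (p : R * R) := cabs (F (p.1 +i* p.2)) ^+ 2 + ep * p.1 ^+ 2.
pose K : set (R * R) := `[0, 1] `*` `[- Y, Y].
have KE x y : K (x, y) <-> rect 0 1 (- Y) Y (x +i* y).
  by rewrite /K /rect; split=> -[/= h1 h2]; split; rewrite /= in_itv /= in h1 h2 *.
have cpt : compact K by apply: compact_setX; exact: segment_compact.
have K0 : K !=set0.
  by exists (complex.Re z1, complex.Im z1); apply/KE; case: (z1) hz1.
have cont : {within K, continuous f}.
  apply/subspace_continuousP => -[x y] Kxy; apply: cvg_within_filter.
  have [L [d [L0 d0 hL]]] := taylor2_lipschitz (hF _ ((KE x y).1 Kxy)).
  have Fc : (fun p : R * R => cabs (F (p.1 +i* p.2))) @ (x, y) --> cabs (F (x +i* y)).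
    apply/cvgrPdist_lt => e e0; pose s := Num.min (d / 2) (e / (2 * (L + 1))).
    have L1 : 0 < 2 * (L + 1) by rewrite mulr_gt0 // ltr_wpDl.
    have s0 : 0 < s by rewrite lt_min !divr_gt0.
    exists (ball x s, ball y s); first by split; exact: nbhsx_ballx.
    move=> [u v] [/= xu yv]; have {}xu : `|x - u| < s by []. have {}yv : `|y - v| < s by [].
    pose h : R[i] := (u - x) +i* (v - y).
    have hE : u +i* v = (x +i* y) + h.
      by apply: complex_ext => /=; rewrite addrC subrK.
    have hs : cabs h <= 2 * s.
      by apply: le_trans (cabs_le_ReIm h) _; rewrite /= distrC [X in _ + X]distrC; lra.
    have sd : s <= d / 2 by rewrite ge_min lexx.
    have se : s * (2 * (L + 1)) <= e by rewrite -ler_pdivlMr // ge_min lexx orbT.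
    rewrite distrC; apply: le_lt_trans (cabs_dist _ _) _; rewrite hE.
    apply: le_lt_trans (hL h _) _; first lra.
    have := ler_wpM2l L0 hs; nra.
  have Xc : (fun p : R * R => p.1) @ (x, y) --> x by exact: cvg_fst.
  apply: cvgD; first by rewrite /= expr2; under eq_fun do rewrite expr2; exact: cvgM.
  apply: cvgM; first exact: cvg_cst.
  by rewrite /= expr2; under eq_fun do rewrite expr2; exact: cvgM.
have [[x y]] := compact_EVT_max K0 cpt cont; rewrite inE => Kxy hmax.
have {}hmax u v : rect 0 1 (- Y) Y (u +i* v) -> f (u, v) <= f (x, y).
  by move=> /KE h; apply: hmax; rewrite inE.
have rxy := (KE x y).1 Kxy; have [/= /andP[x0 x1] /andP[y1 y2]] := rxy.
have big : B ^+ 2 + 2 * ep <= f (x, y).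
  have -> : B ^+ 2 + 2 * ep = cabs (F z1) ^+ 2 by rewrite /ep; field.
  have := hmax (complex.Re z1) (complex.Im z1); rewrite /f /=.
  have -> : complex.Re z1 +i* complex.Im z1 = z1 by case: (z1).
  have := sqr_ge0 (complex.Re z1).
  move=> h /(_ hz1); have := mulr_ge0 (ltW ep0) h; lra.
have inn : ~ [\/ x = 0, x = 1 | `|y| = Y].
  move=> /(bd _ rxy) FB; have : cabs (F (x +i* y)) ^+ 2 <= B ^+ 2 by rewrite lerXn2r ?nnegrE ?cabs_ge0.
  have : x ^+ 2 <= 1 by rewrite exprn_ile1.
  by move: big; rewrite /f /=; nra.
have x0' : 0 < x by rewrite lt_neqAle x0 andbT eq_sym; apply/eqP => e; apply: inn; exact: Or31.
have x1' : x < 1 by rewrite lt_neqAle x1 andbT; apply/eqP => e; apply: inn; exact: Or32.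
have y1' : - Y < y.
  rewrite lt_neqAle y1 andbT; apply/eqP => e; apply: inn; apply: Or33.
  by rewrite -e normrN ger0_norm //; lra.
have y2' : y < Y.
  rewrite lt_neqAle y2 andbT; apply/eqP => e; apply: inn; apply: Or33.
  by rewrite e ger0_norm //; lra.
have [C [d [C0 d0 hC]]] := taylor2_submean (hF _ rxy).
(* Small enough for the four points z + r, z - r, z + i r, z - i r to stay in
   the rectangle and for the cubic error to be below ep r^2. *)
pose r := Num.min (Num.min d (Num.min x (1 - x))) (Num.min (Num.min (Y - y) (y + Y)) (ep / (C + 1))).
have C1 : 0 < C + 1 by rewrite ltr_wpDl.
have r0 : 0 < r by rewrite !lt_min d0 x0' divr_gt0 // !andbT /=; apply/and3P; split; lra.
have : r <= r by []. rewrite {2}/r !le_min ler_pdivlMr // => /andP[/and3P[rd rx r1x] /andP[/andP[rY ry] rC]].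
have rr : 0 <= r <= d by rewrite ltW.
have := hC r rr.
have e1 : (x +i* y) + r%:C = (x + r) +i* y by apply: complex_ext => //=; rewrite addr0.
have e2 : (x +i* y) - r%:C = (x - r) +i* y by apply: complex_ext => //=; rewrite subr0.
have e3 : (x +i* y) + 'i%C * r%:C = x +i* (y + r).
  by apply: complex_ext; rewrite ?ReD ?ImD ?ReM ?ImM /=; ring.
have e4 : (x +i* y) - 'i%C * r%:C = x +i* (y - r).
  by apply: complex_ext; rewrite ?ReD ?ImD ?ReN ?ImN ?ReM ?ImM /=; ring.
rewrite e1 e2 e3 e4.
have m1 : f (x + r, y) <= f (x, y) by apply: hmax; clear -rx r1x rY ry r0 x0 x1 y1 y2; split => /=; apply/andP; split; lra.
have m2 : f (x - r, y) <= f (x, y) by apply: hmax; clear -rx r1x rY ry r0 x0 x1 y1 y2; split => /=; apply/andP; split; lra.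
have m3 : f (x, y + r) <= f (x, y) by apply: hmax; clear -rx r1x rY ry r0 x0 x1 y1 y2; split => /=; apply/andP; split; lra.
have m4 : f (x, y - r) <= f (x, y) by apply: hmax; clear -rx r1x rY ry r0 x0 x1 y1 y2; split => /=; apply/andP; split; lra.
have r20 : 0 < r ^+ 2 by rewrite exprn_gt0.
move: m1 m2 m3 m4; rewrite /f /=.
have : C * r ^+ 3 <= ep * r ^+ 2.
  by rewrite exprSr mulrCA mulrC ler_pM2r //; nra.
have : 0 < ep * r ^+ 2 by rewrite mulr_gt0.
rewrite !sqrrD sqrrN.
set a1 := cabs _ ^+ 2; set a2 := cabs _ ^+ 2; set a3 := cabs _ ^+ 2; set a4 := cabs _ ^+ 2; set a5 := cabs _ ^+ 2.
lra.
Qed.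

(** Hadamard's three lines theorem, with boundary values of exponential growth:
    the Gaussian factor exp (k (z^2 - z)) compensates the growth. *)
Theorem three_lines F (th k C c M0 M1 : R) : 0 <= th -> 0 < k -> 0 <= C -> 0 <= c -> 0 < M0 -> 0 < M1 ->
  (forall z, 0 <= complex.Re z <= 1 -> taylor2 F z) ->
  (forall z, 0 <= complex.Re z <= 1 -> cabs (F z) <= C * expR (c * `|complex.Im z|)) ->
  (forall z, complex.Re z = 0 -> cabs (F z) <= M0 * expR (th * `|complex.Im z|)) ->
  (forall z, complex.Re z = 1 -> cabs (F z) <= M1 * expR (th * `|complex.Im z|)) ->
  forall z, 0 <= complex.Re z <= 1 ->
    cabs (F z) <= expR (k * complex.Im z ^+ 2 + k * complex.Re z * (1 - complex.Re z) + (4 * k)^-1 * th ^+ 2)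
      * (M0 `^ (1 - complex.Re z) * M1 `^ complex.Re z).
Proof.
move=> th0 k0 C0 c0 M00 M10 hT hG hM0 hM1 z hz.
(* G is F times exp (k (z^2 - z)) M0^(z-1) M1^(-z), so that its boundary
   values are bounded by the same B on both lines. *)
pose be : R := - k + ln M0 - ln M1.
pose G w := F w * cexp (k%:C * w ^+ 2 + be%:C * w + (- ln M0)%:C).
have GE w : cabs (G w) = cabs (F w) * expR (- (k * complex.Im w ^+ 2) - k * complex.Re w * (1 - complex.Re w)
   - (1 - complex.Re w) * ln M0 - complex.Re w * ln M1).
  rewrite /G cabsM cabs_cexp; congr (_ * expR _).
  rewrite !ReD !Re_realM expr2 ReM /= /be; ring.
have kk : 0 < (4 * k)^-1 by rewrite invr_gt0 mulr_gt0.
pose B := expR ((4 * k)^-1 * th ^+ 2).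
have B1 : 1 <= B by rewrite -expR0 ler_expR mulr_ge0 ?sqr_ge0 // ltW.
have sq (y : R) : th * `|y| - k * y ^+ 2 <= (4 * k)^-1 * th ^+ 2.
  have -> : (4 * k)^-1 * th ^+ 2 = th * `|y| - k * y ^+ 2 + (th - 2 * k * `|y|) ^+ 2 * (4 * k)^-1.
    by rewrite -(real_normK (num_real y)); field; rewrite gt_eqF.
  by rewrite lerDl mulr_ge0 ?sqr_ge0 // ltW.
pose D := C * (expR (`|ln M0| + `|ln M1|)); have D0 : 0 <= D by rewrite mulr_ge0 ?expR_ge0.
(* At height Y the Gaussian factor makes up for the growth exp (c |Im z|) and
   for the constant D. *)
pose Y := `|complex.Im z| + (c + 1) / k + D + 1.
have ck : 0 <= (c + 1) / k by rewrite divr_ge0 ?ltW // ltr_wpDl.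
have Y1 : 1 <= Y by rewrite /Y; have := normr_ge0 (complex.Im z); lra.
suff : cabs (G z) <= B.
  rewrite GE; set u := expR _ => h.
  have uE : u * expR (k * complex.Im z ^+ 2 + k * complex.Re z * (1 - complex.Re z))
     * (M0 `^ (1 - complex.Re z) * M1 `^ complex.Re z) = 1.
    rewrite /powR !gt_eqF // -!expRD -expR0; congr expR; ring.
  rewrite [expR (_ + _ + _)]expRD -/B; set v := expR _ in uE *; set q := _ * _ `^ _ in uE *.
  have -> : cabs (F z) = cabs (F z) * u * (v * q) by rewrite -mulrA (mulrA u) uE mulr1.
  have -> : v * B * q = B * (v * q) by ring.
  by rewrite ler_wpM2r // mulr_ge0 ?expR_ge0 // mulr_ge0 ?powR_ge0.
apply: (@maximum_principle G Y B).
- exact: le_trans ler01 B1.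
- by move=> w [hw _]; apply: taylor2_mul; [exact: hT|exact: taylor2_gauss].
- move=> w [hw _] [w0|w1|wY]; rewrite GE.
  + rewrite w0; apply: le_trans (ler_wpM2r (expR_ge0 _) (hM0 w w0)) _.
    rewrite -[X in X * expR (th * _)](lnK (x := M0)) ?posrE // -!expRD ler_expR.
    by have := sq (complex.Im w); lra.
  + rewrite w1; apply: le_trans (ler_wpM2r (expR_ge0 _) (hM1 w w1)) _.
    rewrite -[X in X * expR (th * _)](lnK (x := M1)) ?posrE // -!expRD ler_expR.
    by have := sq (complex.Im w); lra.
  + apply: le_trans B1; have [x0 x1] := andP hw.
    apply: le_trans (ler_wpM2r (expR_ge0 _) (hG w hw)) _.
    rewrite -[leLHS]mulrA -expRD.
    apply: le_trans (_ : C * (expR (`|ln M0| + `|ln M1|) * expR (- Y)) <= _).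
      rewrite ler_wpM2l // -expRD ler_expR -(real_normK (num_real (complex.Im w))) wY.
      have a1 : - ((1 - complex.Re w) * ln M0) <= `|ln M0|.
        apply: le_trans (ler_norm _) _; rewrite normrN normrM ger0_norm ?subr_ge0 //.
        by rewrite ler_piMl //; lra.
      have a2 : - (complex.Re w * ln M1) <= `|ln M1|.
        by apply: le_trans (ler_norm _) _; rewrite normrN normrM ger0_norm // ler_piMl.
      have a3 : 0 <= k * complex.Re w * (1 - complex.Re w).
        by rewrite !mulr_ge0 ?subr_ge0 // ltW.
      have a4 : (c + 1) * Y <= k * Y ^+ 2.
        rewrite expr2 mulrA ler_wpM2r //; first lra.
        by rewrite mulrC -ler_pdivrMr // /Y; have := normr_ge0 (complex.Im z); lra.
      rewrite mulrDl mul1r in a4; lra.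
    rewrite [leLHS]mulrA -/D expRN ler_pdivrMr ?expR_gt0 // mul1r.
    by have := expR_ge1Dx Y; rewrite /Y; have := normr_ge0 (complex.Im z); lra.
- split => //; rewrite -ler_norml /Y; lra.
Qed.

End ThreeLines.

(** * Pairings with Schatten class operators *)

Section Pairings.
Variable R : realType.

Lemma schatten_pairing (H1 H2 : hilbertType R) (A : oper H1 H2) (p : R) :
  1 <= p -> schatten p A ->
  exists a M K, [/\ blin a M, forall f g, A (f, g) <-> g = a f, 0 <= K,
    schatten_norm p A = K%:E &
    forall k (u : nat -> H1) (v : nat -> H2) (y : nat -> R) c d, 0 < c -> 0 < d ->
      bessel k c u -> bessel k d v -> (forall i, 0 <= y i) -> \sum_(i < k) y i `^ p <= 1 ->
      \sum_(i < k) y i `^ (p - 1) * cabs (hdot (a (u i)) (v i)) <= c * d * K].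
Proof.
move=> p1 [cA nA]; have [bA _] := cA; have [a [M [aM aA]]] := bounded_operP bA.
have [K [K0 nK sK]] := schatten_norm_sums p1 nA; have ssv := singular_values_spec aM aA cA.
exists a, M, K; split => // k u v y c d c0 d0 bu bv y0 y1.
apply: (singular_values_pairing aM aA ssv p1 K0 _ c0 d0 bu bv y0 y1) => N.
have [_ s0 _] := ssv.
by apply: le_trans (sK N); under [leRHS]eq_bigr do rewrite ger0_norm //.
Qed.

Lemma taylor2_pairing (H H' : hilbertType R) (A : R[i] -> H -> H') (x : R[i] -> H) z
  (A1 A2 : H -> H') x1 x2 (M M' C C' d d' : R) g :
  0 < d -> 0 < d' -> blin (A z) M -> blin A1 M' -> blin A2 M' ->
  (forall h v, cabs h <= d ->
     hnorm (A (z + h) v - A z v - h *: A1 v - h ^+ 2 *: A2 v) <= C * cabs h ^+ 3 * hnorm v) ->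
  (forall h, cabs h <= d' ->
     hnorm (x (z + h) - x z - h *: x1 - h ^+ 2 *: x2) <= C' * cabs h ^+ 3) ->
  taylor2 (fun w => hdot (A w (x w)) g) z.
Proof.
move=> d0 d0' aM a1 a2 hA hx.
pose al0 v := hdot (A z v) g; pose al1 v := hdot (A1 v) g; pose al2 v := hdot (A2 v) g.
pose X := hnorm (x z) + hnorm x1 + hnorm x2 + `|C'|.
have M0 := blin_ge0 aM; have M0' := blin_ge0 a1.
have X0 : 0 <= X by rewrite !addr_ge0 ?hnorm_ge0.
exists (al0 x1 + al1 (x z)), (al0 x2 + al1 x1 + al2 (x z)),
  ((`|C| * X + (M + 2 * M') * `|C'|) * hnorm g + (cabs (al1 x2) + cabs (al2 x1) + cabs (al2 x2))), (Num.min 1 (Num.min d d')).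
split; first by rewrite !lt_min ltr01 d0.
move=> h; rewrite !le_min => /andP[h1 /andP[hd hd']]; have h0 := cabs_ge0 h.
have r2 : cabs h ^+ 2 <= 1 by rewrite exprn_ile1.
have r3 : cabs h ^+ 3 <= 1 by rewrite exprn_ile1.
have r30 : 0 <= cabs h ^+ 3 by rewrite exprn_ge0.
have up (u : R) : u * cabs h ^+ 3 <= `|u| * cabs h ^+ 3 by rewrite ler_wpM2r ?ler_norm.
set v := x (z + h); pose e := v - x z - h *: x1 - h ^+ 2 *: x2.
have eC : hnorm e <= `|C'| * cabs h ^+ 3 by exact: le_trans (hx h hd') (up C').
have vE : v = x z + h *: x1 + h ^+ 2 *: x2 + e.
  have -> : e = v - (x z + h *: x1 + h ^+ 2 *: x2) by rewrite /e !opprD !addrA.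
  by rewrite [RHS]addrC subrK.
have vX : hnorm v <= X.
  rewrite vE; apply: le_trans (hnormD _ _) _; apply: lerD; last first.
    by apply: le_trans eC _; rewrite ler_piMr.
  apply: le_trans (hnormD _ _) _; rewrite hnormZ cabsX; apply: lerD; last by rewrite ler_piMl ?hnorm_ge0.
  by apply: le_trans (hnormD _ _) _; rewrite hnormZ lerD // ler_piMl ?hnorm_ge0.
pose E := hdot (A (z + h) v - A z v - h *: A1 v - h ^+ 2 *: A2 v) g.
have lin (B : H -> H') N : blin B N -> hdot (B v) g =
    hdot (B (x z)) g + h * hdot (B x1) g + h ^+ 2 * hdot (B x2) g + hdot (B e) g.
  by move=> bB; rewrite vE !(blinD bB) !(blinZ bB) !hdotDl !hdotZl.
have EE : hdot (A (z + h) v) g = E + al0 v + h * al1 v + h ^+ 2 * al2 v.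
  by rewrite /E !hdotBl !hdotZl /al0 /al1 /al2; ring.
rewrite EE /al0 /al1 /al2 (lin _ _ aM) (lin _ _ a1) (lin _ _ a2) -/(al0 (x z)) -/(al1 (x z)) -/(al2 (x z)).
rewrite -/(al0 x1) -/(al1 x1) -/(al2 x1) -/(al0 x2) -/(al1 x2) -/(al2 x2) -/(al0 e) -/(al1 e) -/(al2 e).
set L := cabs _.
have -> : L = cabs (E + (al0 e + h * al1 e + h ^+ 2 * al2 e) + (al1 x2 + al2 x1 + h * al2 x2) * h ^+ 3).
  by congr cabs; ring.
apply: le_trans (cabsD _ _) _; rewrite [leRHS]mulrDl; apply: lerD; last first.
  rewrite cabsM cabsX ler_wpM2r //; apply: le_trans (cabsD _ _) _; apply: lerD; first exact: cabsD.
  by rewrite cabsM ler_piMl ?cabs_ge0.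
have g0 := hnorm_ge0 g.
have EC : cabs E <= `|C| * X * hnorm g * cabs h ^+ 3.
  apply: le_trans (hdot_CS _ _) _; rewrite mulrAC ler_wpM2r //.
  apply: le_trans (hA h v hd) _; apply: le_trans (ler_wpM2r (hnorm_ge0 _) (up C)) _.
  by rewrite mulrAC ler_wpM2r // ler_wpM2l.
have ab (B : H -> H') N : blin B N -> cabs (hdot (B e) g) <= N * `|C'| * hnorm g * cabs h ^+ 3.
  move=> bB; apply: le_trans (hdot_CS _ _) _; rewrite [leRHS]mulrAC ler_wpM2r //.
  apply: le_trans (blin_le bB e) _; rewrite -mulrA ler_wpM2l ?(blin_ge0 bB) //.
apply: le_trans (cabsD _ _) _.
have q0 := ab _ _ aM; have q1 := ab _ _ a1; have q2 := ab _ _ a2.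
have s1 : cabs (h * al1 e) <= cabs (al1 e) by rewrite cabsM ler_piMl ?cabs_ge0.
have s2 : cabs (h ^+ 2 * al2 e) <= cabs (al2 e) by rewrite cabsM cabsX ler_piMl ?cabs_ge0.
have := cabsD (al0 e + h * al1 e) (h ^+ 2 * al2 e); have := cabsD (al0 e) (h * al1 e).
rewrite -/(al0 e) in q0; rewrite -/(al1 e) in q1; rewrite -/(al2 e) in q2.
rewrite (_ : _ * cabs h ^+ 3 = `|C| * X * hnorm g * cabs h ^+ 3 + M * `|C'| * hnorm g * cabs h ^+ 3
  + 2 * (M' * `|C'| * hnorm g * cabs h ^+ 3)); last by ring.
lra.
Qed.

End Pairings.

(** * Interpolation *)

(** For estimates that hold up to a multiple of an arbitrarily small error. *)
Lemma le_of_small (R : realType) (x y K : R) :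
  (forall e, 0 < e -> e <= 1 -> x <= y + K * e) -> x <= y.
Proof.
move=> h; apply/ler_addgt0Pr => e e0.
have K1 : 0 < `|K| + 1 by rewrite ltr_wpDl.
pose d := Num.min 1 (e / (`|K| + 1)).
have d0 : 0 < d by rewrite lt_min ltr01 divr_gt0.
have d1 : d <= 1 by rewrite ge_min lexx.
have de : d * (`|K| + 1) <= e by rewrite -ler_pdivlMr // ge_min lexx orbT.
apply: le_trans (h d d0 d1) _; rewrite lerD2l.
by have := ler_norm K; nra.
Qed.

Section Interpolation.
Variables (R : realType) (H1 H2 : hilbertType R).
Variables (T1 : oper H1 H1) (T2 : oper H2 H2) (N1 N2 th1 th2 : R).
Variables (r1 : H1 -> H1) (P1 : R[i] -> H1 -> H1) (r2 : H2 -> H2) (P2 : R[i] -> H2 -> H2).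
Hypotheses (pf1 : power_family T1 N1 th1 r1 P1) (pf2 : power_family T2 N2 th2 r2 P2).
Hypotheses (N1_ge1 : 1 <= N1) (N2_ge1 : 1 <= N2) (th1_ge0 : 0 <= th1) (th2_ge0 : 0 <= th2).
Variables (b : H1 -> H2) (c : H2 -> H1) (Mb : R).
Hypothesis bM : blin b Mb.
Hypothesis bc : forall x g, hdot (r2 (b x)) g = hdot (r1 x) (c g).
Variable p : R.

(** What Schatten class membership means for the argument: a bound that is
    stable under bounded operators, through the Bessel constants. *)
Definition pairing_bound (Ha Hb : hilbertType R) (a : Ha -> Hb) (K : R) : Prop :=
  forall k (u : nat -> Ha) (v : nat -> Hb) (y : nat -> R) (c d : R), 0 < c -> 0 < d ->
      bessel k c u -> bessel k d v -> (forall i, 0 <= y i) -> \sum_(i < k) y i `^ p <= 1 ->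
      \sum_(i < k) y i `^ (p - 1) * cabs (hdot (a (u i)) (v i)) <= c * d * K.

Variables (K0 K1 : R).
Hypotheses (K0_gt0 : 0 < K0) (K1_gt0 : 0 < K1) (bK : pairing_bound b K0) (cK : pairing_bound c K1).

Variable s2 : H2 -> H2.
Hypothesis s2E : forall u v, hdot (r2 u) v = hdot u (s2 v).

(** T2^{-z} S T1^{-1+z} in the form that makes sense on the whole space, at the
    point with T1-image x. *)
Definition strip_op z x : H2 := P2 z (b (P1 (1 - z) x)).

Let F (u : H1) (v : H2) (w : R[i]) : R[i] := hdot (P2 (1 + w) (b (P1 (2 - w) u))) v.

Let Re2 : complex.Re (2 : R[i]) = 2. Proof. by rewrite -[2 : R[i]]/(1 + 1) ReD. Qed.
Let Im2 : complex.Im (2 : R[i]) = 0. Proof. by rewrite -[2 : R[i]]/(1 + 1) ImD /= addr0. Qed.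

Let FE u v w : 0 <= complex.Re w <= 1 -> F u v w = hdot (strip_op w (r1 u)) (s2 v).
Proof.
move=> /andP[w0 w1]; have w1' : 0 <= complex.Re (1 - w) by rewrite ReD ReN /= subr_ge0.
rewrite -s2E /strip_op (pf_shiftl pf2) // (pf_shift pf1) // /F (addrC 1 w).
by congr (hdot (P2 _ (b (P1 _ _))) _); ring.
Qed.

Let F_taylor u v w : 0 <= complex.Re w <= 1 -> taylor2 (F u v) w.
Proof.
move=> /andP[w0 w1].
have q1 : 0 < complex.Re (2 - w) by rewrite ReD ReN Re2; lra.
have q2 : 0 < complex.Re (1 + w) by rewrite ReD /=; lra.
have [A1 [A2 [M [C [d [d0 a1 a2 hA]]]]]] := pf_taylor pf1 q1.
have [B1 [B2 [M' [C' [d' [d0' b1 b2 hB]]]]]] := pf_taylor pf2 q2.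
have [M0 p20] := pf_blin pf2 (ltW q2).
apply: (@taylor2_pairing _ _ _ (fun w => P2 (1 + w)) (fun w => b (P1 (2 - w) u)) w B1 B2
   (b (- A1 u)) (b (A2 u)) M0 M' C' (Mb * (C * hnorm u)) d' d v) => //.
  by move=> h g hd; rewrite addrA; exact: hB.
move=> h hd; have := hA (- h) u; rewrite cabsN => /(_ hd) => hh.
have -> : b (P1 (2 - (w + h)) u) - b (P1 (2 - w) u) - h *: b (- A1 u) - h ^+ 2 *: b (A2 u)
   = b (P1 (2 - w - h) u - P1 (2 - w) u - (- h) *: A1 u - (- h) ^+ 2 *: A2 u).
  by rewrite opprD addrA !(blinB bM) !(blinZ bM) (blinN bM) scalerN scaleNr sqrrN.
apply: le_trans (blin_le bM _) _; rewrite -mulrA ler_wpM2l ?(blin_ge0 bM) //.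
by apply: le_trans hh _; rewrite mulrAC.
Qed.

Let F_growth : exists2 C, 0 <= C & forall u v w, 0 <= complex.Re w <= 1 ->
  cabs (F u v w) <= C * (hnorm u * hnorm v) * expR (2 * pi * `|complex.Im w|).
Proof.
have [C1 C10 h1] := pf_growth pf1; have [C2 C20 h2] := pf_growth pf2.
have Mb0 := blin_ge0 bM.
exists (C2 * (Mb * C1)); first by rewrite !mulr_ge0.
move=> u v w /andP[w0 w1].
have {}h1 : blin (P1 (2 - w)) (C1 * expR (pi * `|complex.Im w|)).
  have <- : `|complex.Im (2 - w)| = `|complex.Im w| by rewrite ImD ImN Im2 sub0r normrN.
  by apply: h1; rewrite ReD ReN Re2; lra.
have {}h2 : blin (P2 (1 + w)) (C2 * expR (pi * `|complex.Im w|)).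
  have <- : `|complex.Im (1 + w)| = `|complex.Im w| by rewrite ImD /= add0r.
  by apply: h2; rewrite ReD /=; lra.
set E := expR _ in h1 h2; have E0 : 0 <= E by exact: expR_ge0.
have -> : expR (2 * pi * `|complex.Im w|) = E * E by rewrite -expRD; congr expR; ring.
apply: le_trans (hdot_CS _ _) _.
have -> : C2 * (Mb * C1) * (hnorm u * hnorm v) * (E * E) = C2 * E * (Mb * (C1 * E * hnorm u)) * hnorm v by ring.
rewrite ler_wpM2r ?hnorm_ge0 //; apply: le_trans (blin_le h2 _) _; rewrite ler_wpM2l ?mulr_ge0 //.
by apply: le_trans (blin_le bM _) _; rewrite ler_wpM2l // (blin_le h1).
Qed.

Let adjoint_blin (a : H2 -> H2) M : blin a M ->
  exists a', blin a' M /\ forall u v, hdot (a u) v = hdot u (a' v).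
Proof. by move=> aM; have [a' [h1 h2 h3 h4]] := blin_adjoint aM; exists a'. Qed.

Section Test.
Variables (n : nat) (u : nat -> H1) (v : nat -> H2) (y : nat -> R) (cu cv : R).
Hypotheses (cu0 : 0 < cu) (cv0 : 0 < cv).
Hypotheses (bu : bessel n cu (fun i => r1 (r1 (u i)))) (bv : bessel n cv (fun i => s2 (v i))).
Hypotheses (y0 : forall i, 0 <= y i) (y1 : \sum_(i < n) y i `^ p <= 1).

Let E1 (t : R) := N1 * expR (th1 * `|t|).
Let E2 (t : R) := N2 * expR (th2 * `|t|).
Let E1_gt0 t : 0 < E1 t. Proof. by rewrite mulr_gt0 ?expR_gt0 //; exact: lt_le_trans N1_ge1. Qed.
Let E2_gt0 t : 0 < E2 t. Proof. by rewrite mulr_gt0 ?expR_gt0 //; exact: lt_le_trans N2_ge1. Qed.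

Let test_left w : complex.Re w = 0 -> \sum_(i < n) y i `^ (p - 1) * cabs (F (u i) (v i) w)
  <= N1 * N2 * cu * cv * K0 * expR ((th1 + th2) * `|complex.Im w|).
Proof.
move=> w0; have b1 : blin (P1 (- w)) (E1 (complex.Im w)).
  by have := pf_imag pf1 (z := - w); rewrite ReN w0 oppr0 ImN normrN; apply.
have [a [a2 aE]] := adjoint_blin (pf_imag pf2 w0).
have := bK (mulr_gt0 (E1_gt0 (complex.Im w)) cu0) (mulr_gt0 (E2_gt0 (complex.Im w)) cv0) (bessel_map b1 bu) (bessel_map a2 bv) y0 y1.
have -> : E1 (complex.Im w) * cu * (E2 (complex.Im w) * cv) * K0 =
    N1 * N2 * cu * cv * K0 * expR ((th1 + th2) * `|complex.Im w|).
  by rewrite /E1 /E2 mulrDl expRD; ring.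
apply: le_trans; rewrite le_eqVlt; apply/orP; left; apply/eqP; apply: eq_bigr => i _.
rewrite FE ?w0 ?lexx ?ler01 // /strip_op aE /=; congr (_ * cabs (hdot (b _) _)).
by rewrite [RHS](pf_shift pf1) ?ReN ?w0 ?oppr0 // addrC.
Qed.

Let test_right w : complex.Re w = 1 -> \sum_(i < n) y i `^ (p - 1) * cabs (F (u i) (v i) w)
  <= N1 * N2 * cu * cv * K1 * expR ((th1 + th2) * `|complex.Im w|).
Proof.
(* The line Re w = 1 is moved to the imaginary axis by giving one power of
   each inverse back to the operators b and c. *)
move=> w1; pose w' := w - 1.
have w0 : complex.Re w' = 0 by rewrite ReD ReN w1 /= subrr.
have wi : complex.Im w' = complex.Im w by rewrite ImD ImN /= oppr0 addr0.
have b1 : blin (P1 (- w')) (E1 (complex.Im w)).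
  by have := pf_imag pf1 (z := - w'); rewrite ReN w0 oppr0 ImN normrN wi; apply.
have [a [a2 aE]] := adjoint_blin (pf_imag pf2 w0); rewrite wi in a2.
have := cK (mulr_gt0 (E2_gt0 (complex.Im w)) cv0) (mulr_gt0 (E1_gt0 (complex.Im w)) cu0) (bessel_map a2 bv) (bessel_map b1 bu) y0 y1.
have -> : E2 (complex.Im w) * cv * (E1 (complex.Im w) * cu) * K1 =
    N1 * N2 * cu * cv * K1 * expR ((th1 + th2) * `|complex.Im w|).
  by rewrite /E1 /E2 mulrDl expRD; ring.
apply: le_trans; rewrite le_eqVlt; apply/orP; left; apply/eqP; apply: eq_bigr => i _.
have wE : w = w' + 1 by rewrite subrK.
have w'0 : 0 <= complex.Re w' by rewrite w0.
have w'0' : 0 <= complex.Re (- w') by rewrite ReN w0 oppr0.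
congr (_ * _); rewrite FE ?w1 ?lexx ?ler01 // /strip_op [in LHS]wE -(pf_shift pf2) // aE.
have -> : 1 - (w' + 1) = - w' by ring.
by rewrite bc (pf_shiftl pf1) // -(pf_shift pf1) // cabs_hdotC.
Qed.

(** The sum of matrix coefficients, with the phases fixed so that it is
    nonnegative at z, is analytic in the strip; on the boundary lines the
    imaginary powers are moved to the two families, where they only change the
    Bessel constants. On the line Re z = 1 the operator c takes the place of
    b. *)
Lemma strip_test k z : 0 < k -> 0 <= complex.Re z <= 1 ->
  \sum_(i < n) y i `^ (p - 1) * cabs (hdot (strip_op z (r1 (u i))) (s2 (v i))) <=
  cu * cv * (N1 * N2 * expR (k * complex.Im z ^+ 2 + k * complex.Re z * (1 - complex.Re z)
    + (4 * k)^-1 * (th1 + th2) ^+ 2) * (K0 `^ (1 - complex.Re z) * K1 `^ complex.Re z)).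
Proof.
move=> k0 hz.
have phase (s : R[i]) : exists2 q : R[i], cabs q = 1 & q * s = (cabs s)%:C.
  have [->|s0] := eqVneq s 0; first by exists 1; rewrite ?cabs1 // mulr0 cabs0.
  have cs := cabs_gt0 s0.
  exists (cj s * ((cabs s)^-1)%:C).
    by rewrite cabsM cabsJ cabsR gtr0_norm ?invr_gt0 // divff ?gt_eqF.
  by rewrite mulrAC (mulrC (cj s)) cabs_mulJ -rmorphM expr2 -mulrA divff ?gt_eqF // mulr1.
have [q q1 qE] : exists2 q : nat -> R[i], (forall i, cabs (q i) = 1) &
    forall i, q i * F (u i) (v i) z = (cabs (F (u i) (v i) z))%:C.
  have [q hq] := choice (fun i => let: ex_intro2 q a b := phase (F (u i) (v i) z) in ex_intro (fun q => cabs q = 1 /\ q * F (u i) (v i) z = (cabs (F (u i) (v i) z))%:C) q (conj a b)).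
  by exists q => i; case: (hq i).
(* The coefficients carry the phases that make every term nonnegative at z. *)
pose co i : R[i] := (y i `^ (p - 1))%:C * q i.
have coc i : cabs (co i) = y i `^ (p - 1) by rewrite cabsM q1 mulr1 cabsR ger0_norm ?powR_ge0.
pose G w := \sum_(i < n) co i * F (u i) (v i) w.
have Gle w : cabs (G w) <= \sum_(i < n) y i `^ (p - 1) * cabs (F (u i) (v i) w).
  by apply: le_trans (cabs_sum _) _; apply: ler_sum => i _; rewrite cabsM coc.
have GE : cabs (G z) = \sum_(i < n) y i `^ (p - 1) * cabs (F (u i) (v i) z).
  rewrite /G (eq_bigr (fun i : 'I_n => (y i `^ (p - 1) * cabs (F (u i) (v i) z))%:C)).
    by rewrite -rmorph_sum cabsR ger0_norm // sumr_ge0 // => i _; rewrite mulr_ge0 ?powR_ge0 ?cabs_ge0.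
  by move=> i _; rewrite /co -mulrA qE rmorphM.
have [C C0 hC] := F_growth.
pose D := \sum_(i < n) y i `^ (p - 1) * (C * (hnorm (u i) * hnorm (v i))).
have D0 : 0 <= D by apply: sumr_ge0 => i _; rewrite !mulr_ge0 ?powR_ge0 ?hnorm_ge0.
pose N := N1 * N2 * cu * cv.
have N0 : 0 < N by rewrite !mulr_gt0 //; [exact: lt_le_trans N1_ge1|exact: lt_le_trans N2_ge1].
have := @three_lines _ G (th1 + th2) k D (2 * pi) (N * K0) (N * K1) _ k0 D0 _ _ _ _ _ _ _ z hz.
rewrite GE (powRM _ (ltW N0) (ltW K0_gt0)) (powRM _ (ltW N0) (ltW K1_gt0)).
set X := expR _; set Y0 := K0 `^ _; set Y1 := K1 `^ _.
have NN : N `^ (1 - complex.Re z) * N `^ complex.Re z = N.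
  by rewrite -powRD ?subrK ?powRr1 ?(ltW N0) // (gt_eqF N0) implybT.
have -> : X * (N `^ (1 - complex.Re z) * Y0 * (N `^ complex.Re z * Y1)) =
   X * (N `^ (1 - complex.Re z) * N `^ complex.Re z) * (Y0 * Y1) by ring.
rewrite NN (_ : X * N * _ = cu * cv * (N1 * N2 * X * (Y0 * Y1))); last by rewrite /N; ring.
under eq_bigr do rewrite FE //.
apply.
- exact: addr_ge0.
- by rewrite mulr_ge0 ?pi_ge0.
- exact: mulr_gt0.
- exact: mulr_gt0.
- by move=> w hw; apply: taylor2_sum => i; exact: F_taylor.
- move=> w hw; apply: le_trans (Gle w) _; rewrite mulr_suml; apply: ler_sum => i _.
  by rewrite -mulrA ler_wpM2l ?powR_ge0 // hC.
- by move=> w w0; apply: le_trans (Gle w) (test_left w0).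
- by move=> w w1; apply: le_trans (Gle w) (test_right w1).
Qed.

End Test.
Variable Ms : R.
Hypothesis s2M : blin s2 Ms.
Hypothesis r1_dense : forall x (e : R), 0 < e -> exists u, hnorm (x - r1 u) < e.
Hypothesis r2_inj : forall v, r2 v = 0 -> v = 0.

(** The test vectors lie in the domain of T1^2, so that all powers that occur
    have exponents of positive real part. *)
Lemma r1_sqr_dense x (e : R) : 0 < e -> exists u, hnorm (x - r1 (r1 u)) < e.
Proof.
move=> e0; have [M rM] := pf_inv_blin pf1; have M0 := blin_ge0 rM.
have e2 : 0 < e / 2 by rewrite divr_gt0.
have [u hu] := r1_dense x e2.
have q : 0 < e / 2 / (M + 1) by rewrite divr_gt0 // ltr_wpDl.
have [w] := r1_dense u q; rewrite ltr_pdivlMr ?ltr_wpDl // => hw; exists w.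
apply: le_lt_trans (hnorm_dist3 (r1 u) _ _) _.
rewrite -(blinB rM).
have := blin_le rM (u - r1 w); have := hnorm_ge0 (u - r1 w); lra.
Qed.

(** Orthogonality to the range of the adjoint of r2 means being in the kernel
    of r2. *)
Lemma s2_dense x (e : R) : 0 < e -> exists v, hnorm (x - s2 v) < e.
Proof.
move=> e0; have [||_ [v _ <-] hv] := @dense_of_orthogonal _ _ [set s2 v | v in setT] _ _ x e e0; last by exists v.
- split; first by exists 0; rewrite ?(blin0 s2M).
  by move=> k _ _ [u _ <-] [v _ <-]; exists (k *: u + v); rewrite ?(blin_lin s2M).
- move=> w hw; apply: r2_inj; apply: hdot_inj => g; rewrite s2E hdot0l; apply: hw.
  by exists g.
Qed.

Section Bounds.
Variables (k : R) (z : R[i]).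
Hypotheses (k0 : 0 < k) (hz : 0 <= complex.Re z <= 1).

Let W := N1 * N2 * expR (k * complex.Im z ^+ 2 + k * complex.Re z * (1 - complex.Re z)
    + (4 * k)^-1 * (th1 + th2) ^+ 2) * (K0 `^ (1 - complex.Re z) * K1 `^ complex.Re z).

Let W0 : 0 <= W.
Proof.
rewrite !mulr_ge0 ?expR_ge0 ?powR_ge0 //.
  exact: le_trans ler01 N1_ge1.
exact: le_trans ler01 N2_ge1.
Qed.

Lemma strip_blin : exists M, blin (strip_op z) M.
Proof.
have [z0 z1] := andP hz; have z1' : 0 <= complex.Re (1 - z) by rewrite ReD ReN /= subr_ge0.
have [M1 m1] := pf_blin pf1 z1'; have [M2 m2] := pf_blin pf2 z0.
exists (M2 * (Mb * M1)); split => [|d x y|x].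
- by rewrite !mulr_ge0 ?(blin_ge0 m1) ?(blin_ge0 m2) ?(blin_ge0 bM).
- by rewrite /strip_op (blin_lin m1) (blin_lin bM) (blin_lin m2).
- apply: le_trans (blin_le m2 _) _; rewrite -!mulrA ler_wpM2l ?(blin_ge0 m2) //.
  apply: le_trans (blin_le bM _) _; rewrite ler_wpM2l ?(blin_ge0 bM) //.
  exact: blin_le m1 x.
Qed.

Let strip_core u v :
  cabs (hdot (strip_op z (r1 u)) (s2 v)) <= W * hnorm (r1 (r1 u)) * hnorm (s2 v).
Proof.
set f := r1 (r1 u); set h := s2 v.
have [f0 h0] := (hnorm_ge0 f, hnorm_ge0 h).
apply: (@le_of_small _ _ _ (W * (hnorm f + hnorm h + 1))) => e e0 e1.
have b1 (H : hilbertType R) (x : H) : bessel 1 (hnorm x + e) (fun=> x).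
  move=> w; rewrite big_ord_recl big_ord0 addr0 -exprMn lerXn2r ?nnegrE ?cabs_ge0 ?mulr_ge0 ?hnorm_ge0 //.
    by rewrite addr_ge0 ?hnorm_ge0 // ltW.
  by apply: le_trans (hdot_CS _ _) _; rewrite ler_wpM2r ?hnorm_ge0 // lerDl ltW.
have c0 (H : hilbertType R) (x : H) : 0 < hnorm x + e by rewrite ltr_wpDl ?hnorm_ge0.
have := @strip_test 1 (fun=> u) (fun=> v) (fun=> 1) _ _ (c0 _ f) (c0 _ h) (b1 _ f) (b1 _ h) (fun=> ler01) _ k z k0 hz.
rewrite -/W !big_ord_recl !big_ord0 !addr0 !powR1 mul1r => /(_ (lexx _)) /le_trans; apply.
have := mulr_ge0 (mulr_ge0 W0 (ltW e0)) (eqbRL (subr_ge0 _ _) e1); lra.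
Qed.

(** A single pair of test vectors gives the bound of the sesquilinear form on
    dense subspaces. *)
Lemma strip_bound x : hnorm (strip_op z x) <= W * hnorm (r1 x).
Proof.
have [M sM] := strip_blin; have [Mr rM] := pf_inv_blin pf1.
have range u : hnorm (strip_op z (r1 u)) <= W * hnorm (r1 (r1 u)).
  set X := strip_op _ _; set f := r1 (r1 u); have f0 := hnorm_ge0 f.
  apply: hnorm_sup => [|y]; first exact: mulr_ge0.
  apply: (@le_of_small _ _ _ (W * hnorm f + hnorm X)) => e e0 _.
  have [v hv] := s2_dense y e0.
  have -> : hdot X y = hdot X (s2 v) + hdot X (y - s2 v) by rewrite hdotBr addrC subrK.
  apply: le_trans (cabsD _ _) _.
  have t1 := strip_core u v; have t2 := hdot_CS X (y - s2 v).
  have t3 : hnorm (s2 v) <= hnorm y + hnorm (y - s2 v).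
    by have := hnormD y (s2 v - y); rewrite addrC subrK [hnorm (s2 v - y)]hnorm_subC.
  have t4 := ler_wpM2l (mulr_ge0 W0 f0) t3.
  have t5 := ler_wpM2l (mulr_ge0 W0 f0) (ltW hv).
  have t6 := ler_wpM2l (hnorm_ge0 X) (ltW hv).
  rewrite -/X -/f in t1; lra.
apply: (@le_of_small _ _ _ (W * Mr + M)) => e e0 _.
have [u hu] := r1_dense x e0.
have t1 : hnorm (strip_op z x) <= hnorm (strip_op z (r1 u)) + M * hnorm (x - r1 u).
  have := hnorm_dist3 (strip_op z (r1 u)) (strip_op z x) 0; rewrite !subr0.
  by have := blin_le sM (x - r1 u); rewrite (blinB sM); lra.
have t2 : hnorm (r1 (r1 u)) <= hnorm (r1 x) + Mr * hnorm (x - r1 u).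
  have := hnorm_dist3 (r1 x) (r1 (r1 u)) 0; rewrite !subr0 [hnorm (r1 (r1 u) - _)]hnorm_subC.
  by have := blin_le rM (x - r1 u); rewrite (blinB rM); lra.
have t3 := ler_wpM2l W0 t2; have t4 := range u.
have t5 := ler_wpM2l (mulr_ge0 W0 (blin_ge0 rM)) (ltW hu).
have t6 := ler_wpM2l (blin_ge0 sM) (ltW hu).
lra.
Qed.

(** Orthonormal families are approximated by test vectors; their Bessel
    constants then tend to one. *)
Lemma strip_dual a (Wa : R) : blin a Wa -> (forall x, a (r1 x) = strip_op z x) ->
  dual_bound p W a.
Proof.
move=> aW aE n u v y [ou u1] [ov v1] y0 y1.
have bu := orthonormal_bessel (conj ou u1); have bv := orthonormal_bessel (conj ov v1).
have Wa0 := blin_ge0 aW.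
pose S := \sum_(i < n) y i `^ (p - 1).
apply: (@le_of_small _ _ _ (W * (1 + 2 * n%:R) + S * (3 * Wa))) => e e0 e1.
have [f hf] := choice (fun i => r1_sqr_dense (u i) e0).
have [g hg] := choice (fun i => s2_dense (v i) e0).
pose f' i := r1 (r1 (f i)); pose g' i := s2 (g i).
pose ce := Num.sqrt (1 + (1 + 2 * n%:R) * e).
have n0 : 0 <= n%:R :> R by [].
have ne : 0 <= (1 + 2 * n%:R) * e by rewrite mulr_ge0 ?(ltW e0) // addr_ge0 // mulr_ge0.
have ce0 : 0 < ce by rewrite sqrtr_gt0 ltr_wpDr.
have ce2 : ce * ce = 1 + (1 + 2 * n%:R) * e by rewrite -expr2 sqr_sqrtr // addr_ge0.
have pert (H : hilbertType R) (w w' : nat -> H) : bessel n 1 w -> (forall i, hnorm (w i - w' i) < e) ->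
    bessel n ce w'.
  move=> bw ww' h; have ww i : (i < n)%N -> hnorm (w' i - w i) <= e by rewrite hnorm_subC => _; exact: ltW.
  apply: le_trans (bessel_perturb ler01 e0 bw ww h) _.
  rewrite ler_wpM2r ?sqr_ge0 // [leRHS]expr2 ce2 sqr_sqrtr; last first.
    by rewrite !addr_ge0 ?mulr_ge0 ?addr_ge0 ?sqr_ge0 ?(ltW e0).
  have : n%:R * e ^+ 2 <= n%:R * e by rewrite ler_wpM2l // expr2 ler_piMr // ltW.
  rewrite expr1n; lra.
have bf := pert _ _ f' bu hf; have bg := pert _ _ g' bv hg.
have := strip_test ce0 ce0 bf bg y0 y1 k0 hz; rewrite -/W ce2 => test.
have pc (i : 'I_n) : cabs (hdot (a (u i)) (v i)) <= cabs (hdot (strip_op z (r1 (f i))) (s2 (g i))) + 3 * Wa * e.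
  rewrite -aE -/(f' i) -/(g' i).
  have -> : hdot (a (u i)) (v i) = hdot (a (f' i)) (g' i) + (hdot (a (u i - f' i)) (v i) + hdot (a (f' i)) (v i - g' i)).
    by rewrite (blinB aW) hdotBl hdotBr; ring.
  apply: le_trans (cabsD _ _) _; rewrite lerD2l; apply: le_trans (cabsD _ _) _.
  have d1 := le_trans (hdot_CS (a (u i - f' i)) (v i)) (ler_wpM2r (hnorm_ge0 _) (blin_le aW _)).
  have d2 := le_trans (hdot_CS (a (f' i)) (v i - g' i)) (ler_wpM2r (hnorm_ge0 _) (blin_le aW _)).
  rewrite v1 // mulr1 in d1.
  have fn : hnorm (f' i) <= 2.
    have := hnorm_dist3 (u i) (f' i) 0; rewrite !subr0 u1 // hnorm_subC.
    by have := hf i; rewrite -/(f' i); lra.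
  have d3 : Wa * hnorm (f' i) * hnorm (v i - g' i) <= Wa * 2 * e.
    by rewrite ler_pM ?mulr_ge0 ?hnorm_ge0 ?ler_wpM2l // ltW // hg.
  have d4 : Wa * hnorm (u i - f' i) <= Wa * e by rewrite ler_wpM2l // ltW // hf.
  lra.
apply: le_trans (_ : \sum_(i < n) (y i `^ (p - 1) * cabs (hdot (strip_op z (r1 (f i))) (s2 (g i)))
    + y i `^ (p - 1) * (3 * Wa * e)) <= _).
  by apply: ler_sum => i _; rewrite -mulrDr ler_wpM2l ?powR_ge0.
rewrite big_split /= -mulr_suml -/S; apply: le_trans (lerD test (lexx _)) _.
by rewrite le_eqVlt; apply/orP; left; apply/eqP; ring.
Qed.

End Bounds.
End Interpolation.

(** * From the dense domain to the closure *)

Section Closure.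
Variables (R : realType) (H1 H2 : hilbertType R).

Lemma dense_approx (D : set H1) : dense D ->
  forall x (e : R), 0 < e -> exists2 y, D y & hnorm (x - y) < e.
Proof.
move=> Dd x e e0; have b0 : nbhs x (ball x e%:C) by apply: nbhsx_ballx; rewrite ltcR.
have [|y [/interior_subset xy Dy]] := Dd (ball x e%:C)° _ (open_interior _); first by exists x.
by exists y => //; apply/ball_hnorm.
Qed.

(** For r the inverse of an unbounded operator, this passes from an operator
    given on the domain of the latter to its closure: a bound on a dense
    domain extends. *)
Lemma closure_of_bounded_on_range (A : oper H1 H2) (r : H1 -> H1) (s : H1 -> H2) (M N W : R) :
  blin r M -> blin s N -> 0 <= W ->
  (forall x (e : R), 0 < e -> exists u, hnorm (x - r u) < e) ->
  (forall x, r x = 0 -> x = 0) ->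
  (forall f h, A (f, h) <-> exists x, f = r x /\ h = s x) ->
  (forall x, hnorm (s x) <= W * hnorm (r x)) ->
  exists a, [/\ blin a W, linear_oper A, closure A = graph a & forall x, a (r x) = s x].
Proof.
move=> rM sN W0 rd ri AE sW.
have Alin : linear_oper A.
  split.
  - by apply/AE; exists 0; rewrite (blin0 rM) (blin0 sN).
  - move=> c [f1 h1] [f2 h2] /AE[x [-> ->]] /AE[y [-> ->]]; apply/AE; exists (c *: x + y).
    by rewrite (blin_lin rM) (blin_lin sN).
  - move=> f g h /AE[x [-> ->]] /AE[y [e ->]].
    suff -> : x = y by [].
    by apply/eqP; rewrite -subr_eq0; apply/eqP/ri; rewrite (blinB rM) e subrr.
have [a [aW aE]] : exists a, blin a W /\ closure A = graph a.
  apply: closure_bounded => //.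
    move=> x e e0; have [u hu] := rd x e e0; exists (r u) => //.
    by exists (r u, s u) => //; apply/AE; exists u.
  by move=> f g /AE[x [-> ->]].
exists a; split => // x.
have : closure A (r x, s x) by apply: subset_closure; apply/AE; exists x.
by rewrite aE.
Qed.

(** The bound is applied to a single pair of vectors. *)
Lemma pairing_bound0 (p : R) (a : H1 -> H2) : pairing_bound p a 0 -> forall x, a x = 0.
Proof.
move=> h x; apply: hdot_inj => y; rewrite hdot0l; apply: cabs_eq0.
apply/eqP; rewrite eq_le cabs_ge0 andbT.
have b1 (H : hilbertType R) (z : H) : bessel 1 (hnorm z + 1) (fun=> z).
  move=> w; rewrite big_ord_recl big_ord0 addr0 -exprMn lerXn2r ?nnegrE ?cabs_ge0 ?mulr_ge0 ?hnorm_ge0 //.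
    by rewrite addr_ge0 ?hnorm_ge0.
  by apply: le_trans (hdot_CS _ _) _; rewrite ler_wpM2r ?hnorm_ge0 // lerDl.
have c0 (H : hilbertType R) (z : H) : 0 < hnorm z + 1 by rewrite ltr_wpDl ?hnorm_ge0.
have := h 1%N (fun=> x) (fun=> y) (fun=> 1) _ _ (c0 _ x) (c0 _ y) (b1 _ x) (b1 _ y) (fun=> ler01).
by rewrite !big_ord_recl !big_ord0 !addr0 !powR1 mul1r mulr0 => /(_ (lexx _)).
Qed.

Lemma dual_bound_le (p K L : R) (a : H1 -> H2) : K <= L -> dual_bound p K a -> dual_bound p L a.
Proof. by move=> KL h k u v y ou ov y0 y1; exact: le_trans (h k u v y ou ov y0 y1) KL. Qed.

(** The best k would be th / (2 sqrt q); it is perturbed so as to stay positive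
    and finite. *)
Lemma optimal_gauss (X Y th q : R) : 0 <= Y -> 0 <= th -> 0 <= q ->
  (forall k, 0 < k -> X <= expR (k * q + (4 * k)^-1 * th ^+ 2) * Y) ->
  X <= expR (th * Num.sqrt q) * Y.
Proof.
move=> Y0 th0 q0 hX; set s := Num.sqrt q; have s0 : 0 <= s by exact: sqrtr_ge0.
have qE : q = s ^+ 2 by rewrite sqr_sqrtr.
pose L := (s + th) / 2; have L0 : 0 <= L by rewrite divr_ge0 // addr_ge0.
have key e : 0 < e -> X <= expR (th * s) * Y * expR (L * e).
  move=> e0; have te : 0 < th + e by rewrite ltr_wpDl.
  have se : 0 < s + e by rewrite ltr_wpDl.
  (* The critical point th / (2 s) of k s^2 + th^2 / (4 k), moved away from
     0 and infinity. *)
  pose k := (th + e) / (2 * (s + e)).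
  have k0 : 0 < k by rewrite divr_gt0 // mulr_gt0.
  apply: le_trans (hX k k0) _; rewrite [leRHS]mulrAC -expRD ler_wpM2r // ler_expR qE.
  have h1 : k * s ^+ 2 <= (th + e) * s / 2.
    rewrite /k mulrAC ler_pdivrMr ?mulr_gt0 //.
    have : 0 <= (th + e) * (s * e) by rewrite !mulr_ge0 // ltW.
    by rewrite expr2; lra.
  have h2 : (4 * k)^-1 * th ^+ 2 <= th * (s + e) / 2.
    have -> : (4 * k)^-1 * th ^+ 2 = (s + e) * th ^+ 2 / (2 * (th + e)).
      by rewrite /k; field; rewrite !gt_eqF.
    rewrite ler_pdivrMr ?mulr_gt0 //.
    have : 0 <= th * (s + e) * e by rewrite !mulr_ge0 // ltW.
    by rewrite expr2; lra.
  by rewrite /L; lra.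
set Z := expR _ * Y in key *; have Z0 : 0 <= Z by rewrite mulr_ge0 ?expR_ge0.
apply: (@le_of_small _ _ _ (2 * Z * L * expR L)) => e e0 e1.
apply: le_trans (key e e0) _.
have le0 : 0 <= L * e by rewrite mulr_ge0 // ltW.
have [+ _ _] := cexp_taylor (L * e)%:C.
rewrite cabsR ger0_norm // => h.
have : expR (L * e) - 1 <= cabs (cexp (L * e)%:C - 1).
  have -> : cexp (L * e)%:C = (expR (L * e))%:C :> R[i].
    by apply: complex_ext; rewrite ?Re_cexp ?Im_cexp /= ?cos0 ?sin0 ?mulr1 ?mulr0.
  by rewrite -rmorphB cabsR ler_norm.
have : expR (L * e) <= expR L by rewrite ler_expR ler_piMr.
move: h; set u := expR (L * e); set v := expR L; set w := cabs _ => h uv hw.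
have : 2 * (L * e) * u <= 2 * (L * e) * v by rewrite ler_wpM2l // mulr_ge0.
move=> h3; have : u <= 1 + 2 * (L * e) * v by lra.
by move/(ler_wpM2l Z0); lra.
Qed.

End Closure.

(** * The operators on the closed strip *)

Section StripClosure.
Variables (R : realType) (H1 H2 : hilbertType R).
Variables (T1 : oper H1 H1) (T2 : oper H2 H2) (S : oper H1 H2).
Variables (N1 N2 th1 th2 p K0 K1 : R).
Variables (r1 : H1 -> H1) (P1 : R[i] -> H1 -> H1) (r2 : H2 -> H2) (P2 : R[i] -> H2 -> H2).
Hypotheses (pf1 : power_family T1 N1 th1 r1 P1) (pf2 : power_family T2 N2 th2 r2 P2).
Hypotheses (N1_ge1 : 1 <= N1) (N2_ge1 : 1 <= N2) (th1_ge0 : 0 <= th1) (th2_ge0 : 0 <= th2).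
Hypotheses (linT1 : linear_oper T1) (linT2 : linear_oper T2) (linS : linear_oper S).
Hypothesis denseT1 : dense (dom T1).
Variables (b : H1 -> H2) (c : H2 -> H1) (Mb : R).
Hypotheses (bM : blin b Mb) (bE : forall f g, (S \; T1^-1)%relation (f, g) <-> g = b f).
Hypothesis cE : forall f g, (adjoint S \; (adjoint T2)^-1)%relation (f, g) <-> g = c f.
Hypotheses (K0_ge0 : 0 <= K0) (K1_ge0 : 0 <= K1).
Hypotheses (bK : pairing_bound p b K0) (cK : pairing_bound p c K1).

Let T1r x : T1 (r1 x, x). Proof. exact/(pf_inv pf1). Qed.
Let T2r x : T2 (r2 x, x). Proof. exact/(pf_inv pf2). Qed.

Let r1_inj x : r1 x = 0 -> x = 0.
Proof. by have [T0 _ Tf] := linT1; move=> x0; apply: (Tf 0) => //; rewrite -{1}x0. Qed.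

Let r2_inj x : r2 x = 0 -> x = 0.
Proof. by have [T0 _ Tf] := linT2; move=> x0; apply: (Tf 0) => //; rewrite -{1}x0. Qed.

Let Sb x : S (r1 x, b x).
Proof. by have /(bE _ _).2[u /= /(pf_inv pf1) <-] : b x = b x by []. Qed.

Let bc x g : hdot (r2 (b x)) g = hdot (r1 x) (c g).
Proof.
have /(cE _ _).2[v /= Tv Sv] : c g = c g by [].
by rewrite -(Sv _ _ (Sb x)) /= (Tv _ _ (T2r (b x))).
Qed.

Let r1_dense x (e : R) : 0 < e -> exists u, hnorm (x - r1 u) < e.
Proof.
move=> e0; have [_ [[f g] /= /(pf_inv pf1) -> <-] h] := dense_approx denseT1 x e0.
by exists g.
Qed.

Let b_eq0 : K0 = 0 \/ K1 = 0 -> forall x, b x = 0.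
Proof.
case=> e x; first by apply: (@pairing_bound0 _ _ _ p) => //; rewrite -e.
apply: r2_inj; apply: hdot_inj => g; rewrite bc hdot0l (@pairing_bound0 _ _ _ p c) ?hdot0r //.
by rewrite -e.
Qed.

Let P (z : R[i]) : oper H1 H2 := (neg_power T2 z \; S \; neg_power T1 (1 - z))%relation.
Let A (z : R[i]) : oper H1 H2 := restrict_dom (P z) (dom T1).

Let AE z f h : 0 <= complex.Re z <= 1 ->
  A z (f, h) <-> exists x, f = r1 x /\ h = strip_op P1 P2 b z x.
Proof.
move=> /andP[z0 z1]; have z1' : 0 <= complex.Re (1 - z) by rewrite ReD ReN /= subr_ge0.
have comm x : P1 (1 - z) (r1 x) = r1 (P1 (1 - z) x).
  by rewrite (pf_shift pf1) // (pf_shiftl pf1).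
rewrite /A /P /restrict_dom (pf_graph pf1 z1') (pf_graph pf2 z0); split.
  move=> [] /= [v [u /= Pu Sv] hE] [[f' x] /= /(pf_inv pf1) fx e].
  have {Pu} : u = P1 (1 - z) f := Pu; have {hE} -> : h = P2 z v := hE.
  rewrite -e fx comm => uE; exists x; split => //; rewrite /strip_op; congr (P2 z _).
  have [_ _ Sf] := linS; apply: (Sf (r1 (P1 (1 - z) x))) => //.
  by rewrite -uE.
move=> [x [-> ->]]; split; last by exists (r1 x, x).
exists (b (P1 (1 - z) x)) => //; exists (P1 (1 - z) (r1 x)) => //=.
by rewrite comm.
Qed.

(** If one of the two bounds is zero then so is S on the domain of T1, and all
    the operators vanish; otherwise this is the interpolation estimate. *)
Lemma strip_closure z : 0 <= complex.Re z <= 1 ->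
  [/\ dom T1 `<=` dom (P z), linear_oper (A z) & exists a M, [/\ blin a M, closure (A z) = graph a &
    forall k, 0 < k -> dual_bound p (N1 * N2 * expR (k * complex.Im z ^+ 2 + k * complex.Re z * (1 - complex.Re z)
    + (4 * k)^-1 * (th1 + th2) ^+ 2) * (K0 `^ (1 - complex.Re z) * K1 `^ complex.Re z)) a]].
Proof.
move=> hz; have AzE f h := AE f h hz.
have domP : dom T1 `<=` dom (P z).
  move=> _ [[f x] /= /(pf_inv pf1) -> <-].
  have [|Pz _] := (AzE (r1 x) (strip_op P1 P2 b z x)).2 _; first by exists x.
  by exists (r1 x, strip_op P1 P2 b z x).
have [Mr rM] := pf_inv_blin pf1.
have [M2 r2M] := pf_inv_blin pf2.
have [s2 [Ms0 sl sM sE]] := blin_adjoint r2M.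
have s2M : blin s2 M2 by [].
have [M sM'] := strip_blin pf1 pf2 bM hz.
have [bz|[K00 K10]] : (forall x, b x = 0) \/ (0 < K0 /\ 0 < K1).
  have [e0|n0] := eqVneq K0 0; first by left; apply: b_eq0; left.
  have [e1|n1] := eqVneq K1 0; first by left; apply: b_eq0; right.
  by right; rewrite !lt_neqAle eq_sym n0 eq_sym n1.
- have s0 x : strip_op P1 P2 b z x = 0.
    have [M3 m3] : exists M, blin (P2 z) M by apply: (pf_blin pf2); case/andP: hz.
    by rewrite /strip_op bz (blin0 m3).
  have [|a [a0 lA cA _]] := closure_of_bounded_on_range rM sM' (lexx 0) r1_dense r1_inj AzE.
    by move=> x; rewrite s0 hnorm0 mul0r.
  split => //; exists a, 0; split => // k k0.
  have az x : a x = 0.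
    by apply: hnorm_eq0; apply/eqP; rewrite eq_le hnorm_ge0 andbT -(mul0r (hnorm x)) (blin_le a0).
  apply: (@dual_bound_le _ _ _ p 0); last first.
    move=> n u v y _ _ _ _; apply: sumr_le0 => i _.
    by rewrite az hdot0l cabs0 mulr0.
  rewrite !mulr_ge0 ?expR_ge0 ?powR_ge0 //.
    exact: le_trans ler01 N1_ge1.
  exact: le_trans ler01 N2_ge1.
have bound := strip_bound pf1 pf2 N1_ge1 N2_ge1 th1_ge0 th2_ge0 bM bc K00 K10 bK cK sE s2M r1_dense r2_inj ltr01 hz.
have W0 : 0 <= N1 * N2 * expR (1 * complex.Im z ^+ 2 + 1 * complex.Re z * (1 - complex.Re z)
    + (4 * 1)^-1 * (th1 + th2) ^+ 2) * (K0 `^ (1 - complex.Re z) * K1 `^ complex.Re z).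
  rewrite !mulr_ge0 ?expR_ge0 ?powR_ge0 //.
    exact: le_trans ler01 N1_ge1.
  exact: le_trans ler01 N2_ge1.
have [a [aW lA cA aE]] := closure_of_bounded_on_range rM sM' W0 r1_dense r1_inj AzE bound.
split => //; eexists; eexists; split; [exact: aW|exact: cA|] => k k0.
exact: (strip_dual pf1 pf2 N1_ge1 N2_ge1 th1_ge0 th2_ge0 bM bc K00 K10 bK cK sE s2M r1_dense r2_inj k0 hz aW aE).
Qed.

End StripClosure.
Theorem corollary4p8 (R : realType) (H1 H2 : hilbertType R)
    (sepH1 : separable_space H1) (sepH2 : separable_space H2)
    (T1 : oper H1 H1) (T2 : oper H2 H2) (S : oper H1 H2)
    (sectT1 : sectorial T1) (sectT2 : sectorial T2)
    (invT1 : bounded_oper (T1^-1)%relation)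
    (invT2 : bounded_oper (T2^-1)%relation)
    (closedS : closed_oper S)
    (domS : dom T1 `<=` dom S)
    (domS' : dom (adjoint T2) `<=` dom (adjoint S))
    (p : R) (p1 : 1 <= p)
    (SpS : schatten p (S \; T1^-1)%relation)
    (SpS' : schatten p (adjoint S \; (adjoint T2)^-1)%relation)
    (N1 N2 theta1 theta2 : R)
    (N1_ge1 : 1 <= N1) (N2_ge1 : 1 <= N2)
    (theta1_ge0 : 0 <= theta1) (theta2_ge0 : 0 <= theta2)
    (bipT1 : BIP T1 N1 theta1) (bipT2 : BIP T2 N2 theta2) :
  (* P z = T2^{-z} S T1^{-1+z} with its maximal domain *)
  let P (z : R[i]) : oper H1 H2 :=
    (neg_power T2 z \; S \; neg_power T1 (1 - z))%relation in
  let A (z : R[i]) : oper H1 H2 := restrict_dom (P z) (dom T1) in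
  [/\ forall z : R[i], 0 <= complex.Re z <= 1 ->
        [/\ dom T1 `<=` dom (P z), closable (A z) &
            schatten p (closure (A z))],
      forall (k : R) (z : R[i]), 0 < k -> 0 <= complex.Re z <= 1 ->
        let x := complex.Re z in
        let y := complex.Im z in
        (schatten_norm p (closure (A z)) <=
         (N1 * N2 * expR (k * y ^+ 2 + k * x * (1 - x)
                          + (4 * k)^-1 * (theta1 + theta2) ^+ 2))%:E
         * schatten_norm p (S \; T1^-1)%relation `^ (1 - x)
         * schatten_norm p (adjoint S \; (adjoint T2)^-1)%relation `^ x)%E &
      forall x : R, 0 <= x <= 1 ->
        (schatten_norm p (closure (A x%:C)) <=
         (N1 * N2 * expR ((theta1 + theta2) * Num.sqrt (x * (1 - x))))%:E
         * schatten_norm p (S \; T1^-1)%relation `^ (1 - x)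
         * schatten_norm p (adjoint S \; (adjoint T2)^-1)%relation `^ x)%E].
Proof.
move=> P A.
have [_ _ [w sw]] := sectT1.
have N10 := le_trans ler01 N1_ge1; have N20 := le_trans ler01 N2_ge1.
have [r1 [P1 pf1]] := bip_power_family N10 bipT1.
have [r2 [P2 pf2]] := bip_power_family N20 bipT2.
have [[linT1 _] denseT1 _] := sectT1; have [[linT2 _] _ _] := sectT2; have [linS _] := closedS.
have [b [Mb [K0 [bM bE K00 nb bK]]]] := schatten_pairing p1 SpS.
have [c [Mc [K1 [_ cE K10 nc cK]]]] := schatten_pairing p1 SpS'.
have main := strip_closure pf1 pf2 N1_ge1 N2_ge1 theta1_ge0 theta2_ge0 linT1 linT2 linS denseT1
  bM bE cE K00 K10 bK cK.
have norm_le (k : R) (z : R[i]) : 0 < k -> 0 <= complex.Re z <= 1 ->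
    schatten p (closure (A z)) /\ (schatten_norm p (closure (A z)) <=
      (N1 * N2 * expR (k * complex.Im z ^+ 2 + k * complex.Re z * (1 - complex.Re z)
         + (4 * k)^-1 * (theta1 + theta2) ^+ 2) * (K0 `^ (1 - complex.Re z) * K1 `^ complex.Re z))%:E)%E.
  move=> k0 hz; have [_ _ [a [M [aM -> ab]]]] := main z hz.
  exact: (dual_bound_schatten aM p1 (ab k k0)).
split=> [z hz|k z k0 hz|x hx].
- have [domP lA [a [M [aM cA _]]]] := main z hz.
  split => //; last exact: (norm_le 1 z ltr01 hz).1.
  split => //; rewrite cA; exact: linear_oper_graph aM.
- have [_ h] := norm_le k z k0 hz; apply: le_trans h _.
  by rewrite nb nc !poweR_EFin -!EFinM lee_fin mulrA.
- have hz : 0 <= complex.Re (x%:C : R[i]) <= 1 by [].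
  have [[_ fin] _] := norm_le 1 x%:C ltr01 hz.
  have [X [X0 nX _]] := schatten_norm_sums p1 fin.
  rewrite nb nc nX !poweR_EFin -!EFinM lee_fin.
  have [x0 x1] := andP hx.
  have q0 : 0 <= x * (1 - x) by rewrite mulr_ge0 // subr_ge0.
  pose Y := N1 * N2 * (K0 `^ (1 - x) * K1 `^ x).
  have Y0 : 0 <= Y by rewrite !mulr_ge0 ?powR_ge0.
  have := @optimal_gauss _ X Y (theta1 + theta2) (x * (1 - x)) Y0 (addr_ge0 theta1_ge0 theta2_ge0) q0.
  have -> : N1 * N2 * expR ((theta1 + theta2) * Num.sqrt (x * (1 - x))) * K0 `^ (1 - x) * K1 `^ x
     = expR ((theta1 + theta2) * Num.sqrt (x * (1 - x))) * Y by rewrite /Y; ring.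
  apply => k k0; have [_] := norm_le k x%:C k0 hz.
  rewrite nX lee_fin /= expr0n /= mulr0 add0r mulrA => /le_trans; apply.
  by rewrite /Y [k * (x * _)]mulrA le_eqVlt; apply/orP; left; apply/eqP; ring.
Qed.
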